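(* Let $\bar p\in M$ be a Pareto critical point of $F$ and suppose that $F$ is quasi-convex around $\bar p$. Then, for any $\delta>0$, there exist $\bar\delta,\hat\delta>0$ satisfying $\bar\delta<\hat\delta<\frac{\delta}{2}$ such that, for any sequence $\{p_k\}$ generated by the inexact descent algorithm (with associated step sizes $\{t_k\}$ and directions $\{v_k\}$, each $v_k$ being s-compatible at $p_k$) with initial point $p_0\in\mathbb{B}(\bar p,\bar\delta)$, if $$\lim_{k\to+\infty}F(p_k)\succeq F(\bar p),$$ then the following assertions hold: (i) The sequence $\{p_k\}$ stays in $\mathbb{B}(\bar p,\hat\delta)$ and converges to a point $p^*$. (ii) If it is additionally assumed that $\{t_k\}$ has a positive lower bound or that $\{t_k\}$ is given by the Armijo step sizes, then $p^*$ is a Pareto critical point of $F$.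
   Context: $M$ is a connected, complete, $m$-dimensional Riemannian manifold with Riemannian distance $\mathrm{d}$; $\mathbb{B}(p,r)=\{q\in M:\mathrm{d}(p,q)\le r\}$. $I=\{1,\dots,n\}$ and $F=(f_i)_{i\in I}:M\to\mathbb{R}^n$ is continuously differentiable, with $JF(p)(v):=(\langle\nabla f_i(p),v\rangle)_{i\in I}$ for $v\in T_pM$. For $x,y\in\mathbb{R}^n$, $x\preceq y$ (equivalently $y\succeq x$) means $x_i\le y_i$ for all $i$. A point $p\in M$ is a Pareto critical point of $F$ if there is no $v\in T_pM$ with $\langle\nabla f_i(p),v\rangle<0$ for all $i\in I$. A set $Q\subseteq M$ is weakly convex if any two points of $Q$ are joined by a minimal geodesic of $M$ lying in $Q$. For $Q$ weakly convex, $F$ is quasi-convex on $Q$ if for all $p,q\in Q$ and every geodesic $\gamma:[0,1]\to M$ with $\gamma(0)=p$, $\gamma(1)=q$, $\gamma([0,1])\subseteq Q$, one has $F(\gamma(t))\preceq\max\{F(p),F(q)\}$ (componentwise max) for all $t\in[0,1]$. $F$ is quasi-convex around $x$ if it is quasi-convex on $\mathbb{B}(x,r)$ for some $r>0$ (with $\mathbb{B}(x,r)$ weakly convex). For $p\in M$, $\alpha_p(v):=\max_{i\in I}\langle\nabla f_i(p),v\rangle+\frac12\|v\|^2$ ($v\in T_pM$), and $\alpha_p^*:=\min_{v\in T_pM}\alpha_p(v)$. For $\sigma\in[0,1)$, $D_\sigma(p):=\{v\in T_pM:\alpha_p(v)\le(1-\sigma)\alpha_p^*\}$. A vector $v\in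 T_pM$ is s-compatible at $p$ if $v=-\sum_{i\in I}\alpha_i\nabla f_i(p)$ for some $\alpha_i\in[0,1]$ with $\sum_{i\in I}\alpha_i=1$. Inexact descent algorithm: fix $\sigma,\beta\in(0,1)$, $R\in[1,+\infty)$ and $p_0\in M$. At iteration $k=0,1,2,\dots$: if $p_k$ is a Pareto critical point, stop; otherwise choose $v_k\in D_\sigma(p_k)$, let $\gamma_k$ be the geodesic with $\gamma_k(0)=p_k$, $\gamma_k'(0)=v_k$, choose any $t_k\in(0,R]$ with $F(\gamma_k(t_k))\preceq F(p_k)+\beta t_kJF(p_k)(v_k)$, and set $p_{k+1}:=\gamma_k(t_k)$. Generated sequences are understood to be infinite (the algorithm does not stop). Armijo step sizes: for a fixed $\nu\in(0,1)$, $t_k=\max\{\nu^{i}: i\in\{0,1,2,\dots\},\ F(\gamma_k(\nu^{i}))\preceq F(p_k)+\beta\nu^{i}JF(p_k)(v_k)\}$ for every $k$. *)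

(* Defs.v *)
From HB Require Import structures.
From mathcomp Require Import all_boot all_order all_algebra.
From mathcomp Require Import all_classical all_reals all_analysis.

Set Implicit Arguments.
Unset Strict Implicit.
Unset Printing Implicit Defensive.

Import Order.TTheory GRing.Theory Num.Theory.
Import numFieldNormedType.Exports.

Local Open Scope classical_set_scope.
Local Open Scope ring_scope.

Definition partial (R : realType) (m : nat) (i : 'I_m) (f : 'rV[R]_m -> R)
  (x : 'rV[R]_m) : R := 'D_(delta_mx ord0 i) f x.

Fixpoint Ck_on (R : realType) (m k : nat) (U : set 'rV[R]_m)
    (f : 'rV[R]_m -> R) : Prop :=
  (forall x, U x -> {for x, continuous f}) /\
  if k is k'.+1 then
    forall i : 'I_m,
      (forall x, U x -> derivable f x (delta_mx ord0 i)) /\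
      Ck_on k' U (partial i f)
  else True.

Definition smooth_on (R : realType) (m : nat) (U : set 'rV[R]_m)
  (f : 'rV[R]_m -> R) : Prop := forall k, Ck_on k U f.

Record smoothManifold (R : realType) (m : nat) := SmoothManifold {
  carrier :> topologicalType;
  manifold_hausdorff : hausdorff_space carrier;
  manifold_second_countable : @second_countable carrier;
  atlas : Type;
  dom : atlas -> set carrier;
  chart : atlas -> carrier -> 'rV[R]_m;
  chart_inv : atlas -> 'rV[R]_m -> carrier;
  cod := fun c => chart c @` dom c;
  dom_open : forall c, open (dom c);
  cod_open : forall c, open (cod c);
  chartK : forall c p, dom c p -> chart_inv c (chart c p) = p;
  chart_continuous : forall c p, dom c p -> {for p, continuous (chart c)};
  chart_inv_continuous :
    forall c x, cod c x -> {for x, continuous (chart_inv c)};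
  transition_smooth : forall c c' (j : 'I_m),
    smooth_on (chart c @` (dom c `&` dom c'))
      (fun x => chart c' (chart_inv c x) ord0 j);
  chart_at : carrier -> atlas;
  dom_chart_at : forall p, dom (chart_at p) p
}.

(* [gram c x] is the matrix (g_ij) of the metric at the point of coordinates
   [x] in the chart [c].  Vectors are rows, so a change of chart with Jacobian
   [J] acts on them by [u |-> u *m J] and on Gram matrices by
   [G |-> J *m G *m J^T] in the opposite direction. *)
Record riemannianManifold (R : realType) (m : nat) := RiemannianManifold {
  manifold :> smoothManifold R m;
  gram : atlas manifold -> 'rV[R]_m -> 'M[R]_m;
  gram_smooth : forall c i j, smooth_on (cod c) (fun x => gram c x i j);
  gram_sym : forall c x, cod c x -> (gram c x)^T = gram c x;
  gram_posdef : forall c x (u : 'rV[R]_m), cod c x -> u != 0 ->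
    0 < (u *m gram c x *m u^T) ord0 ord0;
  gram_transition : forall c c' p, dom c p -> dom c' p ->
    let J := jacobian (chart c' \o chart_inv c) (chart c p) in
    gram c (chart c p) = J *m gram c' (chart c' p) *m J^T
}.

(* The tangent space at [p] is represented by coordinates with respect to the
   distinguished chart [chart_at p]. *)
Definition tangent (R : realType) (m : nat) (M : riemannianManifold R m)
  (p : M) := 'rV[R]_m.

Section RiemannianGeometry.
Context (R : realType) (m : nat) (M : riemannianManifold R m).
Implicit Types (p q : M) (gam : R -> M) (c : atlas M).

Definition coords_at p : 'rV[R]_m := chart (chart_at p) p.

Definition gram_at p : 'M[R]_m := gram (chart_at p) (coords_at p).

Definition inner p (u v : tangent p) : R :=
  (u *m gram_at p *m v^T) ord0 ord0.

Definition tnorm p (v : tangent p) : R := Num.sqrt (inner v v).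

(* In coordinates the gradient is [g^ij d_j f]. *)
Definition grad (f : M -> R) p : tangent p :=
  (\row_i partial i (f \o chart_inv (chart_at p)) (coords_at p))
    *m invmx (gram_at p).

Definition C1_fun (f : M -> R) : Prop :=
  forall c, Ck_on 1 (cod c) (f \o chart_inv c).

Definition velocity gam (t : R) : tangent (gam t) :=
  derive1 (chart (chart_at (gam t)) \o gam) t.

(* A curve on the closed interval [0, 1] is the restriction to [0, 1] of a
   function on the whole of [R]: being C^1, or a geodesic, on [0, 1] is
   required on a neighbourhood of each point of [0, 1], and the values outside
   of that neighbourhood are irrelevant. *)

Definition C1_curve_at gam (t : R) : Prop :=
  forall c, dom c (gam t) ->
    let x := chart c \o gam in
    (\forall s \near t, dom c (gam s) /\ derivable x s 1) /\
    {for t, continuous (derive1 x)}.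

Definition C1_segment gam : Prop := forall t, 0 <= t <= 1 -> C1_curve_at gam t.

Definition curve_length gam : R :=
  \int[lebesgue_measure]_(t in `[0, 1]) tnorm (velocity gam t).

(* [piecewise_length p q l]: some piecewise C^1 curve from [p] to [q], given as
   a finite concatenation of C^1 curves, has length [l]. *)
Inductive piecewise_length : M -> M -> R -> Prop :=
| piecewise_nil p : piecewise_length p p 0
| piecewise_cons gam q l :
    C1_segment gam -> piecewise_length (gam 1) q l ->
    piecewise_length (gam 0) q (curve_length gam + l).

Definition rdist p q : R := inf (piecewise_length p q).

Definition rball p (r : R) : set M := [set q | rdist p q <= r].

Definition christoffel c (k i j : 'I_m) (x : 'rV[R]_m) : R :=
  2^-1 * \sum_(l < m) invmx (gram c x) k l *
    (partial i (fun y => gram c y j l) x + partial j (fun y => gram c y i l) x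
     - partial l (fun y => gram c y i j) x).

Definition geodesic_at gam (t : R) : Prop :=
  forall c, dom c (gam t) ->
    let x := chart c \o gam in
    \forall s \near t,
      [/\ dom c (gam s), derivable x s 1, derivable (derive1 x) s 1 &
        forall k : 'I_m, derive1 (derive1 x) s ord0 k +
          \sum_(i < m) \sum_(j < m) christoffel c k i j (x s) *
            derive1 x s ord0 i * derive1 x s ord0 j = 0].

Definition geodesic_segment gam : Prop :=
  forall t, 0 <= t <= 1 -> geodesic_at gam t.

Definition complete_geodesic_from p (v : tangent p) gam : Prop :=
  [/\ forall t, geodesic_at gam t, gam 0 = p & velocity gam 0 = v].

Definition geodesically_complete : Prop :=
  forall p (v : tangent p), exists gam, complete_geodesic_from v gam.

Definition weakly_convex (Q : set M) : Prop :=
  forall p q, Q p -> Q q -> exists gam,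
    [/\ geodesic_segment gam, gam 0 = p, gam 1 = q,
        curve_length gam = rdist p q &
        forall t, 0 <= t <= 1 -> Q (gam t)].

End RiemannianGeometry.

Definition vle (R : realType) (n : nat) (x y : 'rV[R]_n) : Prop :=
  forall i, x ord0 i <= y ord0 i.

Definition vmax (R : realType) (n : nat) (x y : 'rV[R]_n) : 'rV[R]_n :=
  \row_i Num.max (x ord0 i) (y ord0 i).

(* The objective takes its values in R^(n.+1), so that there is at least one
   component. *)
Section Multiobjective.
Context (R : realType) (m n : nat) (M : riemannianManifold R m).
Context (F : M -> 'rV[R]_n.+1).
Implicit Types (p : M) (gam : R -> M).

Definition component (i : 'I_n.+1) : M -> R := fun p => F p ord0 i.

Definition C1_map : Prop := forall i, C1_fun (component i).

Definition JF p (v : tangent p) : 'rV[R]_n.+1 :=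
  \row_i inner (grad (component i) p) v.

Definition pareto_critical p : Prop :=
  ~ exists v : tangent p, forall i, inner (grad (component i) p) v < 0.

Definition quasi_convex_on (Q : set M) : Prop :=
  forall p q gam, Q p -> Q q ->
    geodesic_segment gam -> gam 0 = p -> gam 1 = q ->
    (forall t, 0 <= t <= 1 -> Q (gam t)) ->
    forall t, 0 <= t <= 1 -> vle (F (gam t)) (vmax (F p) (F q)).

Definition quasi_convex_around p : Prop :=
  exists r : R, [/\ 0 < r, weakly_convex (rball p r) &
    quasi_convex_on (rball p r)].

Definition alpha p (v : tangent p) : R :=
  \big[Num.max/inner (grad (component ord0) p) v]_(i < n.+1)
     inner (grad (component i) p) v + 2^-1 * tnorm v ^+ 2.

(* The infimum is attained, [alpha p] being continuous and coercive. *)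
Definition alpha_star p : R := inf (range (@alpha p)).

Definition D_sigma (sigma : R) p : set (tangent p) :=
  [set v | alpha v <= (1 - sigma) * alpha_star p].

Definition s_compatible p (v : tangent p) : Prop :=
  exists a : 'I_n.+1 -> R,
    [/\ forall i, 0 <= a i <= 1, \sum_i a i = 1 &
      v = - \sum_i a i *: (grad (component i) p : 'rV[R]_m)].

Definition sufficient_decrease (beta : R) p (v : tangent p) gam (t : R) : Prop :=
  vle (F (gam t)) (F p + (beta * t) *: JF v).

(* The curves [gam k] are determined by [p k] and [v k]; they are carried along
   so that the step size rules can refer to them. *)
Definition inexact_descent (sigma beta Rmax : R) (p : nat -> M)
    (v : forall k, tangent (p k)) (t : nat -> R) (gam : nat -> R -> M) : Prop :=
  forall k,
    [/\ ~ pareto_critical (p k),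
        D_sigma sigma (v k),
        complete_geodesic_from (v k) (gam k),
        0 < t k <= Rmax /\ sufficient_decrease beta (v k) (gam k) (t k) &
        p k.+1 = gam k (t k)].

Definition armijo_steps (beta nu : R) (p : nat -> M)
    (v : forall k, tangent (p k)) (t : nat -> R) (gam : nat -> R -> M) : Prop :=
  forall k,
    let S := [set s | exists2 i : nat, s = nu ^+ i &
                sufficient_decrease beta (v k) (gam k) s] in
    S (t k) /\ ubound S (t k).

End Multiobjective.

(* Main.v *)
Require Import Defs.
From HB Require Import structures.
From mathcomp Require Import all_boot all_order all_algebra.
From mathcomp Require Import all_classical all_reals all_analysis.
From mathcomp Require Import ring lra.

Set Implicit Arguments.
Unset Strict Implicit.
Unset Printing Implicit Defensive.

Import Order.TTheory GRing.Theory Num.Theory.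
Import numFieldNormedType.Exports.

Local Open Scope classical_set_scope.
Local Open Scope ring_scope.

(** The whole argument takes place in the chart at the critical point [pbar].
    The key estimate is a local quasi-Fejer inequality: if [F q <= F p], [v] is
    s-compatible at [p] and [gam] is the geodesic with velocity [v] at [p], then
    [d(q, gam t)^2 <= d(q, p)^2 + C (t |v|)^2] near [pbar].  To prove it, let
    [g] be a minimal geodesic from [q] to [p].  Quasi-convexity makes each
    component of [F o g] maximal at time 1, so that [<v, g'(1)> <= 0].  Deforming
    [g] in coordinates into [g(s) + s w], where [w] is the coordinate increment
    from [p] to [gam t], yields a curve from [q] to [gam t]; by the geodesic
    equation the term of order one of its energy is [2 <g'(1), w>], and
    [w = t v + O((t |v|)^2)].  No curvature bound or comparison theorem is
    needed.

    The definition of [D_sigma] gives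
    [(t_k |v_k|)^2 <= (2 Rmax / beta) (F_0(p_k) - F_0(p_{k+1}))], which is
    summable with a small sum when [p_0] is close to [pbar].  Taking [q = pbar]
    keeps the sequence near [pbar], and taking for [q] a cluster point gives
    convergence to it.  If the limit were not critical, [alpha_star] would be
    bounded away from 0 along the sequence, hence [t_k -> 0], and the sufficient
    decrease condition would also hold at [t_k / nu], against the Armijo rule. *)

(** * Calculus in coordinate space *)

(** [rdist] is an infimum over all curves of the manifold, so nothing ties a small distance to
    nearby coordinates a priori: a short curve might leave the chart. A globally defined Lipschitz
    cut-off function settles this, and it also confines geodesics to the chart without an exit-time
    argument. In the other direction, coordinate segments bound [rdist] from above. Minimal
    geodesics are supplied by weak convexity.

    The deformation [g(s) + s w] is effective because the first-order part of its energy density is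
    an exact derivative, that of [2 s <g'(s), w>]. An explicit primitive therefore bounds the length
    of the deformed curve without evaluating an integral. What is quadratic in [w] is absorbed by a
    polynomial in the dimension and in one constant [L], which controls the Gram matrix and its
    derivatives up to order two on a cube.

    Tangent vectors are stored in the chart chosen at their base point, and that choice has no
    continuity; vectors at different points are therefore compared only after passing to one fixed
    chart. *)

Section Limits.
Context {R : realType} {T : Type} {F : set_system T} {FF : Filter F}.

Lemma cvg_sumr (I : finType) (f : I -> T -> R) (l : I -> R) :
  (forall i, f i x @[x --> F] --> l i) ->
  (\sum_i f i x) @[x --> F] --> \sum_i l i.
Proof.
move=> fl; rewrite /index_enum; elim: (Finite.enum I) => [|i s ih].
  rewrite big_nil; under eq_fun do rewrite big_nil; exact: cvg_cst.
rewrite big_cons; under eq_fun do rewrite big_cons.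
by apply: cvgD => //; exact: fl.
Qed.

Lemma cvg_mxP m n (f : T -> 'M[R]_(m, n)) (A : 'M[R]_(m, n)) :
  (f x @[x --> F] --> A) <-> forall i j, f x i j @[x --> F] --> A i j.
Proof.
split=> [fA i j|fA].
  apply: (@cvg_comp _ _ _ f (fun M : 'M[R]_(m, n) => M i j) F (nbhs A)) => //.
  exact: coord_continuous.
apply/cvgrPdist_le => e e0.
have H : \forall x \near F, forall ij : 'I_m * 'I_n, `|A ij.1 ij.2 - f x ij.1 ij.2| <= e.
  by apply: filter_forall => -[i j] /=; move/cvgrPdist_le : (fA i j) => /(_ _ e0).
apply: filterS H => x H; rewrite [leLHS]/Num.Def.normr /= mx_normrE.
apply: bigmax_le => [|ij _]; first exact: ltW.
by have := H ij; rewrite !mxE.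
Qed.

Lemma cvg_mulmx m n p (f : T -> 'M[R]_(m, n)) (g : T -> 'M[R]_(n, p))
    (A : 'M[R]_(m, n)) (B : 'M[R]_(n, p)) :
  f x @[x --> F] --> A -> g x @[x --> F] --> B ->
  f x *m g x @[x --> F] --> A *m B.
Proof.
move=> /cvg_mxP fA /cvg_mxP gB; apply/cvg_mxP => i j; rewrite mxE.
by under eq_fun do rewrite mxE; apply: cvg_sumr => k; exact: cvgM.
Qed.

Lemma cvg_trmx m n (f : T -> 'M[R]_(m, n)) (A : 'M[R]_(m, n)) :
  f x @[x --> F] --> A -> (f x)^T @[x --> F] --> A^T.
Proof.
move=> /cvg_mxP fA; apply/cvg_mxP => i j; rewrite mxE.
by under eq_fun do rewrite mxE; exact: fA.
Qed.

End Limits.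

Section Calculus.
Context {R : realType}.

Lemma is_derive_line (V W : normedModType R) (f : V -> W) (a v : V) (r : R) :
  derivable f (a + r *: v) v ->
  is_derive r 1 (fun s => f (a + s *: v)) ('D_v f (a + r *: v)).
Proof.
have E : (fun h : R => h^-1 *: (f (a + (h *: 1 + r) *: v) - f (a + r *: v))) =
         (fun h => h^-1 *: (f (h *: v + (a + r *: v)) - f (a + r *: v))).
  apply/funext => h; congr (_ *: (f _ - _)).
  by rewrite [h *: 1]mulr1 scalerDl addrCA.
by move=> fd; split; [rewrite /derivable E|rewrite /derive E].
Qed.

Lemma is_derive_affine (V : normedModType R) (a v : V) (r : R) :
  is_derive r 1 (fun s : R => a + s *: v) v.
Proof. by have := @is_derive_line _ _ id a v r; rewrite derive_id; apply. Qed.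

Lemma is_derive_segment_le (f df : R -> R) (a b c K : R) : a <= b ->
  (forall s, a <= s <= b -> is_derive s 1 f (df s)) ->
  (forall s, a <= s <= b -> `|df s - c| <= K) ->
  `|f b - f a - c * (b - a)| <= K * (b - a).
Proof.
move=> ab fd dfK.
have [|s|s sab ->] := @MVT_segment _ f df a b ab.
- by move=> s; rewrite in_itv /= => /andP[/ltW ? /ltW ?]; apply: fd; apply/andP.
- move: s; apply: derivable_within_continuous => s sab.
  by have [] : is_derive s 1 f (df s) by apply: fd; rewrite in_itv in sab.
by rewrite -mulrBl normrM [`|b - a|]ger0_norm ?subr_ge0// ler_wpM2r ?subr_ge0// dfK// -in_itv.
Qed.

Lemma is_derive_between_le (f df : R -> R) (a b c K : R) :
  (forall s, Num.min a b <= s <= Num.max a b -> is_derive s 1 f (df s)) ->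
  (forall s, Num.min a b <= s <= Num.max a b -> `|df s - c| <= K) ->
  `|f b - f a - c * (b - a)| <= K * `|b - a|.
Proof.
have [ab|/ltW ba] := leP a b => fd dfK.
  by rewrite [`|b - a|]ger0_norm ?subr_ge0//; exact: is_derive_segment_le fd dfK.
have := is_derive_segment_le ba fd dfK.
rewrite -[leLHS]normrN [`|b - a|]distrC [`|a - b|]ger0_norm ?subr_ge0//.
by congr (`| _ | <= _); ring.
Qed.

Section matrix_valued.
Context {V : normedModType R}.

Lemma is_derive_mxP m n (M : V -> 'M[R]_(m, n)) (x v : V) (dM : 'M[R]_(m, n)) :
  is_derive x v M dM <-> forall i j, is_derive x v (fun y => M y i j) (dM i j).
Proof.
split=> [[Md MdE] i j|Md].
  split; first exact: (derivable_mxP M x v).1.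
  by rewrite -MdE derive_mx// mxE.
have Mdv : derivable M x v by apply/derivable_mxP => i j; case: (Md i j).
split=> //; rewrite derive_mx//; apply/matrixP => i j; rewrite mxE.
by case: (Md i j).
Qed.

Lemma is_derive_sumr (I : finType) (f : I -> V -> R) (x v : V) (df : I -> R) :
  (forall i, is_derive x v (f i) (df i)) ->
  is_derive x v (fun y => \sum_i f i y) (\sum_i df i).
Proof.
move=> fd.
have -> : (fun y => \sum_i f i y) = \sum_i f i.
  by apply/funext => y; rewrite fct_sumE.
rewrite /index_enum; elim: (Finite.enum I) => [|i s ih].
  by rewrite !big_nil; exact: is_derive_cst.
by rewrite !big_cons; exact: is_deriveD.
Qed.

Lemma is_derive_mulmx m n p (A : V -> 'M[R]_(m, n)) (B : V -> 'M[R]_(n, p))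
    (x v : V) dA dB :
  is_derive x v A dA -> is_derive x v B dB ->
  is_derive x v (fun y => A y *m B y) (dA *m B x + A x *m dB).
Proof.
move=> /is_derive_mxP Ad /is_derive_mxP Bd; apply/is_derive_mxP => i j.
rewrite (_ : (fun _ => _) = fun y => \sum_k A y i k * B y k j); last first.
  by apply/funext => y; rewrite mxE.
rewrite !mxE -big_split /=; apply: is_derive_sumr => k.
apply: is_derive_eq (is_deriveM (Ad i k) (Bd k j)) _.
by rewrite /GRing.scale /=; ring.
Qed.

Lemma is_derive_trmx m n (A : V -> 'M[R]_(m, n)) (x v : V) dA :
  is_derive x v A dA -> is_derive x v (fun y => (A y)^T) dA^T.
Proof.
move=> /is_derive_mxP Ad; apply/is_derive_mxP => i j.
rewrite (_ : (fun _ => _) = fun y => A y j i) ?mxE//.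
by apply/funext => y; rewrite mxE.
Qed.

End matrix_valued.

Lemma le_mx_norm m n (A : 'M[R]_(m, n)) i j : `|A i j| <= `|A|.
Proof.
rewrite [leRHS]/Num.Def.normr /= mx_normrE.
exact: (le_bigmax _ (fun ij : 'I_m * 'I_n => `|A ij.1 ij.2|) (i, j)).
Qed.

Lemma mx_norm_le m n (A : 'M[R]_(m, n)) (K : R) : 0 <= K ->
  (forall i j, `|A i j| <= K) -> `|A| <= K.
Proof.
move=> K0 AK; rewrite [leLHS]/Num.Def.normr /= mx_normrE.
by apply: bigmax_le => // -[i j] _; exact: AK.
Qed.

Lemma sum_norm_le n (f : 'I_n -> R) (K : R) :
  (forall i, `|f i| <= K) -> `|\sum_i f i| <= n%:R * K.
Proof.
move=> fK; apply: le_trans (ler_norm_sum _ _ _) _.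
apply: le_trans (ler_sum _ (fun i _ => fK i)) _.
by rewrite sumr_const card_ord mulr_natl.
Qed.

Lemma mulmx_norm_le m n p (A : 'M[R]_(m, n)) (B : 'M[R]_(n, p)) :
  `|A *m B| <= n%:R * (`|A| * `|B|).
Proof.
apply: mx_norm_le => [|i j]; first by rewrite !mulr_ge0.
rewrite mxE; apply: sum_norm_le => k.
by rewrite normrM ler_pM// le_mx_norm.
Qed.

Lemma trmx_norm m n (A : 'M[R]_(m, n)) : `|A^T| = `|A|.
Proof.
apply/eqP; rewrite eq_le; apply/andP; split; apply: mx_norm_le => // i j.
  by rewrite mxE le_mx_norm.
by have := le_mx_norm A^T j i; rewrite mxE.
Qed.

Lemma bilin_norm_le m (u v : 'rV[R]_m) (A : 'M[R]_m) :
  `|(u *m A *m v^T) ord0 ord0| <= m%:R ^+ 2 * (`|u| * `|A| * `|v|).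
Proof.
apply: le_trans (le_mx_norm _ _ _) _.
apply: le_trans (mulmx_norm_le _ _) _.
rewrite expr2 -mulrA ler_wpM2l// trmx_norm.
by rewrite [leRHS]mulrA ler_wpM2r// mulmx_norm_le.
Qed.

Lemma bilinE m (u v : 'rV[R]_m) (A : 'M[R]_m) :
  (u *m A *m v^T) ord0 ord0 = \sum_i \sum_j u ord0 i * A i j * v ord0 j.
Proof.
rewrite mxE exchange_big /=; apply: eq_bigr => j _.
by rewrite !mxE big_distrl.
Qed.

Lemma is_derive_rV_le m (f df : R -> 'rV[R]_m) (a b : R) (c : 'rV[R]_m) (K : R) :
  a <= b -> 0 <= K ->
  (forall s, a <= s <= b -> is_derive s 1 f (df s)) ->
  (forall s, a <= s <= b -> `|df s - c| <= K) ->
  `|f b - f a - (b - a) *: c| <= K * (b - a).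
Proof.
move=> ab K0 fd dfK; apply: mx_norm_le => [|i j].
  by rewrite mulr_ge0// subr_ge0.
rewrite !mxE [(b - a) * _]mulrC.
apply: (@is_derive_segment_le (fun s => f s i j) (fun s => df s i j)) => // s sab.
  by have /is_derive_mxP := fd s sab; exact.
by apply: le_trans (dfK s sab); have := le_mx_norm (df s - c) i j; rewrite !mxE.
Qed.

Lemma is_derive2_rV_le m (f df ddf : R -> 'rV[R]_m) (a b K : R) :
  a <= b -> 0 <= K ->
  (forall s, a <= s <= b -> is_derive s 1 f (df s)) ->
  (forall s, a <= s <= b -> is_derive s 1 df (ddf s)) ->
  (forall s, a <= s <= b -> `|ddf s| <= K) ->
  `|f b - f a - (b - a) *: df a| <= K * (b - a) ^+ 2.
Proof.
move=> ab K0 fd dfd ddfK; rewrite expr2 mulrA.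
apply: (@is_derive_rV_le _ f df) => // [|s sab].
  by rewrite mulr_ge0// subr_ge0.
have /andP[as_ sb] := sab.
have := @is_derive_rV_le _ df ddf a s 0 K as_ K0.
rewrite scaler0 subr0 => H; apply: le_trans (H _ _) _.
- by move=> r /andP[ar rs]; apply: dfd; rewrite ar (le_trans rs).
- by move=> r /andP[ar rs]; rewrite subr0; apply: ddfK; rewrite ar (le_trans rs).
- by rewrite ler_wpM2l// lerD2r.
Qed.

End Calculus.

(** * Continuously differentiable functions of several variables *)

Section C1.
Context {R : realType} {m : nat}.
Implicit Types (f : 'rV[R]_m -> R) (x y z w : 'rV[R]_m).

(** Derivability is required nearby, continuity of the partial derivatives only at [x]: this is what
    [Ck_on 1] gives at each point of an open set, and it suffices for differentiability at [x]. *)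
Definition C1_at f x := forall i : 'I_m,
  (\forall y \near x, derivable f y (delta_mx ord0 i)) /\
  {for x, continuous (partial i f)}.

Definition dpart f x (v : 'rV[R]_m) : R := \sum_i v ord0 i * partial i f x.

Lemma C1_at_little f x : C1_at f x -> forall e, 0 < e ->
  \forall y \near x, `|f y - f x - dpart f x (y - x)| <= e * `|y - x|.
Proof.
move=> fC e e0.
(* The denominator [m.+1] is nonzero even in dimension 0, and the [m] one-coordinate errors still
   add up to at most [e * |y - x|]. *)
have : \forall y \near x, forall i : 'I_m, derivable f y (delta_mx ord0 i) /\
    `|partial i f y - partial i f x| <= e / m.+1%:R.
  apply: (@filter_forall _ _ (fun i y => derivable f y (delta_mx ord0 i) /\
    `|partial i f y - partial i f x| <= e / m.+1%:R) (nbhs x)) => i.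
  have [fd fc] := fC i.
  apply: filterI => //; move/cvgrPdist_le : fc => /(_ (e / m.+1%:R)) H.
  have e1 : 0 < e / m.+1%:R by rewrite divr_gt0.
  by near=> y; rewrite distrC; near: y; exact: H.
move=> /nbhs_ballP[d /= d0 dP]; apply/nbhs_ballP; exists d => // y xyd.
(* [z k] takes its first [k] coordinates from [y] and the others from [x]. Consecutive points differ
   in one coordinate, so the one-dimensional mean value inequality applies to each increment. *)
pose z (k : nat) : 'rV[R]_m := \row_i (if (i < k)%N then y ord0 i else x ord0 i).
have zx : z 0%N = x by apply/rowP => i; rewrite mxE.
have zy : z m = y by apply/rowP => i; rewrite mxE ltn_ord.
have -> : f y - f x = \sum_(k < m) (f (z k.+1) - f (z k)).
  by rewrite -(big_mkord xpredT (fun k => f (z k.+1) - f (z k))) telescope_sumr// zx zy.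
rewrite /dpart -sumrB.
apply: (@le_trans _ _ (m%:R * (e / m.+1%:R * `|y - x|))); last first.
  rewrite mulrA ler_wpM2r// mulrCA ler_piMr ?(ltW e0)// ler_pdivrMr// mul1r.
  by rewrite ler_nat.
apply: sum_norm_le => k; rewrite !mxE.
pose a : 'rV[R]_m := \row_i (if i == k then 0 else z k ord0 i).
have zk : z k = a + x ord0 k *: delta_mx ord0 k.
  apply/rowP => i; rewrite !mxE eqxx /=; case: eqP => [->|_].
    by rewrite ltnn add0r mulr1.
  by rewrite mulr0 addr0.
have zk1 : z k.+1 = a + y ord0 k *: delta_mx ord0 k.
  apply/rowP => i; rewrite !mxE eqxx /=; case: eqP => [->|/eqP ik].
    by rewrite ltnSn add0r mulr1.
  by rewrite mulr0 addr0 ltnS leq_eqVlt [in X in X || _](negbTE (_ : i != k :> nat)).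
have inball s : Num.min (x ord0 k) (y ord0 k) <= s <= Num.max (x ord0 k) (y ord0 k) ->
    ball x d (a + s *: delta_mx ord0 k).
  move=> sxy; rewrite -ball_normE /= in xyd *.
  apply: le_lt_trans xyd; apply: mx_norm_le => // i j; rewrite !ord1 !mxE eqxx /=.
  have := le_mx_norm (x - y) ord0 j; rewrite !mxE.
  case: eqP => [->|_].
    move=> H; rewrite add0r mulr1; apply: le_trans H.
    move: sxy; case: (leP (x ord0 k)) => xy /andP[s1 s2].
      by rewrite distrC ger0_norm ?subr_ge0// distrC ger0_norm ?subr_ge0// ?lerD2r.
    by rewrite ger0_norm ?subr_ge0// ger0_norm ?subr_ge0 ?(ltW xy)// lerD2l lerN2.
  rewrite mulr0 addr0; case: ifP => // _ _; by rewrite subrr normr0.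
have := @is_derive_between_le _ (fun s => f (a + s *: delta_mx ord0 k))
  (fun s => partial k f (a + s *: delta_mx ord0 k)) (x ord0 k) (y ord0 k)
  (partial k f x) (e / m.+1%:R).
rewrite -zk -zk1 [partial k f x * _]mulrC => H; apply: le_trans (H _ _) _.
- by move=> s /inball /dP /(_ k)[fd _]; exact: is_derive_line.
- by move=> s /inball /dP /(_ k)[].
- rewrite ler_wpM2l ?divr_ge0 ?(ltW e0)//.
  by have := le_mx_norm (y - x) ord0 k; rewrite !mxE.
Unshelve. all: by end_near. Qed.

Lemma dpart_linear f x : linear (dpart f x).
Proof.
move=> a u v; rewrite /dpart -[RHS]/(a * _ + _) big_distrr -big_split /=; apply: eq_bigr => i _.
by rewrite !mxE; ring.
Qed.

HB.instance Definition _ f x :=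
  GRing.isLinear.Build R 'rV[R]_m R *:%R (dpart f x) (dpart_linear f x).

Lemma dpart_continuous f x : continuous (dpart f x).
Proof.
move=> v; apply: (@cvg_sumr _ _ _ (nbhs_filter v)) => i; apply: cvgM; [exact: coord_continuous|exact: cvg_cst].
Qed.

Lemma C1_at_diff f x : C1_at f x -> differentiable f x /\ 'd f x = dpart f x :> (_ -> _).
Proof.
move=> fC; have dfE : (f : 'rV[R]_m -> R^o) \o shift x = cst (f x) + (dpart f x : 'rV[R]_m -> R^o) +o_ (0 : 'rV[R]_m) id.
  apply/eqaddoP => e e0; have := C1_at_little fC e0.
  rewrite (near_shift 0 x) => H; near=> h.
  have : `|f (h + (x - 0)) - f x - dpart f x (h + (x - 0) - x)| <= e * `|h + (x - 0) - x|.
    by near: h; exact: H.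
  by rewrite subr0 addrK opprD addrA.
have E := diff_unique (@dpart_continuous f x) dfE.
split=> //; apply/diff_locallyP; split; first by rewrite E; exact: dpart_continuous.
by rewrite E.
Unshelve. all: by end_near. Qed.

Lemma is_derive_C1_comp f (x : R -> 'rV[R]_m) (t : R) dx :
  C1_at f (x t) -> is_derive t 1 x dx ->
  is_derive t 1 (f \o x) (dpart f (x t) dx).
Proof.
move=> /C1_at_diff[fd fE] xd.
have /derivable1_diffP xdd : derivable x t 1 by case: xd.
have cd : differentiable (f \o x) t by exact: differentiable_comp.
split; first exact/derivable1_diffP.
rewrite deriveE// diff_comp//= fE; congr dpart.
by rewrite -deriveE//; case: xd.
Qed.

Lemma dpart_norm_le f x v K : (forall i, `|partial i f x| <= K) ->
  `|dpart f x v| <= m%:R * (K * `|v|).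
Proof.
by move=> fK; apply: sum_norm_le => i; rewrite normrM mulrC ler_pM// le_mx_norm.
Qed.

(** The norm on rows is the maximum norm, so this is a closed cube. *)
Definition cball (x0 : 'rV[R]_m) (r : R) : set 'rV[R]_m := [set x | `|x - x0| <= r].

Lemma cball_segment x0 r x y (s : R) : cball x0 r x -> cball x0 r y ->
  0 <= s <= 1 -> cball x0 r (x + s *: (y - x)).
Proof.
move=> xr yr /andP[s0 s1]; rewrite /cball /=.
have -> : x + s *: (y - x) - x0 = (1 - s) *: (x - x0) + s *: (y - x0).
  by apply/rowP => i; rewrite !mxE; ring.
apply: le_trans (ler_normD _ _) _; rewrite !normrZ.
rewrite !ger0_norm// ?subr_ge0//; rewrite /cball /= in xr yr.
apply: (@le_trans _ _ ((1 - s) * r + s * r)); last by rewrite -mulrDl subrK mul1r.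
by rewrite lerD// ler_wpM2l// subr_ge0.
Qed.

Lemma C1_lipschitz f x0 r K : 
  (forall x, cball x0 r x -> C1_at f x) ->
  (forall x i, cball x0 r x -> `|partial i f x| <= K) ->
  forall x y, cball x0 r x -> cball x0 r y -> `|f y - f x| <= m%:R * K * `|y - x|.
Proof.
move=> fC fK x y xr yr.
have := @is_derive_segment_le _ (fun s => f (x + s *: (y - x)))
  (fun s => dpart f (x + s *: (y - x)) (y - x)) 0 1 0 (m%:R * K * `|y - x|) ler01.
rewrite scale0r addr0 scale1r subrKC mul0r subr0 subr0 mulr1; apply => s s01.
  apply: (@is_derive_C1_comp f (fun s => x + s *: (y - x))).
    exact/fC/cball_segment.
  exact: is_derive_affine.
rewrite subr0 -mulrA; apply: dpart_norm_le => i; apply: fK.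
exact: cball_segment.
Qed.

(** The partial derivatives are Lipschitz with constant [m * K], so the derivative along the segment
    stays close to its initial value. The mean value inequality loses the factor 1/2 of Taylor's
    formula, which is harmless here. *)
Lemma C2_taylor f x0 r K : 0 <= K ->
  (forall x, cball x0 r x -> C1_at f x) ->
  (forall x i, cball x0 r x -> C1_at (partial i f) x) ->
  (forall x i j, cball x0 r x -> `|partial j (partial i f) x| <= K) ->
  forall x y, cball x0 r x -> cball x0 r y ->
  `|f y - f x - dpart f x (y - x)| <= m%:R ^+ 2 * K * `|y - x| ^+ 2.
Proof.
move=> K0 fC fC2 fK x y xr yr.
have := @is_derive_segment_le _ (fun s => f (x + s *: (y - x)))
  (fun s => dpart f (x + s *: (y - x)) (y - x)) 0 1 (dpart f x (y - x))
  (m%:R ^+ 2 * K * `|y - x| ^+ 2) ler01.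
rewrite scale0r addr0 scale1r subrKC subr0 !mulr1; apply => s s01.
  apply: (@is_derive_C1_comp f (fun s => x + s *: (y - x))).
    exact/fC/cball_segment.
  exact: is_derive_affine.
have zr := cball_segment xr yr s01; have /andP[s0 s1] := s01.
rewrite /dpart -sumrB [m%:R ^+ 2]expr2 -!mulrA; apply: sum_norm_le => i.
rewrite -mulrBr normrM [`|y - x| ^+ 2]expr2 !mulrA mulrC.
apply: ler_pM => //; last exact: le_mx_norm.
have H := @C1_lipschitz (partial i f) x0 r K (fun x => @fC2 x i)
  (fun x j => @fK x i j) x (x + s *: (y - x)) xr zr.
apply: le_trans H _; rewrite addrC addKr normrZ ger0_norm//.
by rewrite ler_wpM2l ?mulr_ge0// ler_piMl.
Qed.

End C1.

(** * Charts and tangent vectors *)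

Section C1_rows.
Context {R : realType} {m n : nat}.

Lemma Ck_on_C1_at (U : set 'rV[R]_m) (f : 'rV[R]_m -> R) k x : open U -> U x ->
  Ck_on k.+1 U f -> C1_at f x.
Proof.
move=> Uo Ux [_ fk] i; have [fd pC] := fk i; split.
  by apply: filterS (fd) _; exact: open_nbhs_nbhs.
by case: k pC {fk} => [|k] [pc _]; exact: pc.
Qed.

Lemma Ck_on_partial_C1_at (U : set 'rV[R]_m) (f : 'rV[R]_m -> R) k x i :
  open U -> U x -> Ck_on k.+2 U f -> C1_at (partial i f) x.
Proof. by move=> Uo Ux [_ fk]; apply: Ck_on_C1_at Uo Ux (fk i).2. Qed.

Lemma differentiable_row (T : 'rV[R]_m -> 'rV[R]_n) x :
  (forall j, C1_at (fun y => T y ord0 j) x) ->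
  differentiable T x /\ forall v, 'd T x v = \row_j dpart (fun y => T y ord0 j) x v.
Proof.
move=> TC; have Td : differentiable T x.
  have -> : T = \sum_(j < n) (fun y => T y ord0 j *: delta_mx ord0 j).
    by apply/funext => y; rewrite fct_sumE; exact: row_sum_delta.
  apply: differentiable_sum => j; apply: differentiableZl.
  by have [] := C1_at_diff (TC j).
split=> // v; rewrite -deriveE// derive_mx; last exact: diff_derivable.
apply/rowP => j; rewrite !mxE; have [fd fE] := C1_at_diff (TC j).
by rewrite ord1 deriveE// fE.
Qed.

End C1_rows.

Section Charts.
Context {R : realType} {m : nat} (M : riemannianManifold R m).
Implicit Types (p q : M) (gam : R -> M) (c : atlas M).

Lemma chart_invP c x : cod c x ->
  dom c (chart_inv c x) /\ chart c (chart_inv c x) = x.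
Proof. by move=> [p pc <-]; rewrite chartK. Qed.

Lemma cod_chart c p : dom c p -> cod c (chart c p).
Proof. by move=> pc; exists p. Qed.

Lemma nbhs_cod c x : cod c x -> nbhs x (cod c).
Proof. by move=> cx; apply: open_nbhs_nbhs; split=> //; exact: cod_open. Qed.

Lemma nbhs_dom c p : dom c p -> nbhs p (dom c).
Proof. by move=> pc; apply: open_nbhs_nbhs; split=> //; exact: dom_open. Qed.

Lemma near_chart_inv_dom c c' p : dom c p -> dom c' p ->
  \forall x \near chart c p, cod c x /\ dom c' (chart_inv c x).
Proof.
move=> pc pc'; apply: filterI; first exact/nbhs_cod/cod_chart.
by apply: (chart_inv_continuous (cod_chart pc)); rewrite chartK//; exact: nbhs_dom.
Qed.

Lemma transition_dom_open c c' : open (chart c @` (dom c `&` dom c')).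
Proof.
rewrite openE => _ [p [pc pc'] <-].
apply: filterS (near_chart_inv_dom pc pc') => x [xc xc'].
by have [? xE] := chart_invP xc; exists (chart_inv c x).
Qed.

Definition transition c c' := chart c' \o chart_inv c : 'rV[R]_m -> 'rV[R]_m.

Lemma transition_C1 c c' p j : dom c p -> dom c' p ->
  C1_at (fun x => transition c c' x ord0 j) (chart c p).
Proof.
move=> pc pc'; have := @transition_smooth _ _ M c c' j 1%N.
apply: Ck_on_C1_at; [exact: transition_dom_open|by exists p].
Qed.

Lemma transition_diff c c' p : dom c p -> dom c' p ->
  differentiable (transition c c') (chart c p).
Proof.
by move=> pc pc'; have [] := differentiable_row (fun j => transition_C1 j pc pc').
Qed.

Lemma jacobian_transitionE c c' p v : dom c p -> dom c' p ->
  v *m jacobian (transition c c') (chart c p) =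
  \row_j dpart (fun x => transition c c' x ord0 j) (chart c p) v.
Proof.
move=> pc pc'; have [Td TE] := differentiable_row (fun j => transition_C1 j pc pc').
by rewrite -deriveEjacobian// deriveE.
Qed.

Lemma gram_unit c x : cod c x -> gram c x \in unitmx.
Proof.
move=> xc; rewrite -row_free_unit -kermx_eq0; apply/eqP/eqP/rowV0P => v.
move=> /sub_kermxP vG; apply: contrapT => /eqP v0.
by have := gram_posdef xc v0; rewrite vG mul0mx mxE ltxx.
Qed.

(** Read off the determinant of [J *m G' *m J^T], which is an invertible Gram matrix; the inverse
    transition map does not enter. *)
Lemma jacobian_unit c c' p : dom c p -> dom c' p ->
  jacobian (transition c c') (chart c p) \in unitmx.
Proof.
move=> pc pc'; have := gram_unit (cod_chart pc); rewrite (gram_transition pc pc').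
by rewrite !unitmx_mul -andbA => /andP[].
Qed.

(** Components in the chart [c] of a vector stored in the distinguished chart of its base point. *)
Definition tocoord c p (u : tangent p) : 'rV[R]_m :=
  u *m jacobian (transition (chart_at p) c) (coords_at p).

Lemma inner_tocoord c p (u v : tangent p) : dom c p ->
  inner u v = (tocoord c u *m gram c (chart c p) *m (tocoord c v)^T) ord0 ord0.
Proof.
move=> pc; rewrite /inner /gram_at /coords_at.
rewrite (gram_transition (dom_chart_at p) pc) /tocoord trmx_mul.
by rewrite -/(transition _ _) !mulmxA.
Qed.

Lemma tocoord_surj c p (w : 'rV[R]_m) : dom c p ->
  exists u : tangent p, tocoord c u = w.
Proof.
move=> pc; have Ju := jacobian_unit (dom_chart_at p) pc.
by exists (w *m invmx (jacobian (transition (chart_at p) c) (coords_at p)));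
  rewrite /tocoord mulmxKV.
Qed.

Lemma is_derive_transition c c' gam t dx :
  (\forall s \near t, dom c (gam s)) -> dom c' (gam t) ->
  is_derive t 1 (chart c \o gam) dx ->
  is_derive t 1 (chart c' \o gam)
    (dx *m jacobian (transition c c') (chart c (gam t))).
Proof.
move=> gc gc' xd; have gtc : dom c (gam t) by exact: nbhs_singleton gc.
apply: (@near_eq_is_derive _ _ _ (transition c c' \o (chart c \o gam))).
  by near=> s; rewrite /transition /= chartK//; near: s.
have Td := transition_diff gtc gc'.
have /derivable1_diffP xdd : derivable (chart c \o gam) t 1 by case: xd.
have cd : differentiable (transition c c' \o (chart c \o gam)) t.
  exact: differentiable_comp.
split; first exact/derivable1_diffP.
rewrite deriveE// diff_comp//= -deriveEjacobian// [RHS]deriveE//; congr ('d _ _ _).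
by rewrite -deriveE//; case: xd.
Unshelve. all: by end_near. Qed.

Lemma derive1_is_derive (V : normedModType R) (x : R -> V) (t : R) (dx : V) :
  is_derive t 1 x dx -> derive1 x t = dx.
Proof. by move=> [_ <-]; rewrite derive1E. Qed.

(** The chain rule from [c] to the distinguished chart and back computes the derivative of
    [chart c \o gam] a second time; uniqueness of derivatives identifies the two results. *)
Lemma velocity_tocoord c gam t dx :
  (\forall s \near t, dom c (gam s)) -> is_derive t 1 (chart c \o gam) dx ->
  tocoord c (velocity gam t) = dx.
Proof.
move=> gc xd; have gtc : dom c (gam t) by exact: nbhs_singleton gc.
have gta := dom_chart_at (gam t).
have vd := is_derive_transition gc gta xd.
have gca : \forall s \near t, dom (chart_at (gam t)) (gam s).
  have xc : chart c (gam s) @[s --> t] --> chart c (gam t).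
    by apply/differentiable_continuous/derivable1_diffP; case: xd.
  have H := xc _ (near_chart_inv_dom gtc gta).
  by apply: filterS2 gc H => s gsc [_ /=]; rewrite chartK.
have := is_derive_transition gca gtc vd.
rewrite /tocoord /velocity (derive1_is_derive vd) => /derive1_is_derive <-.
exact: derive1_is_derive.
Qed.

(** The inverse Gram matrix in [grad] cancels the Gram matrix in [inner]. What remains is the
    differential of [f], which the chain rule carries to any chart. *)
Lemma inner_grad c (f : M -> R) p (v : tangent p) : C1_fun f -> dom c p ->
  inner (grad f p) v = dpart (f \o chart_inv c) (chart c p) (tocoord c v).
Proof.
move=> fC pc; have pa := dom_chart_at p.
have fC1 c' : dom c' p -> C1_at (f \o chart_inv c') (chart c' p).
  by move=> pc'; apply: Ck_on_C1_at (fC c'); [exact: cod_open|exact: cod_chart].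
rewrite /inner /grad /gram_at mulmxKV; last exact/gram_unit/cod_chart.
rewrite mxE; under eq_bigr do rewrite !mxE mulrC.
rewrite -/(dpart (f \o chart_inv (chart_at p)) (coords_at p) v).
have [fd fE] := C1_at_diff (fC1 _ pc).
have [fda fEa] := C1_at_diff (fC1 _ pa).
have -> : dpart (f \o chart_inv (chart_at p)) (coords_at p) v =
    'D_v (f \o chart_inv (chart_at p)) (coords_at p) by rewrite deriveE// fEa.
have Td := transition_diff pa pc.
have TE : transition (chart_at p) c (coords_at p) = chart c p.
  by rewrite /transition /= /coords_at chartK.
rewrite -TE in fd fE *.
rewrite -fE /tocoord -deriveEjacobian// (deriveE _ Td) -[RHS]/(('d _ _ \o 'd _ _) v).
rewrite -diff_comp// -deriveE; last exact: differentiable_comp.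
apply: near_eq_derive.
have H := near_chart_inv_dom pa pc.
near=> x; rewrite /transition /= chartK//.
by have [] : cod (chart_at p) x /\ dom c (chart_inv (chart_at p) x) by near: x.
Unshelve. all: by end_near. Qed.

End Charts.

(** * The metric in a chart *)

Section Metric.
Context {R : realType} {m : nat} (M : riemannianManifold R m).
Implicit Types (p q : M) (gam : R -> M) (c : atlas M) (u v w x : 'rV[R]_m).

Definition metric c x u v : R := (u *m gram c x *m v^T) ord0 ord0.

Definition dgram c x w : 'M[R]_m :=
  \matrix_(i, j) dpart (fun y => gram c y i j) x w.

Lemma metricDl c x u v w : metric c x (u + v) w = metric c x u w + metric c x v w.
Proof. by rewrite /metric !mulmxDl mxE. Qed.

Lemma metricZl c x a u v : metric c x (a *: u) v = a * metric c x u v.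
Proof. by rewrite /metric -!scalemxAl mxE. Qed.

Lemma metricC c x u v : cod c x -> metric c x u v = metric c x v u.
Proof.
move=> xc; rewrite /metric -[in LHS](trmxK (u *m _ *m _)) mxE !trmx_mul trmxK.
by rewrite gram_sym// mulmxA.
Qed.

Lemma metricDr c x u v w : metric c x u (v + w) = metric c x u v + metric c x u w.
Proof. by rewrite /metric linearD mulmxDr mxE. Qed.

Lemma metricZr c x a u v : metric c x u (a *: v) = a * metric c x u v.
Proof. by rewrite /metric linearZ -scalemxAr mxE. Qed.

Lemma metric0l c x v : metric c x 0 v = 0.
Proof. by rewrite /metric !mul0mx mxE. Qed.

Lemma metric_ge0 c x u : cod c x -> 0 <= metric c x u u.
Proof.
move=> xc; have [->|u0] := eqVneq u 0; first by rewrite metric0l.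
exact/ltW/gram_posdef.
Qed.

Lemma metric_CauchySchwarz c x u v : cod c x ->
  metric c x u v ^+ 2 <= metric c x u u * metric c x v v.
Proof.
move=> xc; have [->|v0] := eqVneq v 0.
  by rewrite [metric c x u 0]metricC// !metric0l expr0n mulr0.
have vv : 0 < metric c x v v by exact: gram_posdef.
pose a := metric c x u v / metric c x v v.
have := metric_ge0 (u + (- a) *: v) xc.
rewrite !(metricDl, metricDr, metricZl, metricZr) (metricC v u xc).
have -> : metric c x u u + - a * metric c x u v +
  (- a * metric c x u v + - a * (- a * metric c x v v)) =
  metric c x u u - metric c x u v ^+ 2 / metric c x v v.
  by rewrite /a; field; exact: lt0r_neq0.
by rewrite subr_ge0 ler_pdivrMr.
Qed.

Lemma gram_C1 c x i j : cod c x -> C1_at (fun y => gram c y i j) x.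
Proof.
by move=> xc; apply: Ck_on_C1_at (gram_smooth c i j 1%N) => //; exact: cod_open.
Qed.

Lemma partial_gram_C1 c x i j l : cod c x ->
  C1_at (partial l (fun y => gram c y i j)) x.
Proof.
by move=> xc; apply: Ck_on_partial_C1_at (gram_smooth c i j 2%N) => //; exact: cod_open.
Qed.

Lemma C1_at_continuous n (f : 'rV[R]_n -> R) y : C1_at f y -> {for y, continuous f}.
Proof. by move=> /C1_at_diff[fd _]; exact: differentiable_continuous. Qed.

Lemma gram_continuous c x : cod c x -> {for x, continuous (gram c)}.
Proof.
by move=> xc; apply/(@cvg_mxP _ _ _ (nbhs_filter x)) => i j; apply: (C1_at_continuous (gram_C1 i j xc)).
Qed.

Lemma is_derive_gram c (x : R -> 'rV[R]_m) t dx : cod c (x t) ->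
  is_derive t 1 x dx -> is_derive t 1 (fun s => gram c (x s)) (dgram c (x t) dx).
Proof.
move=> xc xd; apply/is_derive_mxP => i j; rewrite mxE.
exact: (is_derive_C1_comp (gram_C1 i j xc) xd).
Qed.

Lemma is_derive_metric c (x a b : R -> 'rV[R]_m) t dx da db : cod c (x t) ->
  is_derive t 1 x dx -> is_derive t 1 a da -> is_derive t 1 b db ->
  is_derive t 1 (fun s => metric c (x s) (a s) (b s))
    (metric c (x t) da (b t) + (a t *m dgram c (x t) dx *m (b t)^T) ord0 ord0
      + metric c (x t) (a t) db).
Proof.
move=> xc xd ad bd.
have := is_derive_mulmx (is_derive_mulmx ad (is_derive_gram xc xd)) (is_derive_trmx bd).
move=> /is_derive_mxP /(_ ord0 ord0) H; apply: is_derive_eq H _.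
by rewrite mulmxDl [LHS]mxE [X in X + _ = _]mxE.
Qed.

(** Euler-Lagrange form of the geodesic equation. Pairing with [w] removes the inverse matrix from
    the Christoffel symbols, so only directional derivatives of the metric are left. *)
Lemma geodesic_eq c x (dx ddx : 'rV[R]_m) w : cod c x ->
  (forall k : 'I_m, ddx ord0 k + \sum_(i < m) \sum_(j < m)
     christoffel c k i j x * dx ord0 i * dx ord0 j = 0) ->
  metric c x ddx w = 2^-1 * (dx *m dgram c x w *m dx^T) ord0 ord0
    - (dx *m dgram c x dx *m w^T) ord0 ord0.
Proof.
move=> xc ode; pose dG i j l := partial i (fun y => gram c y j l) x.
(* Twice the Christoffel symbols of the first kind, contracted with [dx] in both lower indices. *)
pose tau : 'rV[R]_m := \row_l \sum_i \sum_j
  (dG i j l + dG j i l - dG l i j) * (dx ord0 i * dx ord0 j).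
have invC k l : invmx (gram c x) k l = invmx (gram c x) l k.
  by rewrite -[in LHS](gram_sym xc) -trmx_inv mxE.
have -> : ddx = (- 2^-1 *: tau) *m invmx (gram c x).
  apply/rowP => k; move/eqP : (ode k); rewrite addr_eq0 => /eqP ->.
  rewrite -scalemxAl scaleNr !mxE; congr (- _).
  transitivity (\sum_i \sum_j \sum_l 2^-1 * (invmx (gram c x) k l *
    (dG i j l + dG j i l - dG l i j)) * (dx ord0 i * dx ord0 j)).
    apply: eq_bigr => i _; apply: eq_bigr => j _.
    by rewrite /christoffel -mulrA mulr_sumr big_distrl.
  under eq_bigr do rewrite exchange_big /=.
  rewrite exchange_big mulr_sumr; apply: eq_bigr => l _; rewrite !mxE invC.
  rewrite mulr_suml mulr_sumr; apply: eq_bigr => i _.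
  rewrite mulr_suml mulr_sumr; apply: eq_bigr => j _; ring.
rewrite /metric mulmxKV; last exact: gram_unit.
rewrite -scalemxAl mxE.
have -> : (tau *m w^T) ord0 ord0 = 2 * (dx *m dgram c x dx *m w^T) ord0 ord0
   - (dx *m dgram c x w *m dx^T) ord0 ord0.
  have E1 : (dx *m dgram c x dx *m w^T) ord0 ord0 =
      \sum_l \sum_i \sum_j dG i j l * (dx ord0 i * dx ord0 j) * w ord0 l.
    rewrite bilinE exchange_big; apply: eq_bigr => l _.
    rewrite exchange_big; apply: eq_bigr => j _.
    rewrite mxE /dpart mulr_sumr mulr_suml; apply: eq_bigr => i _; rewrite /dG; ring.
  (* The first two terms of [tau] contribute equally: they are exchanged by swapping [i] and [j],
     while [dx ord0 i * dx ord0 j] is symmetric. *)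
  have E2 : (dx *m dgram c x dx *m w^T) ord0 ord0 =
      \sum_l \sum_i \sum_j dG j i l * (dx ord0 i * dx ord0 j) * w ord0 l.
    rewrite E1; apply: eq_bigr => l _; rewrite exchange_big; apply: eq_bigr => i _.
    by apply: eq_bigr => j _; rewrite [dx _ i * _]mulrC.
  rewrite [2 * _]mulr_natl mulr2n [X in X + _ - _]E1 E2.
  have -> : (dx *m dgram c x w *m dx^T) ord0 ord0 =
      \sum_l \sum_i \sum_j dG l i j * (dx ord0 i * dx ord0 j) * w ord0 l.
    rewrite bilinE exchange_big /=; under [RHS]eq_bigr do rewrite exchange_big.
    rewrite [RHS]exchange_big; apply: eq_bigr => j _.
    rewrite [RHS]exchange_big; apply: eq_bigr => i _.
    rewrite mxE /dpart mulr_sumr mulr_suml; apply: eq_bigr => l _; rewrite /dG; ring.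
  rewrite mxE -big_split -sumrB; apply: eq_bigr => l _; rewrite !mxE mulr_suml.
  rewrite -big_split -sumrB; apply: eq_bigr => i _; rewrite mulr_suml.
  rewrite -big_split -sumrB; apply: eq_bigr => j _ /=; ring.
by field.
Qed.

End Metric.

(** * Uniform bounds on the metric near a point *)

Section LocalBounds.
Context {R : realType}.

(** Dividing by [a + 1] covers [a = 0], which occurs because many constants contain the dimension as
    a factor. *)
Lemma exists_small_factor (a b : R) : 0 <= a -> 0 < b -> exists2 z, 0 < z & a * z <= b.
Proof.
move=> a0 b0; have a1 : 0 < a + 1 by rewrite ltr_wpDl.
exists (b / (a + 1)); first by rewrite divr_gt0.
by rewrite mulrCA ler_piMr ?(ltW b0)// ler_pdivrMr// mul1r lerDl.
Qed.

Lemma near_bounded (T : topologicalType) (I : finType) (f : I -> T -> R) (x : T) :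
  (forall i, {for x, continuous (f i)}) ->
  exists2 K : R, 0 <= K & \forall y \near x, forall i, `|f i y| <= K.
Proof.
move=> fc; exists (\sum_i (`|f i x| + 1)).
  by apply: sumr_ge0 => i _; rewrite addr_ge0.
apply: (@filter_forall _ _ (fun i y => `|f i y| <= _) (nbhs x)) => i.
have : \forall y \near x, `|f i x - f i y| <= 1.
  by move/cvgrPdist_le : (fc i) => /(_ 1 ltr01).
apply: filterS => y fxy; rewrite (bigD1 i)//= ler_wpDr//.
  by apply: sumr_ge0 => j _; rewrite addr_ge0.
have := ler_normD (f i x) (f i y - f i x); rewrite subrKC distrC => H.
by apply: le_trans H _; rewrite lerD2l.
Qed.

Lemma near_cball m (x : 'rV[R]_m) (P : 'rV[R]_m -> Prop) :
  (\forall y \near x, P y) -> exists2 r : R, 0 < r & forall y, cball x r y -> P y.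
Proof.
move=> /nbhs_ballP[r /= r0 rP]; exists (r / 2); first by rewrite divr_gt0.
move=> y yr; apply: rP; rewrite -ball_normE /=; rewrite /cball /= in yr.
by rewrite distrC (le_lt_trans yr)// ltr_pdivrMr// ltr_pMr// ltr1n.
Qed.

Lemma compact_cball m (x0 : 'rV[R]_m) (r : R) : compact (cball x0 r).
Proof.
apply: bounded_closed_compact.
  exists (`|x0| + r); split; first exact: num_real.
  move=> K xK x /= xr; apply: le_trans (ltW xK).
  by rewrite -[x](subrKC x0); apply: le_trans (ler_normD _ _) _; rewrite lerD2l.
have -> : cball x0 r = (fun x => `|x - x0|) @^-1` [set s | s <= r] by [].
apply: preimage_closed => [x _|]; last exact: closed_le.
apply: (continuous_comp (f := fun y : 'rV[R]_m => y - x0) (g := fun y => `|y|)).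
  apply: (@cvgB R 'rV[R]_m _ _ (nbhs_filter x) id (cst x0) x x0).
    exact: cvg_id.
  exact: cvg_cst.
exact: norm_continuous.
Qed.

Context {m : nat} (M : riemannianManifold R m).
Implicit Types (p q : M) (gam : R -> M) (c : atlas M) (u v w x : 'rV[R]_m).

(** One constant serves for coercivity, size and two orders of derivatives, so that all later
    estimates are polynomials in [m] and [L]. *)
Definition tame c (L : R) x : Prop := [/\ cod c x,
  forall u, `|u| ^+ 2 <= L * metric c x u u, `|gram c x| <= L,
  forall i j l, `|partial l (fun y => gram c y i j) x| <= L &
  forall i j l k, `|partial k (partial l (fun y => gram c y i j)) x| <= L].

(* [u_i = <u, a_i>] with [a_i] the [i]-th row of the inverse of the Gram matrix,
   so Cauchy-Schwarz bounds [u_i]; no compactness is needed. *)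
Lemma metric_coercive c x : cod c x ->
  exists2 A : R, 0 < A & forall u, `|u| ^+ 2 <= A * metric c x u u.
Proof.
move=> xc; pose a i : 'rV[R]_m := row i (invmx (gram c x)).
have aE u i : metric c x u (a i) = u ord0 i.
  rewrite metricC// /metric /a -row_mul mulVmx ?gram_unit//.
  by rewrite rowE mulmx1 -rowE !mxE.
have a0 i : 0 <= metric c x (a i) (a i) by exact: metric_ge0.
pose A := \sum_i metric c x (a i) (a i) + 1.
have A0 : 0 < A by rewrite ltr_wpDl// sumr_ge0.
exists A => // u; have u0 := metric_ge0 u xc.
have Au0 : 0 <= A * metric c x u u by rewrite mulr_ge0// ltW.
rewrite -[leRHS]sqr_sqrtr// lerXn2r ?nnegrE ?sqrtr_ge0//.
apply: mx_norm_le; first exact: sqrtr_ge0.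
move=> i j; rewrite ord1 -sqrtr_sqr ler_wsqrtr// -aE.
apply: le_trans (metric_CauchySchwarz u (a j) xc) _.
rewrite mulrC ler_wpM2r// /A (bigD1 j)//= -addrA lerDl addr_ge0//.
by apply: sumr_ge0 => k _.
Qed.

Lemma near_tame c x0 : cod c x0 ->
  exists2 L : R, 1 <= L & \forall x \near x0, tame c L x.
Proof.
move=> xc; have [A A0 AP] := metric_coercive xc.
have [K1 K10 K1P] := @near_bounded _ unit (fun _ x => `|gram c x|) x0
  (fun _ => continuous_comp (gram_continuous xc) (@norm_continuous _ _ _)).
have [K2 K20 K2P] := @near_bounded _ ('I_m * 'I_m * 'I_m)%type
  (fun k => partial k.2 (fun y => gram c y k.1.1 k.1.2)) x0
  (fun k => C1_at_continuous (partial_gram_C1 k.1.1 k.1.2 k.2 xc)).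
have [K3 K30 K3P] := @near_bounded _ ('I_m * 'I_m * 'I_m * 'I_m)%type
  (fun k => partial k.2 (partial k.1.2 (fun y => gram c y k.1.1.1 k.1.1.2))) x0
  (fun k => (partial_gram_C1 k.1.1.1 k.1.1.2 k.1.2 xc k.2).2).
(* A change of the Gram matrix by [e] alters the quadratic form by at most [(2 * A)^-1 * |u|^2],
   half of what coercivity at [x0] provides. Coercivity thus survives nearby with [2 * A]. *)
pose e := (2 * A * m.+1%:R ^+ 2)^-1.
have e0 : 0 < e by rewrite invr_gt0 !mulr_gt0// exprn_gt0.
have Gc : \forall x \near x0, `|gram c x0 - gram c x| <= e.
  by move/cvgrPdist_le : (gram_continuous xc) => /(_ _ e0).
exists (2 * A + K1 + K2 + K3 + 1).
  by rewrite lerDr !addr_ge0// mulr_ge0// ltW.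
near=> x; have xc' : cod c x by near: x; exact: nbhs_cod.
have le_sum a b d f : 0 <= a -> 0 <= b -> 0 <= d -> 0 <= f ->
    [/\ a <= a + b + d + f + 1, b <= a + b + d + f + 1, d <= a + b + d + f + 1 &
     f <= a + b + d + f + 1 :> R] by move=> *; split; lra.
have [L1 L2 L3 L4] := le_sum (2 * A) K1 K2 K3 (mulr_ge0 (ler0n _ _) (ltW A0)) K10 K20 K30.
split=> //.
- move=> u; apply: (@le_trans _ _ (2 * A * metric c x u u)); last first.
    by rewrite ler_wpM2r// metric_ge0.
  have eu : `|metric c x0 u u - metric c x u u| <= (2 * A)^-1 * `|u| ^+ 2.
    have -> : metric c x0 u u - metric c x u u =
       (u *m (gram c x0 - gram c x) *m u^T) ord0 ord0.
      by rewrite mulmxBr mulmxBl [RHS]mxE [X in _ = _ + X]mxE.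
    apply: le_trans (bilin_norm_le _ _ _) _.
    apply: (@le_trans _ _ (m.+1%:R ^+ 2 * (`|u| * e * `|u|))).
      rewrite ler_pM// ?mulr_ge0//.
        by rewrite lerXn2r ?nnegrE// ler_nat.
      rewrite ler_wpM2r// ler_wpM2l//; near: x; exact: Gc.
    rewrite [leLHS](_ : _ = (2 * A)^-1 * `|u| ^+ 2)// /e.
    have : m.+1%:R != 0 :> R by rewrite pnatr_eq0.
    by move: (m.+1%:R) => N N0; field; rewrite N0 (lt0r_neq0 A0).
  have := AP u; move: eu; rewrite ler_norml => /andP[_ eu] Au.
  have : A * (metric c x0 u u - metric c x u u) <= A * ((2 * A)^-1 * `|u| ^+ 2).
    by rewrite ler_wpM2l// ltW.
  have -> : A * ((2 * A)^-1 * `|u| ^+ 2) = 2^-1 * `|u| ^+ 2.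
    by field; rewrite lt0r_neq0.
  lra.
- apply: le_trans L2; rewrite -[leLHS]normr_id.
  have : forall _ : unit, `| `|gram c x| | <= K1 by near: x; exact: K1P.
  by apply; exact: tt.
- move=> i j l; apply: le_trans L3.
  have : forall k : 'I_m * 'I_m * 'I_m,
      `|partial k.2 (fun y => gram c y k.1.1 k.1.2) x| <= K2 by near: x; exact: K2P.
  by move=> /(_ (i, j, l)).
- move=> i j l k; apply: le_trans L4.
  have : forall k : 'I_m * 'I_m * 'I_m * 'I_m,
      `|partial k.2 (partial k.1.2 (fun y => gram c y k.1.1.1 k.1.1.2)) x| <= K3.
    by near: x; exact: K3P.
  by move=> /(_ (i, j, l, k)).
Unshelve. all: by end_near. Qed.

Lemma dgram_norm_le c L x w : tame c L x -> `|dgram c x w| <= m%:R * L * `|w|.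
Proof.
move=> [xc _ GL pL _]; have L0 : 0 <= L by exact: le_trans GL.
apply: mx_norm_le => [|i j]; first by rewrite !mulr_ge0.
by rewrite mxE -mulrA; apply: dpart_norm_le => l; exact: pL.
Qed.

Lemma gram_taylor c L x0 r x y : (forall z, cball x0 r z -> tame c L z) ->
  cball x0 r x -> cball x0 r y ->
  `|gram c y - gram c x - dgram c x (y - x)| <= m%:R ^+ 2 * L * `|y - x| ^+ 2.
Proof.
move=> tm xr yr; have L0 : 0 <= L by have [_ _ GL _ _] := tm x xr; exact: le_trans GL.
apply: mx_norm_le => [|i j]; first by rewrite !mulr_ge0// exprn_ge0.
have := @C2_taylor _ _ (fun y => gram c y i j) x0 r L L0.
rewrite !mxE; apply => // [z /tm[zc _ _ _ _]|z l /tm[zc _ _ _ _]|z l k /tm[]].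
- exact: gram_C1.
- exact: partial_gram_C1.
- by move=> _ _ _ _; exact.
Qed.

End LocalBounds.

(** * Curves and geodesics *)

Lemma near_eq_continuous (S T : topologicalType) (f g : S -> T) (t : S) :
  (\forall s \near t, f s = g s) -> {for t, continuous f} -> {for t, continuous g}.
Proof.
move=> E fc; change (g s @[s --> t] --> g t); rewrite -(nbhs_singleton E).
exact: cvg_trans (near_eq_cvg E) fc.
Qed.

Section UnitIntegral.
Context {R : realType}.
Local Notation mu := (@lebesgue_measure R).
Implicit Types f g h : R -> R.

Definition C1_real h (t : R) : Prop :=
  (\forall s \near t, derivable h s 1) /\ {for t, continuous (derive1 h)}.

Definition continuous01 f := forall t : R, 0 <= t <= 1 -> {for t, continuous f}.

Lemma continuous01_within f : continuous01 f -> {within `[0, 1], continuous f}.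
Proof.
move=> fc; apply: continuous_in_subspaceT => t.
by rewrite inE /= in_itv /= => t01; exact: fc.
Qed.

Lemma continuous01_integrable f : continuous01 f ->
  mu.-integrable `[0, 1] (EFin \o f).
Proof.
move=> fc; apply: continuous_compact_integrable; first exact: segment_compact.
exact: continuous01_within.
Qed.

Lemma le_integral01 f g : continuous01 f -> continuous01 g ->
  (forall t : R, 0 <= t <= 1 -> f t <= g t) ->
  \int[mu]_(t in `[0, 1]) f t <= \int[mu]_(t in `[0, 1]) g t.
Proof.
move=> fc gc fg; apply: le_Rintegral => //; try exact: continuous01_integrable.
Qed.

Lemma integral01_derive h : (forall t : R, 0 <= t <= 1 -> C1_real h t) ->
  \int[mu]_(t in `[0, 1]) derive1 h t = h 1 - h 0.
Proof.
move=> hC; rewrite /Rintegral (@continuous_FTC2 _ (derive1 h) h)//.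
- by apply: continuous01_within => t /hC[].
- have hd (t : R) : 0 <= t <= 1 -> derivable h t 1 by move=> /hC[/nbhs_singleton].
  have hc (t : R) : 0 <= t <= 1 -> h s @[s --> t] --> h t.
    by move=> /hd ?; apply/differentiable_continuous/derivable1_diffP.
  split.
  + by move=> t; rewrite in_itv /= => /andP[/ltW t0 /ltW t1]; apply/hd/andP.
  + by apply: cvg_at_right_filter; apply: hc; rewrite lexx ler01.
  + by apply: cvg_at_left_filter; apply: hc; rewrite lexx ler01.
Qed.

Lemma C1_real_continuous h : (forall t : R, 0 <= t <= 1 -> C1_real h t) ->
  continuous01 (derive1 h).
Proof. by move=> hC t /hC[]. Qed.

Lemma C1_realP h (dh : R -> R) (t : R) : (\forall s \near t, is_derive (s : R) 1 h (dh s)) ->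
  {for t, continuous dh} -> C1_real h t.
Proof.
move=> hd dhc; split; first by apply: filterS hd => s [].
apply: near_eq_continuous dhc.
by apply: filterS hd => s /derive1_is_derive.
Qed.

End UnitIntegral.

Section Curves.
Context {R : realType} {m : nat} (M : riemannianManifold R m).
Implicit Types (p q : M) (gam : R -> M) (c : atlas M) (u v w x : 'rV[R]_m).

Lemma derivable_is_derive1 (V : normedModType R) (x : R -> V) (t : R) :
  derivable x t 1 -> is_derive t 1 x (derive1 x t).
Proof. by move=> xd; rewrite derive1E; exact: derivableP. Qed.

Lemma is_derive_continuous (V : normedModType R) (x : R -> V) (t : R) (dx : V) :
  is_derive t 1 x dx -> {for t, continuous x}.
Proof. by case=> xd _; exact/differentiable_continuous/derivable1_diffP. Qed.

Lemma C1_curve_chart gam t c : C1_curve_at gam t -> dom c (gam t) ->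
  [/\ \forall s \near t, dom c (gam s),
   \forall s \near t, is_derive (s : R) 1 (chart c \o gam) (derive1 (chart c \o gam) s) &
   {for t, continuous (derive1 (chart c \o gam))}].
Proof.
move=> gC /gC[gd gc]; split=> //; first by apply: filterS gd => s [].
by apply: filterS gd => s [_]; exact: derivable_is_derive1.
Qed.

Lemma C1_curve_continuous gam t : C1_curve_at gam t -> {for t, continuous gam}.
Proof.
move=> gC; have gta := dom_chart_at (gam t).
have [gc /nbhs_singleton xd _] := C1_curve_chart gC gta.
have H : {for t, continuous (chart_inv (chart_at (gam t)) \o (chart (chart_at (gam t)) \o gam))}.
  apply: (continuous_comp (is_derive_continuous xd)).
  exact/chart_inv_continuous/cod_chart.
change (gam s @[s --> t] --> gam t); rewrite -[X in _ --> X](chartK gta).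
apply: cvg_trans H; apply: near_eq_cvg.
by apply: filterS gc => s gs /=; rewrite chartK.
Qed.

Lemma geodesic_C1_curve gam t : geodesic_at gam t -> C1_curve_at gam t.
Proof.
move=> gG c gtc; have H := gG c gtc; split.
  by apply: filterS H => s [].
have [_ _ xd2 _] := nbhs_singleton H.
exact: is_derive_continuous (derivable_is_derive1 xd2).
Qed.

Lemma tnorm_velocity gam t c dx :
  (\forall s \near t, dom c (gam s)) -> is_derive t 1 (chart c \o gam) dx ->
  inner (velocity gam t) (velocity gam t) = metric c (chart c (gam t)) dx dx.
Proof.
move=> gc xd; rewrite (inner_tocoord _ _ (nbhs_singleton gc)).
by rewrite (velocity_tocoord gc xd).
Qed.

Lemma cvg_metric c (T : Type) (F : set_system T) (FF : Filter F)
    (x a b : T -> 'rV[R]_m) (x0 a0 b0 : 'rV[R]_m) : cod c x0 ->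
  x t @[t --> F] --> x0 -> a t @[t --> F] --> a0 -> b t @[t --> F] --> b0 ->
  metric c (x t) (a t) (b t) @[t --> F] --> metric c x0 a0 b0.
Proof.
move=> xc cx ca cb; have cG : gram c (x t) @[t --> F] --> gram c x0.
  exact: (cvg_comp _ _ cx (gram_continuous xc)).
have H := cvg_mulmx (cvg_mulmx ca cG) (cvg_trmx cb).
exact: ((@cvg_mxP R T F FF _ _ _ _).1 (H FF FF FF) ord0 ord0).
Qed.

Lemma near_inner_velocity gam t c : C1_curve_at gam t -> dom c (gam t) ->
  \forall s \near t, inner (velocity gam s) (velocity gam s) =
    metric c (chart c (gam s)) (derive1 (chart c \o gam) s)
      (derive1 (chart c \o gam) s).
Proof.
move=> gC gtc; have [/near_join gc xd _] := C1_curve_chart gC gtc.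
by apply: filterS2 gc xd => s; exact: tnorm_velocity.
Qed.

Lemma continuous_tnorm_velocity gam t : C1_curve_at gam t ->
  {for t, continuous (fun s => tnorm (velocity gam s))}.
Proof.
move=> gC; have gta := dom_chart_at (gam t).
have [gc xd dxc] := C1_curve_chart gC gta.
have E := near_inner_velocity gC gta.
change (tnorm (velocity gam s) @[s --> t] --> tnorm (velocity gam t)).
rewrite /tnorm; apply: (cvg_comp _ Num.sqrt); last exact: sqrt_continuous.
rewrite (nbhs_singleton E); apply: cvg_trans (near_eq_cvg _) _.
  by apply: filterS E => s /= ->; reflexivity.
apply: cvg_metric => //; first exact: cod_chart.
exact: (is_derive_continuous (nbhs_singleton xd)).
Qed.

(** With [w = x'] the geodesic equation gives [<x'', x'>] as minus half of the derivative of the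
    metric along [x'], and the terms cancel. *)
Lemma geodesic_speed gam t : geodesic_at gam t ->
  is_derive t 1 (fun s => inner (velocity gam s) (velocity gam s)) 0.
Proof.
move=> gG; have gC := geodesic_C1_curve gG; have gta := dom_chart_at (gam t).
have E := near_inner_velocity gC gta.
have [_ xd xd2 ode] := nbhs_singleton (gG _ gta).
set x := chart _ \o gam in E xd xd2 ode *.
apply: (@near_eq_is_derive _ _ _
  (fun s => metric (chart_at (gam t)) (x s) (derive1 x s) (derive1 x s))).
  by apply: filterS E => s ->.
have xc := cod_chart gta.
apply: is_derive_eq (is_derive_metric xc (derivable_is_derive1 xd)
  (derivable_is_derive1 xd2) (derivable_is_derive1 xd2)) _.
rewrite [metric _ _ _ (derive1 (derive1 _) _)]metricC// !(geodesic_eq _ xc ode).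
by field.
Qed.

Lemma geodesic_const_speed gam (a b : R) : a <= b ->
  (forall t, a <= t <= b -> geodesic_at gam t) -> forall t, a <= t <= b ->
  inner (velocity gam t) (velocity gam t) = inner (velocity gam a) (velocity gam a).
Proof.
move=> ab gG t /andP[a_t tb]; apply/eqP; rewrite -subr_eq0 -normr_le0.
have := @is_derive_segment_le _ (fun s => inner (velocity gam s) (velocity gam s))
  (fun=> 0) a t 0 0 a_t.
rewrite !mul0r !subr0; apply => [s /andP[a_s st]|s _]; last by rewrite normr0.
by apply/geodesic_speed/gG; rewrite a_s (le_trans st).
Qed.

Lemma chart_curve_C1 c (y : R -> 'rV[R]_m) t : cod c (y t) ->
  (\forall s \near t, derivable y s 1) -> {for t, continuous (derive1 y)} ->
  C1_curve_at (chart_inv c \o y) t.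
Proof.
move=> yc yd dyc c' gtc'; have [gtc yE] := chart_invP yc.
have yd' : \forall s \near t, is_derive (s : R) 1 y (derive1 y s).
  by apply: filterS yd => s; exact: derivable_is_derive1.
have yct := is_derive_continuous (nbhs_singleton yd').
have gc : \forall s \near t, cod c (y s) by exact: (yct _ (nbhs_cod yc)).
have gc' : \forall s \near t, dom c' (chart_inv c (y s)).
  have := near_chart_inv_dom gtc gtc'; rewrite yE => H.
  have H2 : \forall s \near t, cod c (y s) /\ dom c' (chart_inv c (y s)) := yct _ H.
  by apply: filterS H2 => s [].
have xd : \forall s \near t, is_derive (s : R) 1 (chart c' \o (chart_inv c \o y))
   (\row_j dpart (fun x => transition c c' x ord0 j) (y s) (derive1 y s)).
  have gc2 := near_join gc.
  apply: filterS3 gc2 gc' yd' => s ys gs ysd.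
  have ysc := nbhs_singleton ys.
  have [dys ysE] := chart_invP ysc.
  have h1 : \forall r \near s, dom c ((chart_inv c \o y) r).
    by apply: filterS ys => r /chart_invP[].
  have h2 : is_derive (s : R) 1 (chart c \o (chart_inv c \o y)) (derive1 y s).
    apply: near_eq_is_derive ysd.
    by apply: filterS ys => r /chart_invP[_ /= ->].
  have := is_derive_transition h1 (gs : dom c' ((chart_inv c \o y) s)) h2.
  have := jacobian_transitionE (derive1 y s) dys gs.
  by rewrite ysE => ->.
split; first by apply: filterS2 gc' xd => s gs [].
apply: (@near_eq_continuous _ _ (fun s =>
    \row_j dpart (fun x => transition c c' x ord0 j) (y s) (derive1 y s))).
  by apply: filterS xd => s /derive1_is_derive.
apply/(cvg_mxP _ _) => i j; rewrite mxE; under eq_fun do rewrite mxE.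
apply: cvg_sumr => k; apply: cvgM.
  exact: ((cvg_mxP _ _).1 dyc ord0 k).
apply: (cvg_comp y _ yct); rewrite -yE.
exact: (transition_C1 j gtc gtc' k).2.
Qed.

End Curves.

(** * The Riemannian distance *)

Section Distance.
Context {R : realType} {m : nat} (M : riemannianManifold R m).
Implicit Types (p q : M) (gam : R -> M) (c : atlas M) (u v w x : 'rV[R]_m).

Lemma curve_length_ge0 gam : 0 <= curve_length gam.
Proof. by apply: Rintegral_ge0 => t _; exact: sqrtr_ge0. Qed.

Lemma piecewise_length_ge0 p q l : piecewise_length p q l -> 0 <= l.
Proof. by elim=> // gam q' l' _ _ l0; rewrite addr_ge0// curve_length_ge0. Qed.

Lemma rdist_le p q l : piecewise_length p q l -> rdist p q <= l.
Proof.
move=> pql; apply: ge_inf => //; exists 0 => l'; exact: piecewise_length_ge0.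
Qed.

Lemma rdist_self_le0 p : rdist p p <= 0.
Proof. exact/rdist_le/piecewise_nil. Qed.

Lemma piecewise_length_cat p q r l l' : piecewise_length p q l ->
  piecewise_length q r l' -> piecewise_length p r (l + l').
Proof.
elim=> [s|gam s k gC _ ih] sr; first by rewrite add0r.
by rewrite -addrA; apply: piecewise_cons => //; exact: ih.
Qed.

(** It is enough to dominate the speed by the derivative of a known function [h]. The conclusion
    exhibits a length rather than bounding [rdist], so that it also yields reachability. *)
Lemma rdist_le_curve c (y dy : R -> 'rV[R]_m) (h : R -> R) :
  (forall t : R, 0 <= t <= 1 -> cod c (y t)) ->
  (forall t : R, 0 <= t <= 1 -> \forall s \near t, is_derive (s : R) 1 y (dy s)) ->
  (forall t : R, 0 <= t <= 1 -> {for t, continuous dy}) ->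
  (forall t : R, 0 <= t <= 1 -> C1_real h t) ->
  (forall t : R, 0 <= t <= 1 ->
     Num.sqrt (metric c (y t) (dy t) (dy t)) <= derive1 h t) ->
  exists2 l, piecewise_length (chart_inv c (y 0)) (chart_inv c (y 1)) l &
    l <= h 1 - h 0.
Proof.
move=> yc yd dyc hC yh; pose gam := chart_inv c \o y.
have gC t : 0 <= t <= 1 -> C1_curve_at gam t.
  move=> t01; apply: chart_curve_C1; first exact: yc.
    by apply: filterS (yd t t01) => s [].
  apply: near_eq_continuous (dyc t t01).
  by apply: filterS (yd t t01) => s /derive1_is_derive.
exists (curve_length gam + 0).
  exact: (@piecewise_cons _ _ _ gam _ _ gC (piecewise_nil (gam 1))).
rewrite addr0 -integral01_derive//; apply: le_integral01.
- by move=> t t01; apply: continuous_tnorm_velocity; exact: gC.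
- exact: C1_real_continuous.
move=> t t01; apply: le_trans (yh t t01); rewrite /tnorm.
have [gtc yE] := chart_invP (yc t t01).
have ysc : \forall s \near t, cod c (y s).
  by apply: (is_derive_continuous (nbhs_singleton (yd t t01))); exact/nbhs_cod/yc.
have gc : \forall s \near t, dom c (gam s).
  by apply: filterS ysc => s /chart_invP[].
have gd : is_derive t 1 (chart c \o gam) (dy t).
  apply: near_eq_is_derive (nbhs_singleton (yd t t01)).
  by apply: filterS ysc => s /chart_invP[_ /= ->].
by rewrite (tnorm_velocity gc gd) /= yE.
Qed.

Lemma line_length c x0 (r L : R) x y : 1 <= L ->
  (forall z, cball x0 r z -> tame c L z) -> cball x0 r x -> cball x0 r y ->
  exists2 l, piecewise_length (chart_inv c x) (chart_inv c y) l &
    l <= m%:R * L * `|y - x|.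
Proof.
move=> L1 tm xr yr; set K := m%:R * L * _.
have L0 : 0 <= L by rewrite (le_trans _ L1).
have K0 : 0 <= K by rewrite !mulr_ge0.
have Kd (t : R) : is_derive t 1 (fun s : R => 0 + s *: K) K by exact: is_derive_affine.
have := @rdist_le_curve c (fun s => x + s *: (y - x)) (fun=> y - x) (fun s => 0 + s *: K).
rewrite !scale0r !addr0 !scale1r subrKC add0r subr0; apply.
- by move=> t t01; have [] := tm _ (cball_segment xr yr t01).
- by move=> t _; apply: (@filterE _ (nbhs t)) => s; exact: is_derive_affine.
- by move=> t _; exact: cst_continuous.
- move=> t _; apply: (@C1_realP _ _ (fun=> K)); first exact: (@filterE _ (nbhs t)).
  exact: cst_continuous.
- move=> t t01; rewrite (derive1_is_derive (Kd t)) -[leRHS](ger0_norm K0) -sqrtr_sqr.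
  apply: ler_wsqrtr; apply: le_trans (ler_norm _) _.
  have [_ _ GL _ _] := tm _ (cball_segment xr yr t01).
  apply: le_trans (bilin_norm_le _ _ _) _; rewrite /K !exprMn -[leRHS]mulrA.
  rewrite ler_wpM2l ?exprn_ge0// mulrAC -expr2 mulrC ler_wpM2r ?exprn_ge0//.
  by apply: (le_trans GL); rewrite expr2 ler_peMl.
Qed.

Lemma rdist_le_line c x0 (r L : R) x y : 1 <= L ->
  (forall z, cball x0 r z -> tame c L z) -> cball x0 r x -> cball x0 r y ->
  rdist (chart_inv c x) (chart_inv c y) <= m%:R * L * `|y - x|.
Proof.
by move=> L1 tm xr yr; have [l /rdist_le pl] := line_length L1 tm xr yr; exact: le_trans.
Qed.

(** Both directions are recorded because curves are not reversed: the first makes the set of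
    reachable points open, the second its complement. *)
Lemma near_reachable p : \forall q \near p,
  (exists l, piecewise_length p q l) /\ (exists l, piecewise_length q p l).
Proof.
have pc := dom_chart_at p; have [L L1 /near_cball[r r0 tm]] := near_tame (cod_chart pc).
have xr : cball (chart (chart_at p) p) r (chart (chart_at p) p).
  by rewrite /cball /= subrr normr0 ltW.
have nr : \forall q \near p, cball (chart (chart_at p) p) r (chart (chart_at p) q).
  have := chart_continuous pc; move/cvgrPdist_le => /(_ r r0).
  by apply: filterS => q; rewrite distrC.
apply: filterS2 (nbhs_dom pc) nr => q qc qr; split.
  have [l] := line_length L1 tm xr qr; rewrite !chartK// => pl _; by exists l.
have [l] := line_length L1 tm qr xr; rewrite !chartK// => pl _; by exists l.
Qed.

Lemma reachable p q : connected [set: M] -> exists l, piecewise_length p q l.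
Proof.
move=> Mc; pose A := [set q | exists l, piecewise_length p q l].
suff AE : A = [set: M] by have : A q by rewrite AE.
apply: Mc.
- by exists p, 0; exact: piecewise_nil.
- exists A; last by rewrite setTI.
  rewrite openE => r [l pr]; apply: filterS (near_reachable r) => s [[l' rs] _].
  by exists (l + l'); exact: piecewise_length_cat rs.
- exists A; last by rewrite setTI.
  rewrite -[A]setCK; apply: open_closedC; rewrite openE => r nr.
  apply: filterS (near_reachable r) => s [_ [l' sr]] [l ps]; apply: nr.
  by exists (l + l'); exact: piecewise_length_cat sr.
Qed.

(* Connectedness is needed because the infimum of the empty set is [0]. *)
Lemma le_rdist p q a : connected [set: M] ->
  (forall l, piecewise_length p q l -> a <= l) -> a <= rdist p q.
Proof.
move=> Mc al; apply: lb_le_inf; last by move=> l; exact: al.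
by have [l pl] := reachable p q Mc; exists l.
Qed.

Lemma rdist_ge0 p q : connected [set: M] -> 0 <= rdist p q.
Proof. by move=> Mc; apply: le_rdist => // l; exact: piecewise_length_ge0. Qed.

End Distance.

(** * A cut-off function that is Lipschitz for the Riemannian distance *)

Section Cutoff.
Context {R : realType} {m : nat} (M : riemannianManifold R m).
Implicit Types (p q : M) (gam : R -> M) (c : atlas M) (u v w x : 'rV[R]_m).

(** Squaring makes the positive part continuously differentiable, as the fundamental theorem of
    calculus requires along curves. *)
Definition ramp (r : R) : R := Num.max 0 r ^+ 2.

Lemma is_derive_ramp (r : R) : is_derive r 1 ramp (2 * Num.max 0 r).
Proof.
have [r0|r0|->] := ltgtP r 0.
- rewrite ?mulr0; apply: (@near_eq_is_derive _ _ _ (cst 0)).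
    near=> s; rewrite /ramp max_l ?expr0n//; near: s.
    by apply: filterS (lt_nbhsl r0) => s /ltW.
- have H : is_derive r 1 (fun s : R => s ^+ 2) (2 * r).
    apply: is_derive_eq; rewrite /GRing.scale /=; ring.
  apply: near_eq_is_derive H; near=> s; rewrite /ramp max_r//; near: s.
  by apply: filterS (lt_nbhsr r0) => s /ltW.
- have H : (h^-1 *: (ramp (h *: 1 + 0) - ramp 0)) @[h --> 0^'] --> (0 : R).
    apply/cvgrPdist_le => e e0; near=> h; have h0 : h != 0 by near: h; exact: nbhs_dnbhs_neq.
    rewrite /ramp addr0 maxxx expr0n subr0 sub0r normrN /GRing.scale /= mulr1 normrM.
    rewrite normrV ?unitfE// ler_pdivrMl ?normr_gt0//.
    apply: (@le_trans _ _ (`|h| * `|h|)).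
      rewrite normrX expr2 ler_pM//; case: (leP 0 h) => [//|_]; by rewrite normr0.
    by rewrite ler_wpM2l//; near: h; exact: dnbhs0_le.
  rewrite ?maxxx mulr0; split; first by apply/cvg_ex; exists 0.
  by rewrite /derive; exact: cvg_lim.
Unshelve. all: by end_near. Qed.

(** The Euclidean square is differentiable, unlike the maximum norm of the ambient space. *)
Definition sqdist (x0 x : 'rV[R]_m) : R := \sum_i (x ord0 i - x0 ord0 i) ^+ 2.

Lemma sqdist_ge0 x0 x : 0 <= sqdist x0 x.
Proof. by apply: sumr_ge0 => i _; exact: sqr_ge0. Qed.

Lemma norm_le_sqdist x0 x : `|x - x0| ^+ 2 <= sqdist x0 x.
Proof.
rewrite -[leRHS]sqr_sqrtr ?sqdist_ge0// lerXn2r ?nnegrE ?sqrtr_ge0//.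
apply: mx_norm_le; first exact: sqrtr_ge0.
move=> i j; rewrite ord1 -sqrtr_sqr ler_wsqrtr// !mxE /sqdist (bigD1 j)//= lerDl.
by apply: sumr_ge0 => k _; exact: sqr_ge0.
Qed.

Lemma is_derive_sqdist x0 (x : R -> 'rV[R]_m) (t : R) (dx : 'rV[R]_m) : is_derive t 1 x dx ->
  is_derive t 1 (fun s => sqdist x0 (x s))
    (\sum_i 2 * (x t ord0 i - x0 ord0 i) * dx ord0 i).
Proof.
move=> /is_derive_mxP xd; apply: is_derive_sumr => i; have := xd ord0 i => xid.
by apply: is_derive_eq; rewrite /GRing.scale /=; ring.
Qed.

Lemma sqdist_continuous x0 : continuous (sqdist x0).
Proof.
move=> x; apply: (@cvg_sumr _ _ _ (nbhs_filter x)) => i.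
apply: (continuous_comp (f := fun y : 'rV[R]_m => y ord0 i - x0 ord0 i)
  (g := fun y => y ^+ 2)); last exact: exprn_continuous.
apply: (@cvgB R _ _ _ (nbhs_filter x) (fun y : 'rV[R]_m => y ord0 i) (cst (x0 ord0 i))).
  exact: coord_continuous.
exact: cvg_cst.
Qed.

(* A cut-off function, equal to [1] at the centre of a coordinate ball and to
   [0] off it.  It is Lipschitz for [rdist], so that short curves from the
   centre stay in the chart. *)
Definition cutoff c x0 (rho : R) p : R :=
  if `[< dom c p >] then ramp (1 - sqdist x0 (chart c p) / rho ^+ 2) else 0.

Lemma cutoff_center c x0 rho p : dom c p -> chart c p = x0 -> cutoff c x0 rho p = 1.
Proof.
move=> pc px; rewrite /cutoff asboolT// px /sqdist big1 => [|i _]; last by rewrite subrr expr0n.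
by rewrite mul0r subr0 /ramp max_r// expr1n.
Qed.

(** With [z] the normalised square distance, [z <= 1 - (1 - z)^2] on [0, 1]. This is how a lower
    bound on the cut-off becomes information on coordinates. *)
Lemma cutoff_gt0 c x0 rho p : 0 < rho -> 0 < cutoff c x0 rho p ->
  dom c p /\ sqdist x0 (chart c p) <= rho ^+ 2 * (1 - cutoff c x0 rho p).
Proof.
move=> r0; rewrite /cutoff; case: asboolP => [pc|_]; last by rewrite ltxx.
set s := sqdist _ _; rewrite /ramp; case: (leP 0 (1 - s / rho ^+ 2)) => [s1 _|_]; last first.
  by rewrite expr0n ltxx.
split=> //; have rho2 : 0 < rho ^+ 2 by rewrite exprn_gt0.
have sE : s = rho ^+ 2 * (s / rho ^+ 2) by rewrite mulrC divfK// lt0r_neq0.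
have z0 : 0 <= s / rho ^+ 2 by rewrite divr_ge0 ?sqdist_ge0// ltW.
rewrite [leLHS]sE ler_wpM2l ?(ltW rho2)//; move: (s / rho ^+ 2) s1 z0 => z z1 z0.
nra.
Qed.

Lemma cutoff_ge c x0 rho p : 0 < rho -> dom c p ->
  1 - 2 * (sqdist x0 (chart c p) / rho ^+ 2) <= cutoff c x0 rho p.
Proof.
move=> r0 pc; rewrite /cutoff asboolT// /ramp.
have : 0 <= sqdist x0 (chart c p) / rho ^+ 2.
  by rewrite divr_ge0 ?sqdist_ge0// exprn_ge0// ltW.
move: (_ / _) => z z0; case: (leP 0 (1 - z)) => z1; nra.
Qed.

End Cutoff.

Section CutoffCurve.
Context {R : realType} {m : nat} (M : riemannianManifold R m).
Implicit Types (p q : M) (gam : R -> M) (u v w x : 'rV[R]_m).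
Variables (c : atlas M) (x0 : 'rV[R]_m) (rho L : R).
Hypotheses (rho0 : 0 < rho) (L1 : 1 <= L).
Hypothesis tm : forall x, cball x0 rho x -> tame c L x.

Let L0 : 0 <= L. Proof. exact: le_trans L1. Qed.

Let rho_ge0 : 0 <= rho. Proof. exact: ltW. Qed.

Lemma sqdist_cball x : sqdist x0 x <= rho ^+ 2 -> cball x0 rho x.
Proof.
move=> xr; have := le_trans (norm_le_sqdist x0 x) xr.
by rewrite ler_pXn2r// nnegrE// ltW.
Qed.

(* The Hausdorff property enters here: it makes the cut-off function vanish in
   a neighbourhood of every point outside the chart. *)
Lemma tame_cball_closed :
  closed (chart_inv c @` [set x | sqdist x0 x <= rho ^+ 2]).
Proof.
apply: compact_closed; first exact: manifold_hausdorff.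
apply: continuous_compact.
  apply: continuous_in_subspaceT => x; rewrite inE /= => /sqdist_cball/tm[xc _ _ _ _].
  exact: chart_inv_continuous.
apply: (@subclosed_compact _ [set x | sqdist x0 x <= rho ^+ 2] (cball x0 rho));
  [|exact: compact_cball|exact: sqdist_cball].
have -> : [set x | sqdist x0 x <= rho ^+ 2] = sqdist x0 @^-1` [set s | s <= rho ^+ 2] by [].
by apply: preimage_closed => [x _|]; [exact: sqdist_continuous|exact: closed_le].
Qed.

Lemma cutoff_outside p :
  ~ (chart_inv c @` [set x | sqdist x0 x <= rho ^+ 2]) p -> cutoff c x0 rho p = 0.
Proof.
rewrite /cutoff; case: asboolP => // pc pK; rewrite /ramp max_l ?expr0n//.
rewrite subr_le0 ler_pdivlMr ?exprn_gt0// mul1r leNgt; apply/negP => s1.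
by apply: pK; exists (chart c p); [exact: ltW|exact: chartK].
Qed.

(** The factor 4 is 2 from the ramp times 2 from the square. The [m] summands are bounded using
    [|x_i - x0_i| <= rho] and [|x'| <= L * tnorm], then divided by [rho ^+ 2]. *)
Definition cutoff_lip : R := 4 * m%:R * L / rho.

Lemma cutoff_lip_ge0 : 0 <= cutoff_lip.
Proof. by apply: divr_ge0; rewrite ?mulr_ge0. Qed.

Lemma cutoff_curve gam t : C1_curve_at gam t ->
  C1_real (cutoff c x0 rho \o gam) t /\
  `|derive1 (cutoff c x0 rho \o gam) t| <= cutoff_lip * tnorm (velocity gam t).
Proof.
move=> gC; have gcont := C1_curve_continuous gC.
have [gtc|gtc] := pselect (dom c (gam t)); last first.
  have Kt : ~ (chart_inv c @` [set x | sqdist x0 x <= rho ^+ 2]) (gam t).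
    by move=> [x /sqdist_cball/tm[/chart_invP[xc _] _ _ _ _] xE]; rewrite xE in xc.
  have nK : \forall s \near t, cst 0 s = (cutoff c x0 rho \o gam) s.
    have nK : nbhs (gam t) (~` (chart_inv c @` [set x | sqdist x0 x <= rho ^+ 2])).
      by apply: open_nbhs_nbhs; split=> //; apply: closed_openC; exact: tame_cball_closed.
    have H : \forall s \near t, ~ (chart_inv c @` [set x | sqdist x0 x <= rho ^+ 2]) (gam s).
      exact: (gcont _ nK).
    by apply: filterS H => s /= sK; rewrite cutoff_outside.
  have bd : \forall s \near t, is_derive (s : R) 1 (cutoff c x0 rho \o gam) 0.
    apply: filterS (near_join nK) => s sK; apply: near_eq_is_derive sK _.
  split; first by apply: (C1_realP bd); exact: cst_continuous.
  rewrite (derive1_is_derive (nbhs_singleton bd)) normr0 mulr_ge0 ?cutoff_lip_ge0//.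
  exact: sqrtr_ge0.
have [gc xd xdc] := C1_curve_chart gC gtc; set x := chart c \o gam in xd xdc.
pose D s := 2 * Num.max 0 (1 - sqdist x0 (x s) / rho ^+ 2) *
  (- (\sum_i 2 * (x s ord0 i - x0 ord0 i) * derive1 x s ord0 i) / rho ^+ 2).
have bE : \forall s \near t, ramp (1 - sqdist x0 (x s) / rho ^+ 2) = (cutoff c x0 rho \o gam) s.
  by apply: filterS gc => s gs; rewrite /cutoff /= asboolT.
have bd : \forall s \near t, is_derive (s : R) 1 (cutoff c x0 rho \o gam) (D s).
  apply: filterS2 (near_join bE) xd => s sE sd; apply: near_eq_is_derive sE _.
  have sqd := is_derive_sqdist x0 sd.
  have ad : is_derive s 1 (fun r => 1 - sqdist x0 (x r) / rho ^+ 2)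
      (- (\sum_i 2 * (x s ord0 i - x0 ord0 i) * derive1 x s ord0 i) / rho ^+ 2).
    rewrite (_ : (fun _ => _) = cst 1 - (rho ^- 2 *: fun r => sqdist x0 (x r))); last first.
      by apply/funext => r; rewrite /= mulrC.
    by apply: is_derive_eq; rewrite /GRing.scale /=; ring.
  have rd := is_derive_ramp (1 - sqdist x0 (x s) / rho ^+ 2).
  have [rdd _] := rd; have [add _] := ad.
  have := @derive1_comp _ (fun r => 1 - sqdist x0 (x r) / rho ^+ 2) ramp s add rdd.
  rewrite (derive1_is_derive rd) (derive1_is_derive ad) => E.
  split; last by rewrite -derive1E.
  by apply/derivable1_diffP/differentiable_comp; apply/derivable1_diffP.
have xct : {for t, continuous x} := is_derive_continuous (nbhs_singleton xd).
have sqc : sqdist x0 (x s) @[s --> t] --> sqdist x0 (x t).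
  exact: (cvg_comp _ _ xct (@sqdist_continuous _ _ x0 (x t))).
have Dc : {for t, continuous D}.
  apply: cvgM.
    apply: cvgM; first exact: cvg_cst.
    apply: (continuous_comp (f := fun s => 1 - sqdist x0 (x s) / rho ^+ 2)
      (g := fun r => Num.max 0 r)).
      by apply: cvgB; [exact: cvg_cst|apply: cvgM => //; exact: cvg_cst].
    apply: continuous_max; [exact: cst_continuous|by move=> U].
  apply: cvgM; last exact: cvg_cst.
  apply: cvgN; apply: cvg_sumr => i; apply: cvgM; last first.
    exact: ((cvg_mxP _ _).1 xdc ord0 i).
  apply: cvgM; first exact: cvg_cst.
  apply: cvgB; last exact: cvg_cst.
  exact: ((cvg_mxP _ _).1 xct ord0 i).
split; first exact: C1_realP bd Dc.
rewrite (derive1_is_derive (nbhs_singleton bd)) /D.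
(* Where the ramp vanishes the point may lie in the chart but off the tame cube; there the
   derivative is 0 and no bound on the metric is called for. *)
have [s1|s1] := leP (1 - sqdist x0 (x t) / rho ^+ 2) 0.
  by rewrite ?max_l// mulr0 mul0r normr0 mulr_ge0 ?cutoff_lip_ge0// sqrtr_ge0.
have tr : cball x0 rho (x t).
  apply: sqdist_cball; move: s1; rewrite subr_gt0 ltr_pdivrMr ?exprn_gt0// mul1r.
  exact: ltW.
have [xc xL _ _ _] := tm tr.
have nx : `|derive1 x t| <= L * tnorm (velocity gam t).
  rewrite /tnorm (tnorm_velocity gc (nbhs_singleton xd)).
  have m0 := metric_ge0 (derive1 x t) xc.
  rewrite -ler_sqr ?nnegrE ?mulr_ge0 ?sqrtr_ge0// exprMn sqr_sqrtr//.
  apply: le_trans (xL _) _; rewrite expr2 -mulrA ler_peMl// mulr_ge0//.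
have sum_le : `|\sum_i 2 * (x t ord0 i - x0 ord0 i) * derive1 x t ord0 i| <=
    m%:R * (2 * rho * (L * tnorm (velocity gam t))).
  apply: sum_norm_le => i; rewrite !normrM ler_pM//.
    rewrite ler_pM//; first by rewrite ger0_norm.
    have := le_mx_norm (x t - x0) ord0 i; rewrite !mxE => H. by apply: le_trans H _.
  by apply: le_trans nx; exact: le_mx_norm.
rewrite normrM mulNr normrN [`|_ / rho ^+ 2|]normrM normfV.
rewrite [`|rho ^+ 2|]ger0_norm ?exprn_ge0//.
apply: (@le_trans _ _ (2 * (m%:R * (2 * rho * (L * tnorm (velocity gam t))) / rho ^+ 2))).
  rewrite ler_pM// ?mulr_ge0 ?invr_ge0 ?exprn_ge0//.
    rewrite normrM ger0_norm// ler_piMr// ger0_norm ?(ltW s1)//.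
    by rewrite gerBl divr_ge0 ?sqdist_ge0// exprn_ge0.
  by rewrite ler_wpM2r// invr_ge0 exprn_ge0.
rewrite /cutoff_lip le_eqVlt; apply/orP; left; apply/eqP; field.
exact: lt0r_neq0.
Qed.

Lemma cutoff_length p q l : piecewise_length p q l ->
  cutoff c x0 rho p - cutoff c x0 rho q <= cutoff_lip * l.
Proof.
elim=> [r|gam r k gC _ ih]; first by rewrite subrr mulr0.
have -> : cutoff c x0 rho (gam 0) - cutoff c x0 rho r =
  cutoff c x0 rho (gam 0) - cutoff c x0 rho (gam 1) + (cutoff c x0 rho (gam 1) - cutoff c x0 rho r).
  by rewrite addrA subrK.
rewrite mulrDr lerD//.
have bC (t : R) : 0 <= t <= 1 -> C1_real (cutoff c x0 rho \o gam) t.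
  by move=> /gC/cutoff_curve[].
have vc : continuous01 (fun t => tnorm (velocity gam t)).
  by move=> t /gC/continuous_tnorm_velocity.
have vc2 : continuous01 (fun t => - cutoff_lip * tnorm (velocity gam t)).
  move=> t /vc H; apply: cvgM => //; exact: cvg_cst.
rewrite -lerN2 opprB -[_ (gam 1)]/((cutoff c x0 rho \o gam) 1) -[_ (gam 0)]/((cutoff c x0 rho \o gam) 0).
rewrite -integral01_derive// -mulNr /curve_length -RintegralZl//; last first.
  exact: continuous01_integrable.
apply: le_integral01 => //; first exact: C1_real_continuous.
move=> t /gC/cutoff_curve[_]; rewrite ler_norml => /andP[H _].
by rewrite mulNr.
Qed.

Lemma cutoff_rdist p q : connected [set: M] ->
  cutoff c x0 rho p - cutoff c x0 rho q <= cutoff_lip * rdist p q.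
Proof.
(* The Lipschitz constant vanishes in dimension 0, where one cannot divide by it. *)
move=> Mc; have [m0|K0] := eqVneq cutoff_lip 0.
  rewrite m0 mul0r; have [l pl] := reachable p q Mc.
  by have := cutoff_length pl; rewrite m0 mul0r.
have Kp : 0 < cutoff_lip by rewrite lt_def K0 cutoff_lip_ge0.
rewrite mulrC -ler_pdivrMr//; apply: le_rdist => // l pl.
by rewrite ler_pdivrMr// mulrC; exact: cutoff_length.
Qed.

(** Constant speed and the mean value inequality suffice; [curve_length] refers to [0, 1] only,
    whereas here time runs up to [T]. *)
Lemma cutoff_geodesic gam (T : R) : 0 <= T ->
  (forall t, 0 <= t <= T -> geodesic_at gam t) -> forall t, 0 <= t <= T ->
  cutoff c x0 rho (gam 0) - cutoff c x0 rho (gam t) <=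
    cutoff_lip * (t * tnorm (velocity gam 0)).
Proof.
move=> T0 gG t /andP[t0 tT].
have bC (s : R) : 0 <= s <= t ->
    is_derive s 1 (cutoff c x0 rho \o gam) (derive1 (cutoff c x0 rho \o gam) s) /\
    `|derive1 (cutoff c x0 rho \o gam) s - 0| <= cutoff_lip * tnorm (velocity gam 0).
  move=> /andP[s0 st]; have sT : 0 <= s <= T by rewrite s0 (le_trans st).
  have [[/nbhs_singleton bd _] bK] := cutoff_curve (geodesic_C1_curve (gG s sT)).
  split; first exact: derivable_is_derive1.
  rewrite subr0; apply: le_trans bK _.
  by rewrite /tnorm (geodesic_const_speed T0 gG sT).
have := is_derive_segment_le t0 (fun s H => (bC s H).1) (fun s H => (bC s H).2).
rewrite mul0r !subr0 ler_norml => /andP[H _].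
by rewrite -lerN2 opprB; apply: le_trans H; rewrite mulrCA mulrC.
Qed.

End CutoffCurve.

(** * First variation of the energy *)

Section GeodesicChart.
Context {R : realType} {m : nat} (M : riemannianManifold R m).
Implicit Types (p q : M) (gam : R -> M) (u v w x : 'rV[R]_m).
Variables (c : atlas M) (x0 : 'rV[R]_m) (r L : R).
Hypotheses (L1 : 1 <= L) (tm : forall x, cball x0 r x -> tame c L x).

Let L0 : 0 <= L. Proof. exact: le_trans L1. Qed.

Lemma geodesic_chart gam t : geodesic_at gam t -> dom c (gam t) ->
  let x := chart c \o gam in
  \forall s \near t, [/\ cod c (x s), is_derive (s : R) 1 x (derive1 x s),
    is_derive (s : R) 1 (derive1 x) (derive1 (derive1 x) s) &
    forall w, metric c (x s) (derive1 (derive1 x) s) w =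
      2^-1 * (derive1 x s *m dgram c (x s) w *m (derive1 x s)^T) ord0 ord0
      - (derive1 x s *m dgram c (x s) (derive1 x s) *m w^T) ord0 ord0].
Proof.
move=> gG gtc x; apply: filterS (gG c gtc) => s [gs xd xd2 ode].
have xc : cod c (x s) := cod_chart gs.
split; [exact: xc|exact: (derivable_is_derive1 xd)|exact: (derivable_is_derive1 xd2)|].
by move=> w; exact: (geodesic_eq w xc ode).
Qed.

Lemma dpart_cvg (T : Type) (F : set_system T) (FF : Filter F) (f : 'rV[R]_m -> R)
    (x : T -> 'rV[R]_m) y w : C1_at f y -> x s @[s --> F] --> y ->
  dpart f (x s) w @[s --> F] --> dpart f y w.
Proof.
move=> fC xy; apply: cvg_sumr => i; apply: cvgM; first exact: cvg_cst.
exact: (cvg_comp _ _ xy (fC i).2).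
Qed.

Lemma dgram_cvg (T : Type) (F : set_system T) (FF : Filter F)
    (x : T -> 'rV[R]_m) y w : cod c y -> x s @[s --> F] --> y ->
  dgram c (x s) w @[s --> F] --> dgram c y w.
Proof.
move=> yc xy; apply/(@cvg_mxP _ _ _ FF) => i j; rewrite mxE.
under eq_fun do rewrite mxE; exact: dpart_cvg (gram_C1 i j yc) xy.
Qed.

(* Derivative of [s |-> s <x'(s), w>] along a geodesic, with [x''] eliminated by
   the geodesic equation; it is the first variation of half the energy in the
   direction [s |-> s w]. *)
Definition variation_rate (x dx : R -> 'rV[R]_m) w s : R :=
  metric c (x s) (dx s) w + s * (2^-1 * (dx s *m dgram c (x s) w *m (dx s)^T) ord0 ord0).

Lemma variation_C1 gam t w : geodesic_at gam t -> dom c (gam t) ->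
  let x := chart c \o gam in
  (\forall s \near t, is_derive (s : R) 1
    (fun s => s * metric c (x s) (derive1 x s) w) (variation_rate x (derive1 x) w s)) /\
  {for t, continuous (variation_rate x (derive1 x) w)}.
Proof.
move=> gG gtc x; have H := geodesic_chart gG gtc; split.
  apply: filterS H => s [xc xd xd2 /(_ w) E].
  have md := is_derive_metric xc xd xd2 (is_derive_cst w s 1).
  have -> : (fun s => s * metric c (x s) (derive1 x s) w) =
    id * (fun s => metric c (x s) (derive1 x s) w) by [].
  apply: is_derive_eq (is_deriveM (is_derive_id s 1) md) _.
  rewrite /GRing.scale /= /variation_rate E [metric _ _ _ 0]metricC// metric0l.
  by field.
have [xc xd xd2 _] := nbhs_singleton H.
have xt := is_derive_continuous xd; have dxt := is_derive_continuous xd2.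
apply: cvgD.
  by apply: cvg_metric => //; exact: cvg_cst.
apply: cvgM => //; apply: cvgM; first exact: cvg_cst.
have Gc := @dgram_cvg _ _ (nbhs_filter t) x (x t) w xc xt.
have := @cvg_mulmx _ _ _ (nbhs_filter t) _ _ _ _ _ _ _
  (@cvg_mulmx _ _ _ (nbhs_filter t) _ _ _ _ _ _ _ dxt Gc)
  (@cvg_trmx _ _ _ (nbhs_filter t) _ _ _ _ dxt).
by move=> /(@cvg_mxP _ _ _ (nbhs_filter t)) /(_ ord0 ord0).
Qed.

Lemma norm_le_metric x u s : cball x0 r x -> 0 <= s -> metric c x u u <= s ^+ 2 ->
  `|u| <= L * s.
Proof.
move=> xr s0 us; have [xc xL _ _ _] := tm xr.
rewrite -ler_sqr ?nnegrE ?mulr_ge0//; apply: le_trans (xL u) _.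
apply: (@le_trans _ _ (L * s ^+ 2)); first by rewrite ler_wpM2l.
by rewrite exprMn ler_wpM2r ?exprn_ge0// expr2 ler_peMl.
Qed.

Lemma dgram_bilin_le x u v w : cball x0 r x ->
  `|(u *m dgram c x w *m v^T) ord0 ord0| <= m%:R ^+ 3 * L * (`|u| * `|w| * `|v|).
Proof.
move=> xr; apply: le_trans (bilin_norm_le _ _ _) _.
have := dgram_norm_le w (tm xr); move: (`|dgram c x w|) => D Dw.
apply: (@le_trans _ _ (m%:R ^+ 2 * (`|u| * (m%:R * L * `|w|) * `|v|))).
  by rewrite ler_wpM2l ?exprn_ge0// ler_wpM2r// ler_wpM2l.
by rewrite le_eqVlt; apply/orP; left; apply/eqP; ring.
Qed.

Lemma metric_le x u v : cball x0 r x ->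
  `|metric c x u v| <= m%:R ^+ 2 * L * (`|u| * `|v|).
Proof.
move=> xr; apply: le_trans (bilin_norm_le _ _ _) _.
have [_ _ GL _ _] := tm xr; rewrite -[leRHS]mulrA ler_wpM2l ?exprn_ge0//.
by rewrite mulrAC mulrC ler_wpM2r ?mulr_ge0.
Qed.

Definition accel_bound : R := 2 * m%:R ^+ 3 * L ^+ 4.

(** Take [w = ddx] in the geodesic equation: coercivity bounds [|ddx|^2] by a multiple of
    [|dx|^2 * |ddx|], and one factor [|ddx|] is divided out. *)
Lemma accel_le x dx ddx s : cball x0 r x -> `|dx| <= L * s ->
  (forall w, metric c x ddx w = 2^-1 * (dx *m dgram c x w *m dx^T) ord0 ord0
      - (dx *m dgram c x dx *m w^T) ord0 ord0) ->
  `|ddx| <= accel_bound * s ^+ 2.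
Proof.
move=> xr dxs E; have [_ xL _ _ _] := tm xr.
have [d0|d0] := eqVneq `|ddx| 0.
  by rewrite d0 mulr_ge0 ?sqr_ge0// !mulr_ge0// exprn_ge0.
have dp : 0 < `|ddx| by rewrite lt_def d0 normr_ge0.
have A := dgram_bilin_le dx dx ddx xr; have B := dgram_bilin_le dx ddx dx xr.
have := xL ddx; rewrite (E ddx) => X.
have Y : `|ddx| ^+ 2 <= L * (2 * (m%:R ^+ 3 * L * (`|dx| * `|dx| * `|ddx|))).
  apply: le_trans X _; rewrite ler_wpM2l//.
  move: A B; rewrite [`|dx| * `|ddx| * `|dx|]mulrAC.
  rewrite !ler_norml => /andP[_ A] /andP[B _].
  have : 0 <= m%:R ^+ 3 * L * (`|dx| * `|dx| * `|ddx|) by rewrite !mulr_ge0// exprn_ge0.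
  lra.
have Z : `|ddx| <= 2 * m%:R ^+ 3 * L ^+ 2 * (`|dx| * `|dx|).
  rewrite -(ler_pM2r dp) -expr2; apply: le_trans Y _.
  by rewrite le_eqVlt; apply/orP; left; apply/eqP; ring.
apply: le_trans Z _; rewrite /accel_bound.
apply: (@le_trans _ _ (2 * m%:R ^+ 3 * L ^+ 2 * (L * s * (L * s)))).
  by rewrite ler_wpM2l ?mulr_ge0 ?exprn_ge0// ler_pM.
by rewrite le_eqVlt; apply/orP; left; apply/eqP; ring.
Qed.

(** The summands collect the terms quadratic in [w] of the energy: the metric on [w], the three
    products of the first derivative of the metric involving [w], and the Taylor remainder of the
    metric. *)
Definition variation_const : R :=
  m%:R ^+ 2 * L + 3 * m%:R ^+ 3 * L ^+ 2 + 4 * m%:R ^+ 4 * L ^+ 3.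

Lemma variation_const_ge0 : 0 <= variation_const.
Proof. by rewrite !addr_ge0 ?mulr_ge0 ?exprn_ge0. Qed.

(** Expand the Gram matrix to first order at [x] and the form bilinearly. The condition [|w| <= 1]
    turns the cubic terms into quadratic ones. *)
Lemma energy_variation_le x dx w s : cball x0 r x -> cball x0 r (x + s *: w) ->
  0 <= s <= 1 -> `|dx| <= L -> `|w| <= 1 ->
  metric c (x + s *: w) (dx + w) (dx + w) <=
    metric c x dx dx + 2 * (metric c x dx w +
      s * (2^-1 * (dx *m dgram c x w *m dx^T) ord0 ord0)) + variation_const * `|w| ^+ 2.
Proof.
move=> xr yr /andP[s0 s1] dxL w1; have [xc _ _ _ _] := tm xr.
pose E := gram c (x + s *: w) - gram c x - s *: dgram c x w.
have EG : gram c (x + s *: w) = gram c x + s *: dgram c x w + E.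
  by rewrite /E -[X in _ = _ + X]addrA -opprD subrKC.
have En : `|E| <= m%:R ^+ 2 * L * `|w| ^+ 2.
  have xw : x + s *: w - x = s *: w by rewrite addrC addKr.
  have := gram_taylor tm xr yr; rewrite xw.
  have -> : dgram c x (s *: w) = s *: dgram c x w.
    apply/matrixP => i j; rewrite !mxE /dpart mulr_sumr; apply: eq_bigr => l _.
    by rewrite mxE mulrA.
  move=> H; apply: le_trans H _; rewrite ler_wpM2l ?mulr_ge0 ?exprn_ge0//.
  by rewrite normrZ ger0_norm// exprMn ler_piMl ?exprn_ge0// exprn_ile1.
pose Q (A : 'M[R]_m) (u v : 'rV[R]_m) := (u *m A *m v^T) ord0 ord0.
have QD A B u v : Q (A + B) u v = Q A u v + Q B u v.
  by rewrite /Q mulmxDr mulmxDl mxE.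
have QZ a A u v : Q (a *: A) u v = a * Q A u v.
  by rewrite /Q -scalemxAr -scalemxAl mxE.
have QDl A u u' v : Q A (u + u') v = Q A u v + Q A u' v.
  by rewrite /Q !mulmxDl mxE.
have QDr A u v v' : Q A u (v + v') = Q A u v + Q A u v'.
  by rewrite /Q linearD mulmxDr mxE.
rewrite -/(Q _ _ _) /metric -!/(Q _ _ _) EG 2!QD QZ.
rewrite [Q (gram c x) _ _]QDl !(QDr (gram c x)) [Q (dgram c x w) _ _]QDl !(QDr (dgram c x w)).
have -> : Q (gram c x) w dx = Q (gram c x) dx w by exact: metricC.
have T1 : `|Q (gram c x) w w| <= m%:R ^+ 2 * L * `|w| ^+ 2.
  by rewrite expr2; exact: metric_le.
have T2 : `|Q (dgram c x w) dx w| <= m%:R ^+ 3 * L ^+ 2 * `|w| ^+ 2.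
  apply: le_trans (dgram_bilin_le _ _ _ xr) _.
  have -> : m%:R ^+ 3 * L ^+ 2 * `|w| ^+ 2 = m%:R ^+ 3 * L * (L * `|w| * `|w|) by ring.
  by rewrite ler_wpM2l ?mulr_ge0 ?exprn_ge0// !ler_wpM2r.
have T3 : `|Q (dgram c x w) w dx| <= m%:R ^+ 3 * L ^+ 2 * `|w| ^+ 2.
  apply: le_trans (dgram_bilin_le _ _ _ xr) _.
  have -> : m%:R ^+ 3 * L ^+ 2 * `|w| ^+ 2 = m%:R ^+ 3 * L * (`|w| * `|w| * L) by ring.
  by rewrite ler_wpM2l ?mulr_ge0 ?exprn_ge0// ler_wpM2l ?mulr_ge0.
have T4 : `|Q (dgram c x w) w w| <= m%:R ^+ 3 * L ^+ 2 * `|w| ^+ 2.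
  apply: le_trans (dgram_bilin_le _ _ _ xr) _.
  have -> : m%:R ^+ 3 * L ^+ 2 * `|w| ^+ 2 = m%:R ^+ 3 * L * (`|w| * `|w| * L) by ring.
  by rewrite ler_wpM2l ?mulr_ge0 ?exprn_ge0// ler_wpM2l ?mulr_ge0// (le_trans w1).
have T5 : `|Q E (dx + w) (dx + w)| <= 4 * m%:R ^+ 4 * L ^+ 3 * `|w| ^+ 2.
  have dw : `|dx + w| <= 2 * L.
    by apply: le_trans (ler_normD _ _) _; rewrite mulr2n mulrDl !mul1r lerD// (le_trans w1).
  apply: le_trans (bilin_norm_le _ _ _) _.
  apply: (@le_trans _ _ (m%:R ^+ 2 * (2 * L * (m%:R ^+ 2 * L * `|w| ^+ 2) * (2 * L)))).
    rewrite ler_wpM2l ?exprn_ge0// ler_pM ?mulr_ge0// ler_pM//.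
  by rewrite le_eqVlt; apply/orP; left; apply/eqP; ring.
have sT z K : `|z| <= K -> s * z <= K.
  move=> zK; apply: le_trans (ler_norm _) _; rewrite normrM ger0_norm//.
  by apply: le_trans zK; rewrite ler_piMl.
have := sT _ _ T2; have := sT _ _ T3; have := sT _ _ T4.
have := le_trans (ler_norm _) T1; have := le_trans (ler_norm _) T5.
rewrite /variation_const; lra.
Qed.

End GeodesicChart.

Section DeriveCombinations.
Context {R : realType}.

Lemma is_derive_affine_comb (f : R -> R) (s df a b d : R) : is_derive s 1 f df ->
  is_derive s 1 (fun u => a * (b * u + d * f u)) (a * (b + d * df)).
Proof.
move=> fd; have := is_deriveZ a (is_deriveD (is_deriveZ b (is_derive_id s 1)) (is_deriveZ d fd)).
by rewrite /GRing.scale /= mulr1.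
Qed.

Lemma is_derive_add_scale (V : normedModType R) (x : R -> V) (dx w : V) (s : R) :
  is_derive s 1 x dx -> is_derive s 1 (fun u => x u + u *: w) (dx + w).
Proof.
move=> xd; have wd : is_derive s 1 (fun u : R => u *: w) w.
  by have := is_derive_affine 0 w s; under eq_fun do rewrite add0r.
exact: is_deriveD xd wd.
Qed.

End DeriveCombinations.

Section FirstVariation.
Context {R : realType} {m : nat} (M : riemannianManifold R m).
Implicit Types (p q : M) (gam : R -> M) (u v w x : 'rV[R]_m).
Variables (c : atlas M) (x0 : 'rV[R]_m) (r L : R).
Hypotheses (L1 : 1 <= L) (tm : forall x, cball x0 r x -> tame c L x).

Let L0 : 0 <= L. Proof. exact: le_trans L1. Qed.

Definition geodesic_in (r' T : R) gam : Prop := forall t : R, 0 <= t <= T ->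
  [/\ geodesic_at gam t, dom c (gam t) & cball x0 r' (chart c (gam t))].

Lemma accel_bound_ge0 : 0 <= accel_bound (m := m) L.
Proof. by rewrite !mulr_ge0 ?exprn_ge0. Qed.

Lemma geodesic_in_derive T gam : 0 <= T -> geodesic_in r T gam ->
  forall t : R, 0 <= t <= T ->
  let x := chart c \o gam in
  [/\ is_derive t 1 x (derive1 x t),
      is_derive t 1 (derive1 x) (derive1 (derive1 x) t),
      metric c (x t) (derive1 x t) (derive1 x t) = tnorm (velocity gam 0) ^+ 2,
      `|derive1 x t| <= L * tnorm (velocity gam 0) &
      `|derive1 (derive1 x) t| <= accel_bound (m := m) L * tnorm (velocity gam 0) ^+ 2].
Proof.
move=> T0 gG t tT x; have [gt gtc gr] := gG t tT.
have [xc xd xd2 E] := nbhs_singleton (geodesic_chart gt gtc).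
have s0 : 0 <= tnorm (velocity gam 0) by exact: sqrtr_ge0.
have sE : metric c (x t) (derive1 x t) (derive1 x t) = tnorm (velocity gam 0) ^+ 2.
  have gG' s : 0 <= s <= T -> geodesic_at gam s by move=> /gG[].
  have [gc _ _] := C1_curve_chart (geodesic_C1_curve gt) gtc.
  rewrite -(tnorm_velocity gc xd) (geodesic_const_speed T0 gG' tT).
  rewrite /tnorm sqr_sqrtr// (inner_tocoord _ _ (dom_chart_at _)).
  by apply: metric_ge0; apply: cod_chart; exact: dom_chart_at.
have dxL : `|derive1 x t| <= L * tnorm (velocity gam 0).
  by apply: (norm_le_metric L1 tm gr) => //; rewrite sE.
split=> //; exact: (accel_le L1 tm gr dxL E).
Qed.

Lemma geodesic_in_taylor T gam : 0 <= T -> geodesic_in r T gam ->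
  forall t : R, 0 <= t <= T ->
  let x := chart c \o gam in
  [/\ `|x t - x 0| <= L * tnorm (velocity gam 0) * t,
      `|derive1 x t - derive1 x 0| <=
        accel_bound (m := m) L * tnorm (velocity gam 0) ^+ 2 * t &
      `|x t - x 0 - t *: derive1 x 0| <=
        accel_bound (m := m) L * tnorm (velocity gam 0) ^+ 2 * t ^+ 2].
Proof.
move=> T0 gG t /andP[t0 tT] x; have s0 : 0 <= tnorm (velocity gam 0) by exact: sqrtr_ge0.
have K0 : 0 <= accel_bound (m := m) L * tnorm (velocity gam 0) ^+ 2.
  by rewrite mulr_ge0 ?exprn_ge0 ?accel_bound_ge0.
have tT' s : 0 <= s <= t -> 0 <= s <= T by move=> /andP[-> st]; exact: le_trans tT.
have H s (st : 0 <= s <= t) := geodesic_in_derive T0 gG (tT' s st).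
split.
- have := @is_derive_rV_le _ _ x (derive1 x) 0 t 0 (L * tnorm (velocity gam 0)) t0.
  rewrite scaler0 !subr0; apply; first by rewrite mulr_ge0.
    by move=> s /H[].
  by move=> s /H[_ _ _ + _]; rewrite subr0.
- have := @is_derive_rV_le _ _ (derive1 x) (derive1 (derive1 x)) 0 t 0 _ t0 K0.
  rewrite scaler0 !subr0; apply; first by move=> s /H[].
  by move=> s /H[_ _ _ _ +]; rewrite subr0.
- have := @is_derive2_rV_le _ _ x (derive1 x) (derive1 (derive1 x)) 0 t _ t0 K0.
  by rewrite !subr0; apply => s /H[].
Qed.

(* Used with [sqrt S <= (S + l^2) / (2 l)], which replaces the comparison of
   length and energy by the Cauchy-Schwarz inequality for integrals. *)
Lemma sqr_le_of_energy (rho A : R) : 0 <= rho ->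
  (forall l, 0 < l -> 2 * l * rho <= A + l ^+ 2) -> rho ^+ 2 <= A.
Proof.
move=> r0 H; have [r1|r1] := eqVneq rho 0; last first.
  have rp : 0 < rho by rewrite lt_def r1.
  by have := H rho rp; rewrite -mulrA -expr2; lra.
rewrite r1 expr0n; apply/ler_addgt0Pr => e e0.
have := H (Num.sqrt e); rewrite sqrtr_gt0 => /(_ e0).
by rewrite r1 mulr0 sqr_sqrtr// ltW.
Qed.

(** The speed of the deformed curve is at most [(S + l ^+ 2) / (2 * l)], with [S] its energy
    density. By [energy_variation_le] this is at most the derivative of [H], whose increment over
    [0, 1] retains only the boundary term at time 1. *)
Lemma rdist_variation gam w : connected [set: M] -> geodesic_in r 1 gam ->
  tnorm (velocity gam 0) <= 1 -> `|w| <= 1 ->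
  let x := chart c \o gam in
  (forall s : R, 0 <= s <= 1 -> cball x0 r (x s + s *: w)) ->
  rdist (gam 0) (chart_inv c (x 1 + w)) ^+ 2 <= tnorm (velocity gam 0) ^+ 2 +
    2 * metric c (x 1) (derive1 x 1) w + variation_const (m := m) L * `|w| ^+ 2.
Proof.
move=> Mc gG d1 w1 x yr; apply: sqr_le_of_energy; first exact: rdist_ge0.
move=> l l0; set d := tnorm _; set C := variation_const (m := m) L * _.
have d0 : 0 <= d by exact: sqrtr_ge0.
pose B := d ^+ 2 + C + l ^+ 2.
pose h := (fun s => s * metric c (x s) (derive1 x s) w).
pose H (s : R) : R := (2 * l)^-1 * (B * s + 2 * h s).
pose dH s := (2 * l)^-1 * (B + 2 * variation_rate c x (derive1 x) w s).
have l2 : 0 < 2 * l by rewrite mulr_gt0.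
have Hd (t : R) : 0 <= t <= 1 ->
    (\forall s \near t, is_derive (s : R) 1 H (dH s)) /\ {for t, continuous dH}.
  move=> t01; have [gt gtc _] := gG t t01; have [hd hc] := variation_C1 w gt gtc.
  split.
    apply: filterS hd => s hsd.
    exact: is_derive_affine_comb.
  apply: cvgM; first exact: cvg_cst.
  apply: cvgD; first exact: cvg_cst.
  by apply: cvgM => //; exact: cvg_cst.
have x0g : chart_inv c (x 0) = gam 0.
  by have [|_ gc _] := gG 0 _; [rewrite lexx ler01|exact: chartK].
have := @rdist_le_curve _ _ M c (fun s => x s + s *: w) (fun s => derive1 x s + w) H.
rewrite scale0r addr0 scale1r x0g => /(_ _ _ _ _ _)[].
- by move=> t /yr/tm[].
- move=> t t01; have [gt gtc _] := gG t t01.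
  apply: filterS (geodesic_chart gt gtc) => s [_ xd _ _].
  exact: is_derive_add_scale.
- move=> t t01; have [_ xd2 _ _ _] := geodesic_in_derive ler01 gG t01.
  by apply: cvgD; [exact: is_derive_continuous xd2|exact: cvg_cst].
- by move=> t t01; have [hd hc] := Hd t t01; exact: C1_realP hd hc.
- move=> t t01; have [hd _] := Hd t t01; rewrite (derive1_is_derive (nbhs_singleton hd)).
  have [xd _ sE dxL _] := geodesic_in_derive ler01 gG t01.
  have [_ _ xr] := gG t t01.
  have dxL' : `|derive1 x t| <= L by apply: le_trans dxL _; rewrite ler_piMr.
  have := energy_variation_le L1 tm xr (yr t t01) t01 dxL' w1.
  rewrite sE -/d -/C => En.
  have [yc _ _ _ _] := tm (yr t t01).
  have S0 := metric_ge0 (derive1 x t + w) yc.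
  rewrite /dH ler_pdivlMl//; move: En S0; rewrite /B /variation_rate.
  rewrite -/(x t); move: (metric _ _ (_ + w) _) => S En S0.
  have := sqr_ge0 (Num.sqrt S - l); rewrite sqrrB sqr_sqrtr// => Q.
  nra.
move=> k /rdist_le kl kH; have {}kH := le_trans kl kH.
rewrite -ler_pdivlMl// in kH *; apply: le_trans kH _.
rewrite /H /h mul1r mul0r !mulr0 addr0 mulr0 subr0 mulr1 ler_pM2l ?invr_gt0//.
by rewrite /B; lra.
Qed.

(** The first summand comes from the second-order error between [w] and [T] times the initial
    velocity, the second from [|w| <= L * (T * tnorm)] in the quadratic remainder. *)
Definition fejer_const : R :=
  2 * m%:R ^+ 2 * L ^+ 2 * accel_bound (m := m) L + variation_const (m := m) L * L ^+ 2.

(** The radius is shared: [gam] uses one half and the increment [w] the other, so the deformed curve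
    remains where the metric is tame. *)
Lemma rdist_geodesic_step gam gam2 (T : R) : connected [set: M] -> 0 <= T ->
  geodesic_in (r / 2) 1 gam -> geodesic_in r T gam2 ->
  tnorm (velocity gam 0) <= 1 -> L * (T * tnorm (velocity gam2 0)) <= 1 ->
  L * (T * tnorm (velocity gam2 0)) <= r / 2 -> gam 1 = gam2 0 ->
  metric c (chart c (gam 1)) (derive1 (chart c \o gam) 1) (derive1 (chart c \o gam2) 0) <= 0 ->
  rdist (gam 0) (gam2 T) ^+ 2 <= tnorm (velocity gam 0) ^+ 2
    + fejer_const * (T * tnorm (velocity gam2 0)) ^+ 2.
Proof.
move=> Mc T0 gG gG2 d1 w1 wr g12 mle; set sg := tnorm (velocity gam2 0) in w1 wr *.
pose x := chart c \o gam; pose x2 := chart c \o gam2; pose w := x2 T - x2 0.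
have s0 : 0 <= sg by exact: sqrtr_ge0.
have r0 : 0 <= r / 2 by apply: le_trans wr; rewrite !mulr_ge0.
have gG' : geodesic_in r 1 gam.
  move=> t /gG[gt gtc gr]; split=> //; apply: le_trans gr _.
  by rewrite ler_piMr// ?invf_le1 ?ler1n//; lra.
have TT : 0 <= T <= T by rewrite T0 lexx.
have [wL _ wT] := geodesic_in_taylor T0 gG2 TT.
have w_le : `|w| <= L * (T * sg) by rewrite mulrA mulrAC.
have E : x 1 + w = x2 T by rewrite /w /x /= g12 subrKC.
have yr s : 0 <= s <= 1 -> cball x0 r (x s + s *: w).
  move=> s01; have [_ _ xr] := gG s s01; rewrite /cball /= addrAC.
  apply: le_trans (ler_normD _ _) _; rewrite [leRHS]splitr lerD// normrZ.
  have /andP[s_0 s_1] := s01; rewrite ger0_norm//.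
  by apply: le_trans (le_trans w_le wr); rewrite ler_piMl.
have -> : gam2 T = chart_inv c (x 1 + w).
  by rewrite E; have [_ gc _] := gG2 T TT; rewrite /x2 /= chartK.
apply: le_trans (rdist_variation Mc gG' d1 (le_trans w_le w1) yr) _.
rewrite -addrA lerD2l -/x.
have c01 : 0 <= (1 : R) <= (1 : R) by rewrite ler01 lexx.
have [_ _ _ dxL _] := geodesic_in_derive ler01 gG' c01.
have [_ _ xr] := gG' 1 c01.
have C0 : 0 <= variation_const (m := m) L by exact: variation_const_ge0.
(* The linear part of [w] contributes a nonpositive term by the angle hypothesis; [e] is quadratic
   in the step by the acceleration bound. *)
pose e := w - T *: derive1 x2 0.
have wE : metric c (x 1) (derive1 x 1) w =
    T * metric c (x 1) (derive1 x 1) (derive1 x2 0) + metric c (x 1) (derive1 x 1) e.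
  by rewrite -metricZr -metricDr subrKC.
have me : metric c (x 1) (derive1 x 1) e <=
    m%:R ^+ 2 * L ^+ 2 * accel_bound (m := m) L * (T * sg) ^+ 2.
  apply: le_trans (ler_norm _) _; apply: le_trans (metric_le tm _ _ xr) _.
  apply: (@le_trans _ _ (m%:R ^+ 2 * L * (L * (accel_bound (m := m) L * sg ^+ 2 * T ^+ 2)))).
    rewrite ler_wpM2l ?mulr_ge0 ?exprn_ge0// ler_pM//.
    by apply: le_trans dxL _; rewrite ler_piMr.
  by rewrite le_eqVlt; apply/orP; left; apply/eqP; ring.
have wsq : variation_const (m := m) L * `|w| ^+ 2 <=
    variation_const (m := m) L * L ^+ 2 * (T * sg) ^+ 2.
  rewrite -mulrA -exprMn ler_wpM2l// lerXn2r ?nnegrE//.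
  by rewrite !mulr_ge0.
have : T * metric c (x 1) (derive1 x 1) (derive1 x2 0) <= 0 by rewrite mulr_ge0_le0.
move=> TM; rewrite wE /fejer_const [leRHS]mulrDl; apply: lerD; last exact: wsq.
rewrite -!(mulrA 2) ler_pM2l// !mulrA in me *.
by apply: le_trans me; rewrite gerDr.
Qed.

End FirstVariation.

(** * The local quasi-Fejer inequality *)

Section LocalFejer.
Context {R : realType} {m : nat} (M : riemannianManifold R m).
Implicit Types (p q : M) (gam : R -> M) (u v w x : 'rV[R]_m).

Lemma geodesic_segment_length gam : geodesic_segment gam ->
  curve_length gam = tnorm (velocity gam 0).
Proof.
move=> gG; rewrite /curve_length; set d := tnorm (velocity gam 0).
rewrite (@eq_Rintegral _ _ _ _ _ (cst d)); last first.
  move=> t; rewrite inE /= in_itv /= => t01.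
  by rewrite /d /tnorm (geodesic_const_speed ler01 gG t01).
by rewrite Rintegral_cst//= lebesgue_measure_itv/= lte_fin ltr01/= oppr0 addr0 mulr1.
Qed.

Lemma derive_ge0_at_right_max (f : R -> R) (D : R) : is_derive (1 : R) (1 : R) f D ->
  (forall t : R, 0 <= t <= 1 -> f t <= f 1) -> 0 <= D.
Proof.
case=> fd <- fle; rewrite leNgt; apply/negP => D0.
have /cvgrPdist_lt /(_ (- 'D_1 f 1)) : h^-1 *: (f (h *: 1 + 1) - f 1) @[h --> 0^'] --> 'D_1 f 1.
  exact: fd.
rewrite oppr_gt0 => /(_ D0) [e /= e0 H].
(* The minimum with 1 keeps [h + 1] in [0, 1]. The difference quotient is then nonnegative, yet
   close to a negative derivative. *)
pose h : R := - Num.min (e / 2) 1.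
have m0 : 0 < Num.min (e / 2) 1 by rewrite lt_min ltr01 divr_gt0.
have m1 : Num.min (e / 2) 1 <= 1 by rewrite ge_min lexx orbT.
have h0 : h < 0 by rewrite oppr_lt0.
have /H : ball_ (fun z : R => `|z|) 0 e h.
  rewrite /ball_ /= sub0r normrN normrN gtr0_norm//.
  by rewrite gt_min ltr_pdivrMr// ltr_pMr// ltr1n.
move=> /(_ (ltr0_neq0 h0)).
rewrite [h *: 1]mulr1; have : f (h + 1) <= f 1.
  by apply: fle; rewrite /h addrC subr_ge0 gerBl m1 ltW.
rewrite -subr_le0 => fh; have q0 : 0 <= h^-1 *: (f (h + 1) - f 1).
  by apply: mulr_le0 => //; rewrite invr_le0 ltW.
rewrite ltr_norml => /andP[]; rewrite opprK; lra.
Qed.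

Lemma innerC p (u v : tangent p) : inner u v = inner v u.
Proof. have pc := dom_chart_at p.
rewrite !(inner_tocoord _ _ pc) -!/(metric _ _ _ _); apply: metricC.
exact: cod_chart. Qed.

Section Components.
Context {n : nat} (F : M -> 'rV[R]_n.+1) (F_C1 : C1_map F).

Lemma inner_s_compatible p (u v : tangent p) : s_compatible F v ->
  exists a : 'I_n.+1 -> R, (forall i, 0 <= a i) /\ \sum_i a i = 1 /\
    inner u v = - \sum_i a i * inner (grad (component F i) p) u.
Proof.
move=> [a [a01 asum vE]]; exists a; split; first by move=> i; case/andP: (a01 i).
split=> //; rewrite innerC vE /inner mulNmx mulNmx mxE; congr (- _).
by rewrite !mulmx_suml summxE; apply: eq_bigr => i _; rewrite -!scalemxAl mxE.
Qed.

Lemma component_chart_C1 c i x : cod c x -> C1_at (component F i \o chart_inv c) x.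
Proof. by move=> xc; apply: Ck_on_C1_at (F_C1 i c) => //; exact: cod_open. Qed.

Lemma is_derive_component c gam t dx i : (\forall s \near t, dom c (gam s)) ->
  is_derive t 1 (chart c \o gam) dx ->
  is_derive t 1 (component F i \o gam)
    (dpart (component F i \o chart_inv c) (chart c (gam t)) dx).
Proof.
move=> gc xd; have fC := component_chart_C1 i (cod_chart (nbhs_singleton gc)).
have H := is_derive_C1_comp fC xd; apply: near_eq_is_derive H.
by apply: filterS gc => s gs /=; rewrite chartK.
Qed.

(** Pairing the velocity with [v] gives minus a convex combination of the derivatives of the
    components at time 1, each nonnegative at a maximum reached at the right end. *)
Lemma s_compatible_metric_le0 c gam gam2 (v : tangent (gam 1)) :
  C1_curve_at gam 1 -> dom c (gam 1) -> s_compatible F v ->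
  (forall (t : R) i, 0 <= t <= 1 -> F (gam t) ord0 i <= F (gam 1) ord0 i) ->
  metric c (chart c (gam 1)) (derive1 (chart c \o gam) 1) (tocoord c v) <= 0.
Proof.
move=> gC g1c vs Fle; have [gc /nbhs_singleton xd _] := C1_curve_chart gC g1c.
have [u uE] := tocoord_surj (derive1 (chart c \o gam) 1) g1c.
rewrite -uE -/(metric _ _ _ _) /metric -(inner_tocoord _ _ g1c).
have [a [a0 [_ ->]]] := inner_s_compatible u vs.
rewrite oppr_le0; apply: sumr_ge0 => i _; apply: mulr_ge0 => //.
rewrite (inner_grad u (F_C1 i) g1c) uE.
apply: derive_ge0_at_right_max (is_derive_component i gc xd) _ => t t01.
exact: Fle.
Qed.

End Components.
End LocalFejer.

Section LocalStep.
Context {R : realType} {m n : nat} (M : riemannianManifold R m).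
Implicit Types (p q : M) (gam : R -> M) (u v w x : 'rV[R]_m).
Variables (F : M -> 'rV[R]_n.+1) (c : atlas M) (x0 : 'rV[R]_m) (rho L eta : R).
Hypotheses (Mc : connected [set: M]) (F_C1 : C1_map F) (rho0 : 0 < rho) (L1 : 1 <= L).
Hypothesis tm2 : forall x, cball x0 (2 * rho) x -> tame c L x.
Let K := cutoff_lip (m := m) rho L.
(** [eta_sq] makes the cut-off at least 3/4 on the [eta] cube, [eta_K] lets a minimal geodesic
    between two of its points lower it by at most 1/2, and [eta_1] bounds the length of that
    geodesic by 1. The metric is controlled up to [2 * rho] because the deformed curve may leave the
    [rho] cube. *)
Hypotheses (eta0 : 0 < eta) (eta_rho : eta <= rho)
  (eta_sq : 8 * m%:R * eta ^+ 2 <= rho ^+ 2)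
  (eta_K : K * (m%:R * L * (2 * eta)) <= 2^-1)
  (eta_1 : m%:R * L * (2 * eta) <= 1).

Definition coord_near p : Prop := dom c p /\ cball x0 eta (chart c p).

Let L0 : 0 <= L. Proof. exact: le_trans L1. Qed.

Let rho_ge0 : 0 <= rho. Proof. exact: ltW. Qed.

Let tm x : cball x0 rho x -> tame c L x.
Proof. by move=> xr; apply: tm2; apply: le_trans xr _; rewrite ler_peMl// ler1n. Qed.

Let eta_cball x : cball x0 eta x -> cball x0 rho x.
Proof. by move=> xe; exact: le_trans xe eta_rho. Qed.

Lemma cutoff_coord_near p : coord_near p -> 3 / 4 <= cutoff c x0 rho p.
Proof.
move=> [pc pe]; apply: le_trans (cutoff_ge x0 rho0 pc).
have sq : sqdist x0 (chart c p) <= m%:R * eta ^+ 2.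
  apply: le_trans (ler_norm _) _; apply: sum_norm_le => i.
  rewrite normrX lerXn2r ?nnegrE ?(ltW eta0)//.
  by have := le_mx_norm (chart c p - x0) ord0 i; rewrite !mxE => H; apply: le_trans H _.
have : sqdist x0 (chart c p) / rho ^+ 2 <= 8^-1.
  rewrite ler_pdivrMr ?exprn_gt0//; apply: le_trans sq _.
  by rewrite ler_pdivlMl// mulrA.
lra.
Qed.

(** The cut-off starts at 3/4 or more and loses at most 1/2, so it stays positive, which forces the
    point into the chart and the cube. *)
Lemma geodesic_stays gam (T : R) : 0 <= T -> coord_near (gam 0) ->
  (forall t, 0 <= t <= T -> geodesic_at gam t) ->
  K * (T * tnorm (velocity gam 0)) <= 2^-1 -> geodesic_in c x0 rho T gam.
Proof.
move=> T0 g0 gG KT t tT; have := cutoff_geodesic rho0 L1 tm T0 gG tT.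
have := cutoff_coord_near g0; have /andP[t0 tT'] := tT.
have : K * (t * tnorm (velocity gam 0)) <= K * (T * tnorm (velocity gam 0)).
  by rewrite ler_wpM2l ?cutoff_lip_ge0// ler_wpM2r// sqrtr_ge0.
rewrite -/K => H1 H2 H3.
have b0 : 0 < cutoff c x0 rho (gam t) by lra.
have [gc sq] := cutoff_gt0 rho0 b0; split => //; first exact: gG.
apply: (sqdist_cball rho0); apply: le_trans sq _.
by rewrite ler_piMr ?exprn_ge0//; lra.
Qed.

Lemma rdist_coord_le p q : coord_near p -> coord_near q ->
  rdist p q <= m%:R * L * `|chart c q - chart c p|.
Proof.
move=> [pc pe] [qc qe]; rewrite -{1}(chartK pc) -{1}(chartK qc).
by apply: (rdist_le_line L1 tm); exact: eta_cball.
Qed.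

Lemma rdist_coord_near p q : coord_near p -> coord_near q ->
  rdist p q <= m%:R * L * (2 * eta).
Proof.
move=> pn qn; apply: le_trans (rdist_coord_le pn qn) _.
rewrite ler_wpM2l ?mulr_ge0//.
have -> : chart c q - chart c p = (chart c q - x0) - (chart c p - x0).
  by rewrite opprB addrA subrK.
apply: le_trans (ler_normB _ _) _; have [_ pe] := pn; have [_ qe] := qn.
rewrite /cball /= in pe qe; lra.
Qed.

Lemma minimal_geodesic_in gam : coord_near (gam 0) -> coord_near (gam 1) ->
  geodesic_segment gam -> curve_length gam = rdist (gam 0) (gam 1) ->
  geodesic_in c x0 rho 1 gam /\ tnorm (velocity gam 0) = rdist (gam 0) (gam 1).
Proof.
move=> g0 g1 gG; rewrite geodesic_segment_length// => gL; split=> //.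
apply: geodesic_stays => //; rewrite mul1r gL; apply: le_trans eta_K.
by rewrite ler_wpM2l ?cutoff_lip_ge0//; exact: rdist_coord_near.
Qed.

Lemma coord_le_rdist gam : coord_near (gam 0) -> coord_near (gam 1) ->
  geodesic_segment gam -> curve_length gam = rdist (gam 0) (gam 1) ->
  `|chart c (gam 1) - chart c (gam 0)| <= L * rdist (gam 0) (gam 1).
Proof.
move=> g0 g1 gG gL; have [gin <-] := minimal_geodesic_in g0 g1 gG gL.
have c01 : 0 <= (1 : R) <= (1 : R) by rewrite ler01 lexx.
by have [+ _ _] := geodesic_in_taylor L1 tm ler01 gin c01; rewrite mulr1.
Qed.

Variables (rq : R) (pbar : M).
Hypotheses (wc : weakly_convex (rball pbar rq)) (qc : quasi_convex_on F (rball pbar rq)).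
Hypothesis near_rball : forall p, coord_near p -> rball pbar rq p.

(** Weak convexity provides a minimal geodesic; it stays in the chart, where its coordinate speed is
    at most [L] times its length. *)
Lemma norm_coord_le_rdist p q : coord_near p -> coord_near q ->
  `|chart c q - chart c p| <= L * rdist p q.
Proof.
move=> pn qn; have [gam [gG g0 g1 gL _]] := wc (near_rball pn) (near_rball qn).
by rewrite -g0 -g1; apply: coord_le_rdist; rewrite ?g0 ?g1.
Qed.

Lemma fejer_step p q (v : tangent p) gam (T : R) : coord_near p -> coord_near q ->
  s_compatible F v -> complete_geodesic_from v gam -> vle (F q) (F p) -> 0 <= T ->
  K * (T * tnorm v) <= 2^-1 -> L * (T * tnorm v) <= 1 -> L * (T * tnorm v) <= rho ->
  rdist q (gam T) ^+ 2 <= rdist q p ^+ 2 + fejer_const (m := m) L * (T * tnorm v) ^+ 2.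
Proof.
move=> pn qn vs [gG g0 gv] qp T0 KT LT1 LTr.
have [g [gsG gq gp gL gQ]] := wc (near_rball qn) (near_rball pn).
have Fle (t : R) i : 0 <= t <= 1 -> F (g t) ord0 i <= F (g 1) ord0 i.
  move=> t01; have := qc (near_rball qn) (near_rball pn) gsG gq gp gQ t01 i.
  by rewrite mxE gp max_r// qp.
(* The type of [v] depends on [p]: it is generalised so that [p] can be replaced by [gam 0], and is
   then identified with the velocity there. *)
move: v vs gv KT LT1 LTr pn qp gp gL gQ.
rewrite -g0 -gq in qn * => v vs gv KT LT1 LTr pn qp gp gL gQ.
rewrite -gv in vs KT LT1 LTr *; rewrite -gp in gL.
have g1n : coord_near (g 1) by rewrite gp.
have [gin gE] := minimal_geodesic_in qn g1n gsG gL.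
have T0in : geodesic_in c x0 rho T gam by exact: geodesic_stays.
have r2 : 2 * rho / 2 = rho by rewrite mulrAC divff// mul1r.
have g2in : geodesic_in c x0 (2 * rho) T gam.
  move=> t /T0in[? ? tr]; split=> //; apply: le_trans tr _.
  by rewrite ler_peMl// ler1n.
have -> : rdist (g 0) (gam 0) = tnorm (velocity g 0) by rewrite gE gp.
apply: (@rdist_geodesic_step _ _ _ c x0 (2 * rho)) => //.
- by rewrite r2.
- by rewrite gE; apply: le_trans (rdist_coord_near qn g1n) _.
- by rewrite r2.
have [g1c _] := g1n; have [pc _] := pn.
have c01 : 0 <= (1 : R) <= (1 : R) by rewrite ler01 lexx.
have c0T : 0 <= (0 : R) <= T by rewrite lexx.
have [xd _ _ _ _] := geodesic_in_derive L1 tm T0 T0in c0T.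
have [gc _ _] := C1_curve_chart (geodesic_C1_curve (gG 0)) pc.
rewrite -(velocity_tocoord gc xd).
move: (velocity gam 0) vs; rewrite -gp => v' vs.
apply: s_compatible_metric_le0 vs Fle => //.
by apply: geodesic_C1_curve; exact: gsG.
Qed.

End LocalStep.

(** * The descent algorithm *)

Section Descent.
Context {R : realType} {m n : nat} (M : riemannianManifold R m).
Variables (F : M -> 'rV[R]_n.+1).
Implicit Types (p q : M) (gam : R -> M).

Lemma inner_metric p (u v : tangent p) :
  inner u v = metric (chart_at p) (coords_at p) u v.
Proof. by []. Qed.

Let cod_coords p : cod (chart_at p) (coords_at p).
Proof. exact/cod_chart/dom_chart_at. Qed.

Lemma inner_ge0 p (v : tangent p) : 0 <= inner v v.
Proof. by rewrite inner_metric; apply: metric_ge0. Qed.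

Lemma tnorm_sqr p (v : tangent p) : tnorm v ^+ 2 = inner v v.
Proof. by rewrite /tnorm sqr_sqrtr// inner_ge0. Qed.

Lemma inner_le_alpha p (v : tangent p) i :
  inner (grad (component F i) p) v <= alpha F v - 2^-1 * tnorm v ^+ 2.
Proof.
rewrite /alpha addrK.
exact: (le_bigmax _ (fun i => inner (grad (component F i) p) v) i). Qed.

Lemma alpha_le p (v : tangent p) a :
  (forall i, inner (grad (component F i) p) v <= a) ->
  alpha F v <= a + 2^-1 * tnorm v ^+ 2.
Proof. by move=> va; rewrite /alpha lerD2r; apply: bigmax_le. Qed.

Lemma alpha_star_le p (v : tangent p) : alpha_star F p <= alpha F v.
Proof.
(* A lower bound is needed, since [inf] of an unbounded set is [0]. *)
apply: ge_inf; last by exists v.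
pose g := grad (component F ord0) p.
exists (- 2^-1 * inner g g) => _ [w _ <-].
have := inner_le_alpha w ord0; rewrite -/g tnorm_sqr.
have := @inner_ge0 p (g + w : 'rV[R]_m).
rewrite !inner_metric metricDl !metricDr [metric _ _ w g]metricC//; lra.
Qed.

Lemma alpha0 p : alpha F (0 : tangent p) = 0.
Proof.
have z i : inner (grad (component F i) p) (0 : tangent p) = 0.
  by rewrite inner_metric metricC//; exact: metric0l.
have z0 : inner (0 : tangent p) (0 : tangent p) = 0 by exact: metric0l.
rewrite /alpha tnorm_sqr z0 mulr0 addr0 z.
by apply: (big_ind (fun a => a = 0)) => // a b -> ->; rewrite maxxx.
Qed.

Lemma alpha_star_le0 p : alpha_star F p <= 0.
Proof. by rewrite -(alpha0 p); exact: alpha_star_le. Qed.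

Lemma D_sigma_inner_le sigma p (v : tangent p) i : D_sigma F sigma v ->
  inner (grad (component F i) p) v <= (1 - sigma) * alpha_star F p - 2^-1 * tnorm v ^+ 2.
Proof. by move=> vD; apply: le_trans (inner_le_alpha v i) _; rewrite lerD2r. Qed.

Lemma D_sigma_inner_le_tnorm sigma p (v : tangent p) i : 0 < sigma < 1 ->
  D_sigma F sigma v -> inner (grad (component F i) p) v <= - 2^-1 * tnorm v ^+ 2.
Proof.
move=> /andP[_ s1] /(D_sigma_inner_le i) H; apply: le_trans H _.
rewrite mulNr gerDr; apply: mulr_ge0_le0; last exact: alpha_star_le0.
by rewrite subr_ge0 ltW.
Qed.

Lemma sufficient_decrease_le beta p (v : tangent p) gam t i :
  sufficient_decrease F beta v gam t ->
  F (gam t) ord0 i <= F p ord0 i + beta * t * inner (grad (component F i) p) v.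
Proof. by move=> /(_ i); rewrite !mxE. Qed.

Variables (sigma beta Rmax : R).
Hypotheses (sigma01 : 0 < sigma < 1) (beta01 : 0 < beta < 1) (Rmax1 : 1 <= Rmax).
Variables (p : nat -> M) (v : forall k, tangent (p k)) (t : nat -> R)
  (gam : nat -> R -> M).
Hypothesis alg : inexact_descent F sigma beta Rmax v t gam.

Definition step k : R := t k * tnorm (v k).

Lemma step_ge0 k : 0 <= step k.
Proof. by have [_ _ _ [/andP[t0 _] _] _] := alg k; rewrite mulr_ge0 ?(ltW t0)// sqrtr_ge0. Qed.

(** Each component decreases by at least [beta * t k * |v k|^2 / 2]; in the squared step one factor
    [t k] is replaced by [Rmax]. *)
Lemma step_sqr_le k i :
  step k ^+ 2 <= 2 * Rmax / beta * (F (p k) ord0 i - F (p k.+1) ord0 i).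
Proof.
have [_ vD _ [/andP[t0 tR] sd] pE] := alg k; have /andP[b0 _] := beta01.
have := sufficient_decrease_le i sd; rewrite -pE => H.
have := D_sigma_inner_le_tnorm i sigma01 vD => H2.
have bt : 0 < beta * t k by rewrite mulr_gt0.
have H3 : beta * t k * (2^-1 * tnorm (v k) ^+ 2) <= F (p k) ord0 i - F (p k.+1) ord0 i.
  have : beta * t k * inner (grad (component F i) (p k)) (v k) <=
     beta * t k * (- 2^-1 * tnorm (v k) ^+ 2) by rewrite ler_pM2l.
  rewrite mulNr mulrN; lra.
have RB : 0 < 2 * Rmax / beta by rewrite divr_gt0// mulr_gt0// (lt_le_trans ltr01).
apply: le_trans (_ : 2 * Rmax / beta * (beta * t k * (2^-1 * tnorm (v k) ^+ 2)) <= _); last first.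
  by rewrite ler_pM2l.
have -> : 2 * Rmax / beta * (beta * t k * (2^-1 * tnorm (v k) ^+ 2)) =
    Rmax * t k * tnorm (v k) ^+ 2 by field; exact: lt0r_neq0.
by rewrite /step exprMn ler_wpM2r ?sqr_ge0// expr2 ler_wpM2r// ltW.
Qed.

Lemma descent_nonincr i : nonincreasing_seq (fun k => F (p k) ord0 i).
Proof.
apply/nonincreasing_seqP => k; have := step_sqr_le k i.
have /andP[b0 _] := beta01.
have RB : 0 < 2 * Rmax / beta by rewrite divr_gt0// mulr_gt0// (lt_le_trans ltr01).
by move=> H; have := le_trans (sqr_ge0 _) H; rewrite pmulr_rge0// subr_ge0.
Qed.

Variable (l : 'rV[R]_n.+1).
Hypothesis Fl : F (p k) @[k --> \oo] --> l.

Lemma descent_cvg i : F (p k) ord0 i @[k --> \oo] --> l ord0 i.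
Proof. exact: ((cvg_mxP _ _).1 Fl ord0 i). Qed.

Lemma descent_lim_le k i : l ord0 i <= F (p k) ord0 i.
Proof.
have := nonincreasing_cvgn_ge (@descent_nonincr i) (cvgP _ (@descent_cvg i)) k.
by rewrite (cvg_lim _ (@descent_cvg i)).
Qed.

End Descent.

(** * Confinement and convergence of the iterates *)

Section Convergence.
Context {R : realType} {m n : nat} (M : riemannianManifold R m).
Variables (F : M -> 'rV[R]_n.+1).
Implicit Types (p q : M) (gam : R -> M).

(* The only facts about the geometry near [pbar] used by the convergence proof. *)
Record fejer_frame (pbar : M) (c : atlas M) (x0 : 'rV[R]_m) (rho eta L C eps : R) : Prop := {
  frame_L1 : 1 <= L;
  frame_C0 : 0 <= C;
  frame_eps0 : 0 < eps;
  frame_tame : forall x, cball x0 rho x -> tame c L x;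
  frame_eta_rho : eta < rho;
  frame_near : forall p, rdist pbar p <= eps -> coord_near c x0 eta p;
  frame_rdist_le : forall p q, coord_near c x0 eta p -> coord_near c x0 eta q ->
    rdist p q <= m%:R * L * `|chart c q - chart c p|;
  frame_le_rdist : forall p q, coord_near c x0 eta p -> coord_near c x0 eta q ->
    `|chart c q - chart c p| <= L * rdist p q;
  frame_stays : forall gam (T : R), 0 <= T -> coord_near c x0 eta (gam 0) ->
    (forall t, 0 <= t <= T -> geodesic_at gam t) ->
    T * tnorm (velocity gam 0) <= eps -> geodesic_in c x0 rho T gam;
  frame_fejer : forall p q (v : tangent p) gam (T : R), coord_near c x0 eta p ->
    coord_near c x0 eta q -> s_compatible F v -> complete_geodesic_from v gam ->
    vle (F q) (F p) -> 0 <= T -> T * tnorm v <= eps ->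
    rdist q (gam T) ^+ 2 <= rdist q p ^+ 2 + C * (T * tnorm v) ^+ 2
}.

Hypotheses (Mc : connected [set: M]) (F_C1 : C1_map F).
Variables (pbar : M) (c : atlas M) (x0 : 'rV[R]_m) (rho eta L C eps : R).
Hypothesis fr : fejer_frame pbar c x0 rho eta L C eps.
Variables (sigma beta Rmax : R).
Hypotheses (sigma01 : 0 < sigma < 1) (beta01 : 0 < beta < 1) (Rmax1 : 1 <= Rmax).
Variables (p : nat -> M) (v : forall k, tangent (p k)) (t : nat -> R)
  (gam : nat -> R -> M).
Hypothesis alg : inexact_descent F sigma beta Rmax v t gam.
Hypothesis scomp : forall k, s_compatible F (v k).
Variable (l : 'rV[R]_n.+1).
Hypothesis Fl : F (p k) @[k --> \oo] --> l.
Hypothesis pbarl : vle (F pbar) l.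

Let A := 2 * Rmax / beta.
Local Notation u k := (F (p k) ord0 ord0).

(** [kappa] bounds the total decrease of component 0. [kappa_eps] keeps each step short enough for
    the Fejer inequality, and [kappa_dhat] keeps the accumulated error within the radius [dhat]. *)
Variables (dbar dhat kappa : R).
Hypotheses (dbar0 : 0 <= dbar) (dhat0 : 0 <= dhat) (dhat_eps : dhat <= eps).
Hypothesis kappa_eps : A * kappa <= eps ^+ 2.
Hypothesis kappa_dhat : dbar ^+ 2 + C * (A * kappa) <= dhat ^+ 2.
Hypothesis p0_dbar : rdist pbar (p 0%N) <= dbar.
Hypothesis p0_kappa : u 0%N - F pbar ord0 ord0 <= kappa.

Let A0 : 0 <= A.
Proof.
have /andP[b0 _] := beta01; rewrite divr_ge0 ?(ltW b0)// mulr_ge0//.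
exact: le_trans Rmax1.
Qed.

Let F_ge k i : F pbar ord0 i <= F (p k) ord0 i.
Proof. exact: le_trans (pbarl i) (descent_lim_le sigma01 beta01 Rmax1 alg Fl k i). Qed.

Let step_A k : step v t k ^+ 2 <= A * (u k - u k.+1).
Proof. exact: (step_sqr_le sigma01 beta01 Rmax1 alg k ord0). Qed.

Let u_drop k : A * (u 0%N - u k) <= A * kappa.
Proof. by rewrite ler_wpM2l//; apply: le_trans p0_kappa; rewrite lerD2l lerN2. Qed.

Let u_incr k j : (k <= j)%N -> u j <= u k.
Proof. by move=> kj; exact: (descent_nonincr sigma01 beta01 Rmax1 alg ord0 kj). Qed.

Lemma step_le_eps k : step v t k <= eps.
Proof.
rewrite -ler_sqr ?nnegrE ?(step_ge0 alg) ?(ltW (frame_eps0 fr))//.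
apply: le_trans (step_A k) _; apply: le_trans kappa_eps.
apply: le_trans (u_drop k.+1); rewrite ler_wpM2l// lerD2r.
exact: u_incr.
Qed.

Lemma fejer_iterate q k : coord_near c x0 eta q -> coord_near c x0 eta (p k) ->
  vle (F q) (F (p k)) ->
  rdist q (p k.+1) ^+ 2 <= rdist q (p k) ^+ 2 + C * (A * (u k - u k.+1)).
Proof.
move=> qn pn qp; have [_ _ gk [/andP[t0 _] _] ->] := alg k.
apply: le_trans (frame_fejer fr pn qn (scomp k) gk qp (ltW t0) (step_le_eps k)) _.
rewrite lerD2l ler_wpM2l ?(frame_C0 fr)//.
by have := step_A k; have [_ _ _ _ ->] := alg k.
Qed.

(** The induction carries the telescoped bound with the decrease spent so far: [dhat] alone would
    leave no room for the error of the next step. *)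
Lemma iterates_stay k : rdist pbar (p k) <= dhat.
Proof.
suff H : rdist pbar (p k) <= dhat /\
    rdist pbar (p k) ^+ 2 <= dbar ^+ 2 + C * (A * (u 0%N - u k)) by case: H.
have r0 q : 0 <= rdist pbar q by exact: rdist_ge0.
have sq j : rdist pbar (p j) ^+ 2 <= dbar ^+ 2 + C * (A * (u 0%N - u j)) ->
    rdist pbar (p j) <= dhat.
  move=> H; rewrite -ler_sqr ?nnegrE//; apply: le_trans H _.
  apply: le_trans kappa_dhat; rewrite lerD2l ler_wpM2l ?(frame_C0 fr)//.
have pbarn : coord_near c x0 eta pbar.
  by apply: (frame_near fr); apply: le_trans (rdist_self_le0 _) _; exact/ltW/(frame_eps0 fr).
elim: k => [|k [ih1 ih2]].
  have H : rdist pbar (p 0%N) ^+ 2 <= dbar ^+ 2 + C * (A * (u 0%N - u 0%N)).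
    by rewrite subrr !mulr0 addr0 lerXn2r ?nnegrE.
  by split=> //; exact: sq.
have pn : coord_near c x0 eta (p k) by apply: (frame_near fr); exact: le_trans dhat_eps.
have H : rdist pbar (p k.+1) ^+ 2 <= dbar ^+ 2 + C * (A * (u 0%N - u k.+1)).
  apply: le_trans (fejer_iterate pbarn pn (F_ge k)) _.
  apply: le_trans (lerD ih2 (lexx _)) _.
  by rewrite -addrA -mulrDr -mulrDr addrA subrK.
by split=> //; exact: sq.
Qed.

Lemma iterates_near k : coord_near c x0 eta (p k).
Proof. by apply: (frame_near fr); exact: le_trans (iterates_stay k) dhat_eps. Qed.

Let tame_eta x : cball x0 eta x -> tame c L x.
Proof. by move=> xe; apply: (frame_tame fr); exact: le_trans xe (ltW (frame_eta_rho fr)). Qed.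

Lemma iterates_cluster : exists2 ps : M, coord_near c x0 eta ps &
  forall e N, 0 < e -> exists2 k, (N <= k)%N & `|chart c (p k) - chart c ps| <= e.
Proof.
have xe : \forall k \near \oo, cball x0 eta (chart c (p k)).
  by apply: nearW => k; have [] := iterates_near k.
have [xs [xse xscl]] := @compact_cball _ _ x0 eta (chart c (p k) @[k --> \oo]) _ xe.
have [xsc _ _ _ _] := tame_eta xse; have [psc psE] := chart_invP xsc.
exists (chart_inv c xs); first by split=> //; rewrite psE.
move=> e N e0; rewrite psE.
have near_e : nbhs xs [set y | `|y - xs| <= e].
  have : nbhs xs (ball xs e) by exact: nbhsx_ballx.
  apply: filterS => y; rewrite -ball_normE /= distrC; exact: ltW.
have tail : (chart c (p k) @[k --> \oo]) [set y | exists2 k, (N <= k)%N & y = chart c (p k)].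
  by exists N => // k /= Nk; exists k.
by have [y [[k Nk ->] ye]] := xscl _ _ tail near_e; exists k.
Qed.

(** Continuity along late iterates and monotonicity of the values. It makes the cluster point an
    admissible centre for the Fejer inequality at every iterate. *)
Lemma cluster_value_le ps k : coord_near c x0 eta ps ->
  (forall e N, 0 < e -> exists2 k, (N <= k)%N & `|chart c (p k) - chart c ps| <= e) ->
  vle (F ps) (F (p k)).
Proof.
move=> [psc pse] cl i; rewrite leNgt; apply/negP => lt.
pose e := F ps ord0 i - F (p k) ord0 i; have e0 : 0 < e by rewrite subr_gt0.
have [xsc _ _ _ _] := tame_eta pse.
have fc := C1_at_continuous (component_chart_C1 F_C1 i xsc).
have : \forall y \near chart c ps, `|(component F i \o chart_inv c) (chart c ps) -
    (component F i \o chart_inv c) y| < e by move/cvgrPdist_lt : fc => /(_ e e0).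
move=> /near_cball[d d0 dP]; have [j kj je] := cl d k d0.
have := dP _ je; have [pjc _] := iterates_near j.
rewrite /= /component !chartK// => H.
have := descent_nonincr sigma01 beta01 Rmax1 alg i kj.
by have := le_lt_trans (ler_norm _) H; rewrite /e => X Y; lra.
Qed.

Lemma iterates_cvg : exists ps : M, [/\ coord_near c x0 eta ps,
  chart c (p k) @[k --> \oo] --> chart c ps & p k @[k --> \oo] --> ps].
Proof.
have [ps psn cl] := iterates_cluster; exists ps.
have L0 : 0 < L by apply: lt_le_trans (frame_L1 fr).
have drop j k : (k <= j)%N -> rdist ps (p j) ^+ 2 <=
    rdist ps (p k) ^+ 2 + C * (A * (u k - u j)).
  move=> kj; rewrite -(subnKC kj); elim: (j - k)%N => [|i ih].
    by rewrite addn0 subrr !mulr0 addr0.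
  rewrite addnS; have psF := cluster_value_le (k + i) psn cl.
  apply: le_trans (fejer_iterate psn (iterates_near _) psF) _.
  apply: le_trans (lerD ih (lexx _)) _.
  by rewrite -addrA -mulrDr -mulrDr addrA subrK.
have xcvg : chart c (p k) @[k --> \oo] --> chart c ps.
  (* One [e1] pays for the squared distance at an iterate near the cluster point, the other for all
     later Fejer errors; [L] converts distance to coordinates. *)
  apply/cvgrPdist_le => e e0; pose e1 := (e / L) ^+ 2 / 2.
  have e10 : 0 < e1 by rewrite divr_gt0// exprn_gt0// divr_gt0.
  pose CA := C * A + 1.
  have CA0 : 0 < CA by rewrite ltr_wpDl// mulr_ge0// (frame_C0 fr).
  have : \forall k \near \oo, u k - l ord0 ord0 <= e1 / CA.
    have : \forall k \near \oo, `|l ord0 ord0 - u k| <= e1 / CA.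
      have Fl0 : u k @[k --> \oo] --> l ord0 ord0 by exact: ((cvg_mxP _ _).1 Fl ord0 ord0).
      by move/cvgrPdist_le : Fl0 => /(_ (e1 / CA)); apply; rewrite divr_gt0.
    by apply: filterS => k; rewrite distrC; apply: le_trans; exact: ler_norm.
  move=> [N _ NP].
  pose e2 := Num.sqrt e1 / (m%:R * L + 1).
  have mL0 : 0 < m%:R * L + 1 by rewrite ltr_wpDl// mulr_ge0// ltW.
  have e20 : 0 < e2 by rewrite divr_gt0// sqrtr_gt0.
  have [k Nk ke] := cl e2 N e20.
  have dk : rdist ps (p k) ^+ 2 <= e1.
    rewrite -[leRHS]sqr_sqrtr ?(ltW e10)// lerXn2r ?nnegrE ?sqrtr_ge0 ?rdist_ge0//.
    apply: le_trans (frame_rdist_le fr psn (iterates_near k)) _.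
    apply: (@le_trans _ _ ((m%:R * L + 1) * e2)); last by rewrite /e2 mulrC divfK// lt0r_neq0.
    by rewrite ler_pM// ?mulr_ge0 ?(ltW L0)// lerDl.
  exists k => // j /= kj; rewrite distrC.
  apply: le_trans (frame_le_rdist fr psn (iterates_near j)) _.
  rewrite mulrC -ler_pdivlMr//.
  rewrite -ler_sqr ?nnegrE ?rdist_ge0 ?divr_ge0 ?(ltW e0) ?(ltW L0)//.
  apply: le_trans (drop _ _ kj) _.
  have -> : (e / L) ^+ 2 = e1 + e1 by rewrite /e1 -splitr.
  apply: lerD => //; rewrite mulrA.
  have ukj : 0 <= u k - u j by rewrite subr_ge0 u_incr.
  have ukl : u k - u j <= e1 / CA.
    by have := NP k Nk; have := descent_lim_le sigma01 beta01 Rmax1 alg Fl j ord0; lra.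
  apply: (@le_trans _ _ (CA * (e1 / CA))); last by rewrite mulrC divfK// lt0r_neq0.
  apply: ler_pM => //; first by rewrite mulr_ge0// (frame_C0 fr).
  by rewrite /CA lerDl.
split=> //; have [psc pse] := psn; have [xsc _ _ _ _] := tame_eta pse.
have H : chart_inv c (chart c (p k)) @[k --> \oo] --> chart_inv c (chart c ps).
  exact: (cvg_comp _ _ xcvg (chart_inv_continuous xsc)).
have E : (fun k => chart_inv c (chart c (p k))) = p.
  by apply/funext => k; rewrite chartK//; have [] := iterates_near k.
by rewrite E chartK in H.
Qed.

End Convergence.

(** * Criticality of the limit *)

Section Criticality.
Context {R : realType} {m n : nat} (M : riemannianManifold R m).
Variables (F : M -> 'rV[R]_n.+1).
Implicit Types (p q : M) (gam : R -> M).
Hypotheses (F_C1 : C1_map F).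
Variables (pbar : M) (c : atlas M) (x0 : 'rV[R]_m) (rho eta L C eps : R).
Hypothesis fr : fejer_frame F pbar c x0 rho eta L C eps.
Variables (sigma beta : R).
Hypotheses (sigma01 : 0 < sigma < 1) (beta01 : 0 < beta < 1).

Let L1 : 1 <= L. Proof. exact: frame_L1 fr. Qed.

Let L0 : 0 <= L. Proof. exact: le_trans L1. Qed.

Let tm := frame_tame fr.

Local Notation fhat i := (component F i \o chart_inv c).

Lemma coord_near_cball p : coord_near c x0 eta p -> cball x0 rho (chart c p).
Proof. by move=> [_ pe]; exact: le_trans pe (ltW (frame_eta_rho fr)). Qed.

Lemma tocoord_norm_le p (v : tangent p) : coord_near c x0 eta p ->
  `|tocoord c v| <= L * tnorm v.
Proof.
move=> pn; have [pc _] := pn; apply: (norm_le_metric L1 tm (coord_near_cball pn)).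
  exact: sqrtr_ge0.
by rewrite tnorm_sqr (inner_tocoord _ _ pc).
Qed.

Lemma dpart_diff_le (f : 'rV[R]_m -> R) (x y dx dy : 'rV[R]_m) (P e : R) :
  (forall i, `|partial i f x| <= P) -> (forall i, `|partial i f x - partial i f y| <= e) ->
  `|dpart f x dx - dpart f y dy| <= m%:R * (P * `|dx - dy|) + m%:R * (`|dy| * e).
Proof.
move=> fP fe.
have -> : dpart f x dx - dpart f y dy =
    dpart f x (dx - dy) + \sum_i dy ord0 i * (partial i f x - partial i f y).
  rewrite /dpart -sumrB -big_split /=; apply: eq_bigr => i _; rewrite !mxE; ring.
apply: le_trans (ler_normD _ _) _; apply: lerD; first exact: dpart_norm_le.
by apply: sum_norm_le => i; rewrite normrM ler_pM// le_mx_norm.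
Qed.

(** Up to time [s] the derivative of a component along the geodesic moves by at most
    [(1 - beta) * mu], half due to the acceleration and half to the oscillation of the partial
    derivatives. As it starts at [- mu] or below, a fraction [beta] of the initial slope survives.
    The bounds on [s] involve only constants common to all late iterates. *)
Lemma sufficient_decrease_near (xs : 'rV[R]_m) (d P e V mu : R) p (v : tangent p) gam (s : R) :
  (forall y i l, cball xs d y -> `|partial l (fhat i) y| <= P /\
     `|partial l (fhat i) y - partial l (fhat i) xs| <= e) ->
  coord_near c x0 eta p -> `|chart c p - xs| <= d / 2 ->
  complete_geodesic_from v gam -> 0 < s -> 0 <= P -> 0 <= e -> tnorm v <= V -> s * V <= eps ->
  L * V * s <= d / 2 ->
  m%:R * P * accel_bound (m := m) L * V ^+ 2 * s <= (1 - beta) * mu / 2 ->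
  m%:R * (L * V * (2 * e)) <= (1 - beta) * mu / 2 ->
  (forall i, inner (grad (component F i) p) v <= - mu) ->
  sufficient_decrease F beta v gam s.
Proof.
move=> near_xs; case=> pc pe pd [gG g0 gv] s0 P0 e0; move: v gv; rewrite -g0 in pc pe pd *.
move=> v gv; rewrite -gv => vV sV LVs acc_small e_small decr i.
have pn : coord_near c x0 eta (gam 0) by split.
have gin : geodesic_in c x0 rho s gam.
  apply: (frame_stays fr) => //; first exact: ltW.
  by apply: le_trans sV; rewrite ler_wpM2l// ltW.
have s_ge0 := ltW s0; set sg := tnorm _ in vV.
have sg0 : 0 <= sg by exact: sqrtr_ge0.
have V0 : 0 <= V by exact: le_trans vV.
set x := chart c \o gam.
have c0s : 0 <= (0 : R) <= s by rewrite lexx.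
have D0 : inner (grad (component F i) (gam 0)) (velocity gam 0) =
    dpart (fhat i) (x 0) (derive1 x 0).
  rewrite (inner_grad _ (F_C1 i) pc); congr (dpart _ _ _).
  have [gc xd _] := C1_curve_chart (geodesic_C1_curve (gG 0)) pc.
  exact: velocity_tocoord gc (nbhs_singleton xd).
have x0d : cball xs d (x 0).
  have d2 : 0 <= d / 2 by exact: le_trans pd.
  by apply: (le_trans pd); lra.
have Fd (xi : R) : 0 <= xi <= s ->
    is_derive xi 1 (component F i \o gam) (dpart (fhat i) (x xi) (derive1 x xi)).
  move=> xis; have [gt gtc _] := gin xi xis.
  have [gc xd _] := C1_curve_chart (geodesic_C1_curve gt) gtc.
  have xd1 := nbhs_singleton xd.
  by have := is_derive_component F_C1 i gc xd1.
have Fe (xi : R) : 0 <= xi <= s -> `|dpart (fhat i) (x xi) (derive1 x xi) -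
    dpart (fhat i) (x 0) (derive1 x 0)| <= (1 - beta) * mu.
  move=> xis; have /andP[xi0 xi_s] := xis.
  have [xL x'L _] := geodesic_in_taylor L1 tm s_ge0 gin xis.
  have [_ _ _ dx0 _] := geodesic_in_derive L1 tm s_ge0 gin c0s.
  have xid : cball xs d (x xi).
    rewrite /cball /= -(subrKA (x 0)); apply: le_trans (ler_normD _ _) _; rewrite [leRHS]splitr lerD//.
    apply: le_trans xL _; apply: le_trans LVs.
    by rewrite ler_pM ?mulr_ge0// ler_wpM2l.
  apply: le_trans (@dpart_diff_le _ _ _ _ _ P (2 * e) _ _) _.
  - by move=> j; have [] := near_xs _ i j xid.
  - move=> j; have [_ H1] := near_xs _ i j xid; have [_ H2] := near_xs _ i j x0d.
    have -> : partial j (fhat i) (x xi) - partial j (fhat i) (x 0) =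
      (partial j (fhat i) (x xi) - partial j (fhat i) xs) -
      (partial j (fhat i) (x 0) - partial j (fhat i) xs) by ring.
    apply: le_trans (ler_normB _ _) _; lra.
  rewrite [leRHS]splitr; apply: lerD.
    apply: le_trans acc_small.
    rewrite (_ : m%:R * P * _ * _ * s = m%:R * (P * (accel_bound (m := m) L * (V ^+ 2 * s)))); last by rewrite !mulrA.
    rewrite ler_wpM2l// ler_wpM2l//.
    apply: le_trans x'L _; rewrite -[leLHS]mulrA ler_wpM2l ?accel_bound_ge0//.
    by rewrite ler_pM ?sqr_ge0// lerXn2r ?nnegrE.
  apply: le_trans e_small; rewrite ler_wpM2l//.
  apply: ler_pM => //; first by rewrite mulr_ge0.
  by apply: le_trans dx0 _; rewrite ler_wpM2l.
have := is_derive_segment_le s_ge0 Fd Fe; rewrite subr0 ler_norml => /andP[_].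
have := decr i; rewrite !mxE gv -gv D0 /= => cmu H.
have /andP[b0 b1] := beta01.
have K2 : (1 - beta) * s * dpart (fhat i) (x 0) (derive1 x 0) <= (1 - beta) * s * - mu.
  by rewrite ler_wpM2l// mulr_ge0// subr_ge0 ltW.
rewrite /component /= in H D0 *; nra.
Qed.

Lemma exists_pos_lower_bound (d : 'I_n.+1 -> R) : (forall i, 0 < d i) ->
  exists2 z, 0 < z & forall i, z <= d i.
Proof.
move=> d0; exists (\big[Num.min/d ord0]_i d i); first by apply: lt_bigmin.
by move=> i; exact: bigmin_le.
Qed.

(** The coordinates [w] of a descent direction at [ps] are kept while the base point moves. On
    [s *: w] the value of [alpha] is at most [- s * zz + s^2 * B / 2], and [s = zz / B] minimises
    this bound. *)
Lemma noncritical_alpha_star ps : coord_near c x0 eta ps -> ~ pareto_critical F ps ->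
  exists2 mu, 0 < mu & \forall y \near chart c ps, forall p, coord_near c x0 eta p ->
    chart c p = y -> alpha_star F p <= - mu.
Proof.
move=> psn /contrapT[vs vs_neg]; have [psc _] := psn; set xs := chart c ps.
pose w := tocoord c vs.
have fC i : C1_at (fhat i) xs by have := component_chart_C1 F_C1 i (cod_chart psc).
have [z z0 zP] : exists2 z, 0 < z & forall i, z <= - dpart (fhat i) xs w.
  apply: exists_pos_lower_bound => i; rewrite oppr_gt0 -(inner_grad vs (F_C1 i) psc).
  exact: vs_neg.
pose B := m%:R ^+ 2 * L * (`|w| * `|w|) + 1.
have B0 : 0 < B by rewrite ltr_wpDl// !mulr_ge0// exprn_ge0.
pose zz := z / 2; have zz0 : 0 < zz by rewrite divr_gt0.
exists (zz ^+ 2 / (2 * B)); first by rewrite divr_gt0 ?exprn_gt0// mulr_gt0.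
have : \forall y \near xs, forall i, dpart (fhat i) y w <= - zz.
  apply: (@filter_forall _ _ (fun i y => dpart (fhat i) y w <= - zz) (nbhs xs)) => i.
  have Dc : {for xs, continuous (fun y => dpart (fhat i) y w)}.
    exact: (@dpart_cvg _ _ _ _ (nbhs_filter xs) _ id).
  have : \forall y \near xs, `|dpart (fhat i) xs w - dpart (fhat i) y w| <= zz.
    by move/cvgrPdist_le : Dc => /(_ _ zz0).
  apply: filterS => y; rewrite ler_norml => /andP[H _]; have := zP i.
  rewrite /zz in H *; lra.
apply: filterS => y yP p pn py; have [pc pe] := pn.
have [u uE] := tocoord_surj w pc; pose s := zz / B.
have s0 : 0 < s by rewrite divr_gt0.
have suE : tocoord c (s *: (u : 'rV[R]_m) : tangent p) = s *: w.
  by rewrite /tocoord -scalemxAl -uE.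
apply: le_trans (alpha_star_le F (s *: (u : 'rV[R]_m) : tangent p)) _.
apply: le_trans (@alpha_le _ _ _ _ F p (s *: (u : 'rV[R]_m) : tangent p) (- (s * zz)) _) _.
  move=> i; rewrite (inner_grad _ (F_C1 i) pc) suE py.
  rewrite (_ : dpart _ _ _ = s * dpart (fhat i) y w); last first.
    by rewrite /dpart mulr_sumr; apply: eq_bigr => j _; rewrite mxE mulrA.
  by rewrite -mulrN ler_pM2l.
have nB : tnorm (s *: (u : 'rV[R]_m) : tangent p) ^+ 2 <= s ^+ 2 * B.
  rewrite tnorm_sqr (inner_tocoord _ _ pc) suE -/(metric _ _ _ _) metricZl metricZr.
  set X := metric _ _ _ _.
  have XB : X <= B.
    apply: le_trans (ler_norm _) _.
    apply: le_trans (metric_le tm _ _ (coord_near_cball pn)) _.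
    by rewrite /B lerDl.
  have -> : s * (s * X) = s ^+ 2 * X by rewrite mulrA.
  by have := ler_wpM2l (sqr_ge0 s) XB.
have E : s * zz = s ^+ 2 * B by rewrite /s; field; exact: lt0r_neq0.
have E2 : zz ^+ 2 / (2 * B) = 2^-1 * (s * zz) by rewrite /s; field; exact: lt0r_neq0.
rewrite E2; lra.
Qed.

End Criticality.

Section LimitCritical.
Context {R : realType} {m n : nat} (M : riemannianManifold R m).
Variables (F : M -> 'rV[R]_n.+1).
Hypotheses (F_C1 : C1_map F).
Variables (pbar : M) (c : atlas M) (x0 : 'rV[R]_m) (rho eta L C eps : R).
Hypothesis fr : fejer_frame F pbar c x0 rho eta L C eps.
Variables (sigma beta Rmax : R).
Hypotheses (sigma01 : 0 < sigma < 1) (beta01 : 0 < beta < 1) (Rmax1 : 1 <= Rmax).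
Variables (p : nat -> M) (v : forall k, tangent (p k)) (t : nat -> R)
  (gam : nat -> R -> M).
Hypothesis alg : inexact_descent F sigma beta Rmax v t gam.
Variable (l : 'rV[R]_n.+1).
Hypothesis Fl : F (p k) @[k --> \oo] --> l.
Hypothesis p_near : forall k, coord_near c x0 eta (p k).
Variable (ps : M).
Hypotheses (psn : coord_near c x0 eta ps)
  (xcvg : chart c (p k) @[k --> \oo] --> chart c ps).

Local Notation fhat i := (component F i \o chart_inv c).

Let L1 : 1 <= L. Proof. exact: frame_L1 fr. Qed.

Let L0 : 0 <= L. Proof. exact: le_trans L1. Qed.

Lemma steps_vanish mu e : 0 < mu -> 0 < e ->
  (\forall k \near \oo, forall i, inner (grad (component F i) (p k)) (v k) <= - mu) ->
  \forall k \near \oo, t k <= e.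
Proof.
move=> mu0 e0 vmu; have /andP[b0 _] := beta01.
have a0 : 0 < beta * mu * e by rewrite !mulr_gt0.
have Fl0 : F (p k) ord0 ord0 @[k --> \oo] --> l ord0 ord0 by exact: ((cvg_mxP _ _).1 Fl ord0 ord0).
have Fle : \forall k \near \oo, `|l ord0 ord0 - F (p k) ord0 ord0| <= beta * mu * e.
  by move/cvgrPdist_le : Fl0 => /(_ _ a0).
apply: filterS2 vmu Fle => k /(_ ord0) vk Fk.
have [_ _ _ [/andP[t0 _] sd] pE] := alg k.
have := sufficient_decrease_le ord0 sd; rewrite -pE => H.
have H2 := descent_lim_le sigma01 beta01 Rmax1 alg Fl k.+1 ord0.
have H3 : F (p k) ord0 ord0 - l ord0 ord0 <= beta * mu * e.
  by apply: le_trans Fk; rewrite distrC ler_norm.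
have : beta * t k * inner (grad (component F ord0) (p k)) (v k) <= beta * t k * - mu.
  by rewrite ler_pM2l ?mulr_gt0.
rewrite mulrN => H4; rewrite -(ler_pM2l (_ : 0 < beta * mu)) ?mulr_gt0//.
rewrite [leLHS]mulrAC; lra.
Qed.

Lemma limit_critical :
  (exists2 tau : R, 0 < tau & forall k, tau <= t k) \/
  (exists2 nu : R, 0 < nu < 1 & armijo_steps F beta nu v t gam) ->
  pareto_critical F ps.
Proof.
move=> rule; apply: contrapT => nc.
have [mu0 mu00 /= muP] := noncritical_alpha_star F_C1 fr psn nc.
have /andP[s0 s1] := sigma01; have /andP[b0 b1] := beta01.
pose mu := (1 - sigma) * mu0.
have mup : 0 < mu by rewrite mulr_gt0// subr_gt0.
have vmu : \forall k \near \oo, forall i, inner (grad (component F i) (p k)) (v k) <= - mu.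
  have H : \forall k \near \oo, forall q, coord_near c x0 eta q ->
    chart c q = chart c (p k) -> alpha_star F q <= - mu0 := xcvg muP.
  apply: filterS H => k /(_ _ (p_near k) erefl) ak i.
  have [_ vD _ _ _] := alg k; apply: le_trans (D_sigma_inner_le i vD) _.
  have : (1 - sigma) * alpha_star F (p k) <= (1 - sigma) * - mu0.
    by rewrite ler_pM2l ?subr_gt0.
  have := sqr_ge0 (tnorm (v k)); rewrite /mu; lra.
have tv e (e0 : 0 < e) := steps_vanish mup e0 vmu.
case: rule => [[tau tau0 tauP]|[nu /andP[nu0 nu1] arm]].
  have [N _ /(_ N (leqnn N)) /=] := tv (tau / 2) (divr_gt0 tau0 (ltr0n _ 2)).
  by have := tauP N; lra.
have xcvg' := xcvg; set xs := chart c ps in xcvg' muP *; have [psc pse] := psn.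
have fC i : C1_at (fhat i) xs by have := component_chart_C1 F_C1 i (cod_chart psc).
have [P P0 PP] := @near_bounded _ _ ('I_n.+1 * 'I_m)%type
  (fun k => partial k.2 (fhat k.1)) xs (fun k => (fC k.1 k.2).2).
(* A bound on the directions: [|v|^2 / 2] is at most minus the slope of component 0, itself at most
   [m * P * L * |v|]. *)
pose V := 2 * m%:R * P * L.
have V0 : 0 <= V by rewrite !mulr_ge0.
pose mu1 := (1 - beta) * mu / 2.
have mu10 : 0 < mu1 by rewrite divr_gt0// mulr_gt0// subr_gt0.
have [e e0 eP] := exists_small_factor
  (mulr_ge0 (ler0n R m) (mulr_ge0 (mulr_ge0 L0 V0) (ler0n R 2))) mu10.
have near_e : \forall y \near xs, forall k : 'I_n.+1 * 'I_m,
    `|partial k.2 (fhat k.1) y - partial k.2 (fhat k.1) xs| <= e.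
  apply: (@filter_forall _ _ (fun (k : 'I_n.+1 * 'I_m) y =>
    `|partial k.2 (fhat k.1) y - partial k.2 (fhat k.1) xs| <= e) (nbhs xs)) => k.
  have H : \forall y \near xs, `|partial k.2 (fhat k.1) xs - partial k.2 (fhat k.1) y| <= e.
    by move/cvgrPdist_le : (fC k.1 k.2).2 => /(_ _ e0).
  by apply: filterS H => y; rewrite distrC.
have [d d0 dP] : exists2 d : R, 0 < d & forall y, cball xs d y ->
    (forall k : 'I_n.+1 * 'I_m, `|partial k.2 (fhat k.1) y| <= P) /\
    (forall k : 'I_n.+1 * 'I_m, `|partial k.2 (fhat k.1) y - partial k.2 (fhat k.1) xs| <= e).
  by apply: near_cball; apply: filterI.
have d20 : 0 < d / 2 by rewrite divr_gt0.
have [e1 e10 e1P] := exists_small_factor V0 (frame_eps0 fr).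
have [e2 e20 e2P] := exists_small_factor (mulr_ge0 L0 V0) d20.
have acc0 : 0 <= m%:R * P * accel_bound (m := m) L * V ^+ 2.
  by rewrite !mulr_ge0 ?exprn_ge0 ?accel_bound_ge0.
have [e3 e30 e3P] := exists_small_factor acc0 mu10.
have xd : \forall k \near \oo, `|chart c (p k) - xs| <= d / 2.
  have : \forall k \near \oo, `|xs - chart c (p k)| <= d / 2.
    by move/cvgrPdist_le : xcvg' => /(_ _ d20).
  by apply: filterS => k; rewrite distrC.
have tsmall e' : 0 < e' -> \forall k \near \oo, t k / nu <= e'.
  move=> e'0; apply: filterS (tv (e' * nu) (mulr_gt0 e'0 nu0)) => k.
  by rewrite ler_pdivrMr.
have tlt1 : \forall k \near \oo, t k <= 2^-1 by apply: tv; rewrite invr_gt0.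
have [N _ NP] : \forall k \near \oo, [/\ `|chart c (p k) - xs| <= d / 2,
    t k / nu <= e1, t k / nu <= e2, t k / nu <= e3 & t k <= 2^-1] /\
    forall i, inner (grad (component F i) (p k)) (v k) <= - mu.
  near=> k; split; last by near: k; exact: vmu.
  split; near: k; [exact: xd|exact: tsmall|exact: tsmall|exact: tsmall|exact: tlt1].
have {NP}[[xN t1 t2 t3 tN1] decr] := NP N (leqnn N).
have [_ vD gN [/andP[t0 _] _] _] := alg N.
(* Exponent 0 would mean [t N = 1], excluded by [t N <= 2^-1]. Hence [t N / nu] is again a trial
   step, to which maximality applies. *)
have [[[|i] tE sd] ub] := arm N; first by move: tN1; rewrite tE expr0; lra.
pose s := t N / nu; have s_gt0 : 0 < s by rewrite divr_gt0.
have sE : s = nu ^+ i by rewrite /s tE exprSr mulfK// lt0r_neq0.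
have [pc _] := p_near N.
have vV : tnorm (v N) <= V.
  have := D_sigma_inner_le_tnorm ord0 sigma01 vD.
  rewrite (inner_grad _ (F_C1 ord0) pc) => H.
  have xNd : cball xs d (chart c (p N)) by apply: (le_trans xN); lra.
  have [PN _] := dP _ xNd.
  have PN0 j : `|partial j (fhat ord0) (chart c (p N))| <= P by exact: (PN (ord0, j)).
  have := dpart_norm_le (tocoord c (v N)) PN0.
  have := tocoord_norm_le fr (v N) (p_near N).
  have [->|vn0] := eqVneq (tnorm (v N)) 0; first by [].
  have vp : 0 < tnorm (v N) by rewrite lt_def vn0 sqrtr_ge0.
  move=> vL; rewrite ler_norml => /andP[H2 _].
  have H3 : m%:R * (P * `|tocoord c (v N)|) <= m%:R * (P * (L * tnorm (v N))).
    by rewrite ler_wpM2l// ler_wpM2l.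
  rewrite -(ler_pM2r vp) -expr2.
  have -> : V * tnorm (v N) = 2 * (m%:R * (P * (L * tnorm (v N)))) by rewrite /V; ring.
  rewrite /= in H2; lra.
have good : sufficient_decrease F beta (v N) (gam N) s.
  apply: (sufficient_decrease_near F_C1 fr beta01 (xs := xs) (d := d) (P := P) (e := e)
    (V := V) (mu := mu)) => //.
  - move=> y j k yd; have [H1 H2] := dP y yd.
    by split; [exact: (H1 (j, k))|exact: (H2 (j, k))].
  - exact: ltW.
  - by apply: le_trans e1P; rewrite mulrC ler_wpM2l.
  - by apply: le_trans e2P; rewrite ler_wpM2l// mulr_ge0.
  - by apply: le_trans e3P; rewrite ler_wpM2l.
  - by apply: le_trans eP; rewrite le_eqVlt; apply/orP; left; apply/eqP; ring.
have : s <= t N by apply: ub; exists i.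
by rewrite /s ler_pdivrMr// leNgt gtr_pMr// nu1.
Unshelve. all: by end_near. Qed.

End LimitCritical.

(** * Choice of the local radii *)

Section FrameExists.
Context {R : realType} {m n : nat} (M : riemannianManifold R m).
Variables (F : M -> 'rV[R]_n.+1).

Lemma exists_fejer_frame (pbar : M) : connected [set: M] -> C1_map F ->
  quasi_convex_around F pbar ->
  exists rho eta L C eps,
    fejer_frame F pbar (chart_at pbar) (coords_at pbar) rho eta L C eps.
Proof.
move=> Mc F_C1 [rq [rq0 wc qc]]; set c := chart_at pbar; set x0 := coords_at pbar.
have pc : dom c pbar := dom_chart_at pbar.
have [L L1 /near_cball[r0 r00 tm0]] := near_tame (cod_chart pc).
have L0 : 0 <= L by exact: le_trans L1.
have mL0 : 0 <= m%:R * L by rewrite mulr_ge0.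
have [r1 r10 r1P] := exists_small_factor mL0 rq0.
(* [r0 / 2] keeps the metric tame on the cube of radius [2 * rho]; [r1] puts the cube of radius
   [rho] inside the ball of quasi-convexity. *)
pose rho := Num.min (r0 / 2) r1.
have rho0 : 0 < rho by rewrite lt_min r10 divr_gt0.
have rho_r0 : 2 * rho <= r0.
  have : rho <= r0 / 2 by rewrite ge_min lexx.
  lra.
have rho_r1 : rho <= r1 by rewrite ge_min lexx orbT.
have tm2 x : cball x0 (2 * rho) x -> tame c L x.
  by move=> xr; apply: tm0; exact: le_trans xr rho_r0.
have tm x : cball x0 rho x -> tame c L x.
  by move=> xr; apply: tm2; apply: le_trans xr _; rewrite ler_peMl ?ler1n// ltW.
pose K := cutoff_lip (m := m) rho L.
have K0 : 0 <= K by exact: cutoff_lip_ge0.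
have [e1 e10 e1P] := exists_small_factor (mulr_ge0 (ler0n R 8) (ler0n R m)) rho0.
have [e2 e20 e2P] := @exists_small_factor R (K * (m%:R * L * 2)) 2^-1
  (mulr_ge0 K0 (mulr_ge0 mL0 (ler0n _ _))) (ltac:(by rewrite invr_gt0)).
have [e3 e30 e3P] := exists_small_factor (mulr_ge0 mL0 (ler0n R 2)) ltr01.
(* The four bounds serve, in this order, [theta1], [eta_sq], [eta_K] and [eta_1]. *)
pose eta := Num.min (Num.min (rho / 2) e1) (Num.min e2 e3).
have eta0 : 0 < eta by rewrite !lt_min e10 e20 e30 divr_gt0.
have [eta_r2 eta1 eta2 eta3] : [/\ eta <= rho / 2, eta <= e1, eta <= e2 & eta <= e3].
  by rewrite /eta !ge_min !lexx !orbT.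
have eta_rho : eta < rho by lra.
have eta_sq : 8 * m%:R * eta ^+ 2 <= rho ^+ 2.
  rewrite !expr2 mulrA ler_pM ?mulr_ge0 ?(ltW eta0) ?(ltW eta_rho)//.
  by apply: le_trans e1P; rewrite ler_wpM2l ?mulr_ge0.
have eta_K : K * (m%:R * L * (2 * eta)) <= 2^-1.
  have -> : K * (m%:R * L * (2 * eta)) = K * (m%:R * L * 2) * eta by rewrite !mulrA.
  by apply: le_trans e2P; apply: ler_wpM2l eta2; exact: (mulr_ge0 K0 (mulr_ge0 mL0 (ler0n _ _))).
have eta_1 : m%:R * L * (2 * eta) <= 1.
  by apply: le_trans e3P; rewrite mulrA ler_wpM2l ?mulr_ge0.
(* The tolerable loss of the cut-off: where it is at least [1 - theta], the square distance is at
   most [rho ^+ 2 * theta = eta ^+ 2]. *)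
pose theta := (eta / rho) ^+ 2.
have er1 : eta / rho <= 2^-1 by rewrite ler_pdivrMr//; lra.
have er0 : 0 < eta / rho by rewrite divr_gt0.
have theta0 : 0 < theta by rewrite exprn_gt0.
have theta1 : theta <= 4^-1 by rewrite /theta expr2; nra.
have [d1 d10 d1P] := exists_small_factor K0 theta0.
have rho1_0 : 0 < Num.min 1 rho by rewrite lt_min ltr01.
have [d2 d20 d2P] := exists_small_factor L0 rho1_0.
(* [d1] limits the loss of the cut-off to [theta], both within distance [eps] of [pbar] and along a
   step of that length; [d2] bounds the coordinate increment of a step by 1 and by [rho]. *)
pose eps := Num.min d1 d2.
have eps0 : 0 < eps by rewrite lt_min d10.
have Keps : K * eps <= theta by apply: le_trans d1P; rewrite ler_wpM2l// ge_min lexx.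
have [Leps1 Lepsr] : L * eps <= 1 /\ L * eps <= rho.
  have : L * eps <= Num.min 1 rho.
    by apply: le_trans d2P; rewrite ler_wpM2l// ge_min lexx orbT.
  by rewrite le_min => /andP[].
have x0n : cball x0 rho x0 by rewrite /cball /= subrr normr0 ltW.
have near_rq p : coord_near c x0 eta p -> rball pbar rq p.
  move=> [qc' qe]; rewrite /rball /= -(chartK pc) -(chartK qc').
  have qr : cball x0 rho (chart c p) by exact: le_trans qe (ltW eta_rho).
  apply: le_trans (rdist_le_line L1 tm x0n qr) _; apply: le_trans r1P.
  by rewrite ler_wpM2l//; exact: le_trans qr rho_r1.
have C0 : 0 <= fejer_const (m := m) L.
  by rewrite addr_ge0 ?mulr_ge0 ?exprn_ge0 ?accel_bound_ge0 ?variation_const_ge0.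
exists rho, eta, L, (fejer_const (m := m) L), eps; split=> //.
- move=> p peps; have cut1 := cutoff_center rho pc (erefl (chart c pbar)).
  have := cutoff_rdist rho0 L1 tm pbar p Mc.
  rewrite -/K (_ : cutoff c x0 rho pbar = 1)//.
  have : K * rdist pbar p <= theta by apply: le_trans Keps; rewrite ler_wpM2l.
  move=> H1 H2; have b0 : 0 < cutoff c x0 rho p by lra.
  have [qc' sq] := cutoff_gt0 rho0 b0; split=> //.
  rewrite /cball /= -ler_sqr ?nnegrE ?(ltW eta0)//.
  apply: le_trans (norm_le_sqdist _ _) _; apply: le_trans sq _.
  have -> : eta ^+ 2 = rho ^+ 2 * theta.
    by rewrite /theta exprMn exprVn mulrCA divff ?mulr1// expf_neq0// lt0r_neq0.
  by rewrite ler_wpM2l ?exprn_ge0 ?(ltW rho0)//; lra.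
- by move=> p q; exact: (rdist_coord_le rho0 L1 tm2 (ltW eta_rho)).
- move=> p q.
  exact: (norm_coord_le_rdist rho0 L1 tm2 eta0 (ltW eta_rho) eta_sq eta_K wc near_rq).
- move=> gam T T0 gn gG Teps.
  apply: (geodesic_stays rho0 L1 tm2 eta0 eta_sq) => //.
  rewrite -/K; apply: (@le_trans _ _ (K * eps)); first by rewrite ler_wpM2l.
  lra.
- move=> p q v gam T pn qn vs gv qp T0 Teps.
  apply: (fejer_step Mc F_C1 rho0 L1 tm2 eta0 _ eta_sq eta_K eta_1 wc qc near_rq) => //.
  + exact: ltW.
  + rewrite -/K; apply: (@le_trans _ _ (K * eps)); first by rewrite ler_wpM2l.
    lra.
  + by apply: le_trans Leps1; rewrite ler_wpM2l.
  + by apply: le_trans Lepsr; rewrite ler_wpM2l.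
Qed.

End FrameExists.

Theorem theorem3p5 (R : realType) (m n : nat) (M : riemannianManifold R m)
  (M_connected : connected [set: M]) (M_complete : geodesically_complete M)
  (F : M -> 'rV[R]_n.+1) (F_C1 : C1_map F)
  (sigma beta Rmax : R) (sigma01 : 0 < sigma < 1) (beta01 : 0 < beta < 1)
  (Rmax1 : 1 <= Rmax)
  (pbar : M) (pbar_critical : pareto_critical F pbar)
  (pbar_qconvex : quasi_convex_around F pbar) :
  forall delta : R, 0 < delta ->
  exists dbar dhat : R,
    [/\ 0 < dbar, 0 < dhat, dbar < dhat, dhat < delta / 2 &
      forall (p : nat -> M) (v : forall k, tangent (p k)) (t : nat -> R)
             (gam : nat -> R -> M),
        inexact_descent F sigma beta Rmax v t gam ->
        (forall k, s_compatible F (v k)) ->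
        rball pbar dbar (p 0%N) ->
        (exists2 L : 'rV[R]_n.+1,
          (F (p k) @[k --> \oo] --> L) & vle (F pbar) L) ->
        exists pstar : M,
          [/\ forall k, rball pbar dhat (p k),
              p k @[k --> \oo] --> pstar &
              (exists2 tau : R, 0 < tau & forall k, tau <= t k) \/
              (exists2 nu : R, 0 < nu < 1 & armijo_steps F beta nu v t gam) ->
              pareto_critical F pstar]].

Proof.
move=> delta delta0.
have [rho [eta [L [C [eps fr]]]]] := exists_fejer_frame M_connected F_C1 pbar_qconvex.
set c := chart_at pbar in fr; set x0 := coords_at pbar in fr.
have pc : dom c pbar := dom_chart_at pbar.
have eps0 := frame_eps0 fr; have L1 := frame_L1 fr; have C0 := frame_C0 fr.
have L0 : 0 <= L by exact: le_trans L1.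
have /andP[b0 b1] := beta01.
pose A := 2 * Rmax / beta.
have A0 : 0 <= A by rewrite divr_ge0 ?(ltW b0)// mulr_ge0// (le_trans _ Rmax1).
pose dhat := Num.min eps (delta / 4).
have dhat0 : 0 < dhat by rewrite lt_min eps0 divr_gt0.
have dhat_eps : dhat <= eps by rewrite ge_min lexx.
have dhat_delta : dhat <= delta / 4 by rewrite ge_min lexx orbT.
(* [k1] keeps every step below [eps]; [k2] lets the Fejer errors use at most half of [dhat ^+ 2],
   leaving the other half to the initial distance. *)
have [k1 k10 k1P] := exists_small_factor A0 (exprn_gt0 2 eps0).
have dhat2 : 0 < dhat ^+ 2 / 2 by rewrite divr_gt0// exprn_gt0.
have [k2 k20 k2P] := exists_small_factor (mulr_ge0 C0 A0) dhat2.
pose kappa := Num.min k1 k2.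
have kappa0 : 0 < kappa by rewrite lt_min k10.
have kappa_k1 : kappa <= k1 by rewrite ge_min lexx.
have kappa_k2 : kappa <= k2 by rewrite ge_min lexx orbT.
have pbarc : C1_at (component F ord0 \o chart_inv c) (chart c pbar).
  by have := component_chart_C1 F_C1 ord0 (cod_chart pc).
have : \forall y \near chart c pbar, `|(component F ord0 \o chart_inv c) (chart c pbar) -
    (component F ord0 \o chart_inv c) y| <= kappa.
  by move/cvgrPdist_le : (C1_at_continuous pbarc) => /(_ _ kappa0).
move=> /near_cball[d d0 dP].
have [z z0 zP] := exists_small_factor L0 d0.
(* [z] brings the coordinates of the initial point within [d] of those of [pbar], where component 0
   varies by at most [kappa]; [dhat / 2] gives [dbar ^+ 2 <= dhat ^+ 2 / 2]. *)
pose dbar := Num.min z (dhat / 2).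
have dbar0 : 0 < dbar by rewrite lt_min z0 divr_gt0.
have dbar_dhat : dbar <= dhat / 2 by rewrite ge_min lexx orbT.
have dbar_z : dbar <= z by rewrite ge_min lexx.
exists dbar, dhat; split=> //; [lra|lra|].
move=> p v t gam alg scomp p0 [l Fl pbarl].
have near_p q : rdist pbar q <= eps -> coord_near c x0 eta q by exact: (frame_near fr).
have kappa_eps : A * kappa <= eps ^+ 2.
  exact: le_trans (ler_wpM2l A0 kappa_k1) k1P.
have kappa_dhat : dbar ^+ 2 + C * (A * kappa) <= dhat ^+ 2.
  have H1 : C * (A * kappa) <= dhat ^+ 2 / 2.
    by rewrite mulrA; exact: le_trans (ler_wpM2l (mulr_ge0 C0 A0) kappa_k2) k2P.
  have H2 : dbar ^+ 2 <= (dhat / 2) ^+ 2 by rewrite lerXn2r ?nnegrE ?(ltW dbar0)// ltW// divr_gt0.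
  have H3 : (dhat / 2) ^+ 2 <= dhat ^+ 2 / 2 by rewrite !expr2; nra.
  lra.
have p0_kappa : F (p 0%N) ord0 ord0 - F pbar ord0 ord0 <= kappa.
  have pn0 : coord_near c x0 eta (p 0%N) by apply: near_p; apply: (le_trans p0); lra.
  have pbn : coord_near c x0 eta pbar.
    by apply: near_p; apply: le_trans (rdist_self_le0 _) _; exact: ltW.
  have H : cball (chart c pbar) d (chart c (p 0%N)).
    apply: le_trans (frame_le_rdist fr pbn pn0) _; apply: le_trans zP.
    by rewrite ler_wpM2l//; exact: le_trans p0 dbar_z.
  have := dP _ H; have [pc0 _] := pn0; rewrite /= !chartK// distrC.
  by apply: le_trans; exact: ler_norm.
have [ps [psn xcvg pcvg]] := iterates_cvg M_connected F_C1 fr sigma01 beta01 Rmax1 alg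
  scomp Fl pbarl (ltW dbar0) (ltW dhat0) dhat_eps kappa_eps kappa_dhat p0 p0_kappa.
have stay := iterates_stay M_connected fr sigma01 beta01 Rmax1 alg
  scomp Fl pbarl (ltW dbar0) (ltW dhat0) dhat_eps kappa_eps kappa_dhat p0 p0_kappa.
exists ps; split=> //.
apply: (limit_critical F_C1 fr sigma01 beta01 Rmax1 alg Fl _ psn xcvg) => k.
exact: near_p (le_trans (stay k) dhat_eps).
Qed.
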